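(* Let $i\in\{6,7,8\}$, let $\Phi_i$ be the root system of type $E_i$, let $q$ be a power of a prime, and let $UE_i=UE_i(q)$. Use the numbering of roots, the arms $a(\alpha)$, the set $R^{\mathrm{normal}}$ and the groups $S_\alpha$, $\overline{T}_\alpha$ specified in the context. For each positive root $\alpha\in\Phi_i^+$: (a) If $\alpha\in\Phi_i^+\setminus R^{\mathrm{normal}}$ then $\Psi_\alpha:\operatorname{Irr}^{\mathrm{lin}}(\overline{T}_\alpha)\times\operatorname{Irr}(X_\alpha)^*\to\operatorname{Irr}^{\mathrm{mida}}(UE_i)_\alpha$, $(\mu,\lambda)\mapsto(\operatorname{Infl}_{\overline{T}_\alpha}^{S_\alpha}\mu\cdot\operatorname{Infl}_{X_\alpha}^{S_\alpha}\lambda)^{UE_i}$, is a one to one correspondence. (b) If $\alpha\in R^{\mathrm{normal}}$ then $\Psi_\alpha:\operatorname{Irr}(\overline{T}_\alpha)\times\operatorname{Irr}(X_\alpha)^*\to\operatorname{Irr}(UE_i)_\alpha$, $(\mu,\lambda)\mapsto(\operatorname{Infl}_{\overline{T}_\alpha}^{S_\alpha}\mu\cdot\operatorname{Infl}_{X_\alpha}^{S_\alpha}\lambda)^{UE_i}$, is a one to one correspondence. Moreover, for $\alpha=\alpha_m$ one has $|\operatorname{Irr}^{\mathrm{mida}}(UE_i)_\alpha|=q^{c}(q-1)$ and $\chi(1)=q^{d}$ for all $\chi\in\operatorname{Irr}^{\mathrm{mida}}(UE_i)_\alpha$, where $m:(c,d)$ is given by the following list. $1$–$8$: $(0,0)$;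 $9$–$15$: $(0,1)$; $16$–$22$: $(1,2)$; $23:(2,3)$; $24:(2,3)$; $25:(4,3)$; $26:(2,3)$; $27:(2,3)$; $28:(2,3)$; $29:(2,3)$; $30:(5,4)$; $31:(3,4)$; $32:(3,4)$; $33:(5,4)$; $34:(3,4)$; $35:(3,4)$; $36:(3,4)$; $37:(5,5)$; $38:(6,5)$; $39:(4,5)$; $40:(5,5)$; $41:(6,5)$; $42:(4,5)$; $43:(4,5)$; $44:(4,6)$; $45:(7,6)$; $46:(7,6)$; $47:(5,6)$; $48:(4,6)$; $49:(6,6)$; $50:(7,6)$; $51:(6,7)$; $52:(6,7)$; $53:(8,7)$; $54:(8,7)$; $55:(6,7)$; $56:(7,7)$; $57:(6,8)$; $58:(7,8)$; $59:(8,8)$; $60:(9,8)$; $61:(5,8)$; $62:(7,8)$; $63:(6,9)$; $64:(8,9)$; $65:(8,9)$; $66:(7,9)$; $67:(9,9)$; $68:(7,9)$; $69:(5,10)$; $70:(8,10)$; $71:(7,10)$; $72:(9,10)$; $73:(9,10)$; $74:(6,10)$; $75:(7,11)$; $76:(8,11)$; $77:(9,11)$; $78:(9,11)$; $79:(8,11)$; $80:(7,12)$; $81:(8,12)$; $82:(7,12)$; $83:(10,12)$; $84:(8,12)$; $85:(7,13)$; $86:(9,13)$; $87:(9,13)$; $88:(9,13)$; $89:(7,14)$; $90:(9,14)$; $91:(8,14)$; $92:(9,14)$; $93:(7,15)$; $94:(9,15)$; $95:(9,15)$; $96:(8,15)$; $97:(6,16)$; $98:(9,16)$; $99:(9,16)$;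 $100:(8,16)$; $101:(8,17)$; $102:(9,17)$; $103:(9,17)$; $104:(8,18)$; $105:(9,18)$; $106:(8,18)$; $107:(8,19)$; $108:(9,19)$; $109:(8,20)$; $110:(9,20)$; $111:(9,21)$; $112:(8,21)$; $113:(8,22)$; $114:(8,22)$; $115:(8,23)$; $116:(8,24)$; $117:(8,25)$; $118:(8,26)$; $119:(8,27)$; $120:(7,28)$.
   Context: General notation. For an irreducible root system $\Phi$ with positive roots $\Phi^+$ let $X_\gamma=\{x_\gamma(t)\mid t\in\mathbb{F}_q\}$ be the root subgroups of the untwisted Chevalley group over $\mathbb{F}_q$ of that type, and $U=\langle X_\gamma\mid\gamma\in\Phi^+\rangle$ (denoted $UE_i$ for type $E_i$). Write $\beta\preceq\alpha$ if $\alpha-\beta$ is $0$ or a sum of positive roots. $S\subseteq\Phi^+$ is a closed pattern if $\beta,\gamma\in S$, $\beta+\gamma\in\Phi^+$ imply $\beta+\gamma\in S$; then $P(S)=\langle X_\gamma\mid\gamma\in S\rangle$. For $N\subseteq S$, $S$ a closed pattern, $N\unlhd S$ means: $\beta\in N,\gamma\in S,\beta+\gamma\in\Phi^+$ imply $\beta+\gamma\in N$ (then $P(N)$ is normal in $P(S)$); the normal closure of $M\subseteq S$ in $S$ is the smallest $N\unlhd S$ containing $M$. $k(\alpha)=\{\beta\in\Phi^+\mid\beta\not\preceq\alpha\}$ (the largest $N\unlhd\Phi^+$ not containing $\alpha$); $h(\alpha)=\{\gamma\in\Phi^+\mid\alpha-\gamma\in\Phi^+\cup\{0\}\}$. Given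 a subset $a(\alpha)\subset h(\alpha)\setminus\{\alpha\}$ (arm) containing exactly one of $\gamma,\alpha-\gamma$ for each $\gamma\in h(\alpha)\setminus\{\alpha\}$, the leg is $\ell(\alpha)=\{\alpha-\gamma\mid\gamma\in a(\alpha)\}$ and the source $s(\alpha)=\Phi^+\setminus a(\alpha)$. With the arms below, $s(\alpha)$ is a closed pattern and $S_\alpha=P(s(\alpha))$. If $\alpha\in R^{\mathrm{normal}}$, then $\ell(\alpha)\cup k(\alpha)\unlhd s(\alpha)$ and $\overline{T}_\alpha=S_\alpha/P(\{\alpha\}\cup\ell(\alpha)\cup k(\alpha))$. If $\alpha\notin R^{\mathrm{normal}}$, let $\bar{\ell}(\alpha)=M\setminus k(\alpha)$ with $M$ the normal closure of $\ell(\alpha)\cup k(\alpha)$ in $s(\alpha)$, and $\overline{T}_\alpha=S_\alpha/P(\{\alpha\}\cup\bar{\ell}(\alpha)\cup k(\alpha))$. The group $X_\alpha$ is identified with $S_\alpha/P(s(\alpha)\setminus\{\alpha\})$ and $\operatorname{Infl}_{X_\alpha}^{S_\alpha}$ is inflation along this quotient. All these notions are taken inside $\Phi_i$. $\operatorname{Irr}(G)$: complex irreducible characters; $\operatorname{Irr}^{\mathrm{lin}}(G)$: those of degree 1; $\operatorname{Irr}(G)^*=\operatorname{Irr}(G)\setminus\{\mathbf 1_G\}$; $\lambda^U$: induction. $\operatorname{rs}(\chi)=\{\gamma\in\Phi^+\mid X_\gamma\subseteq Z(\chi),X_\gamma\not\subseteq\ker\chi\}$; $\operatorname{Irr}(U)_\alpha=\{\chi\in\operatorname{Irr}(U)\mid\operatorname{rs}(\chi)=\{\alpha\}\}$;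 $\operatorname{Irr}^{\mathrm{mida}}(U)_\alpha$: the elements of minimal degree in $\operatorname{Irr}(U)_\alpha$. Numbering. Simple roots of $\Phi_8$ (type $E_8$): $\alpha_1,\dots,\alpha_8$, with Dynkin diagram edges $1-3$, $3-4$, $4-5$, $5-6$, $6-7$, $7-8$, $2-4$. The positive roots are $\alpha_1,\dots,\alpha_{120}$, ordered by increasing height $\sum m_j$ where the root is $\sum_jm_j\alpha_j$, and among roots of equal height in decreasing lexicographic order of $(m_1,\dots,m_8)$ (e.g. $\alpha_9=\alpha_1+\alpha_3$, $\alpha_{10}=\alpha_2+\alpha_4$). $\Phi_6$, $\Phi_7$ are the subsystems generated by $\alpha_1,\dots,\alpha_6$ and $\alpha_1,\dots,\alpha_7$, with $\Phi_i^+=\Phi_8^+\cap\Phi_i$. For roots in $\Phi_i^+$ these labels $\alpha_m$ are kept. $R^{\mathrm{normal}}=\Phi_8^+\setminus\{\alpha_m\mid m\in\{$45, 53, 57, 59, 60, 64, 67, 70, 71, 72, 73, 76, 77, 78, 80, 83, 84, 85, 86, 87, 88, 89, 90, 91, 92, 94, 95, 98, 99, 100, 102, 103, 104, 105, 106, 107, 108, 109, 110, 111, 113, 114, 115, 116, 117, 118$\}\}$; statement (b) concerns $\alpha\in\Phi_i^+\cap R^{\mathrm{normal}}$. Arms: for each $m$ the indices $j$ of the roots $\alpha_j\in a(\alpha_m)$. 1–8: empty. 9: 3. 10: 4. 11: 4. 12: 5. 13: 6. 14: 6. 15: 7. 16: 1,4. 17: 2,3. 18: 2,5. 19: 3,5.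 20: 4,6. 21: 5,7. 22: 6,8. 23: 1,2,10. 24: 1,5,12. 25: 2,3,5. 26: 2,6,13. 27: 3,6,13. 28: 4,7,12. 29: 5,8,13. 30: 1,2,5,9. 31: 1,6,9,13. 32: 4,10,11,12. 33: 2,3,6,13. 34: 2,7,10,14. 35: 3,7,11,14. 36: 4,8,12,15. 37: 1,4,10,12,18. 38: 1,2,6,9,13. 39: 1,7,9,14,16. 40: 4,6,10,11,17. 41: 2,3,7,14,21. 42: 2,8,10,15,18. 43: 3,8,11,15,19. 44: 3,9,11,16,17,19. 45: 1,4,6,10,16,20. 46: 1,2,7,9,14,21. 47: 1,8,9,15,16,22. 48: 5,12,13,18,19,20. 49: 4,7,10,11,14,17. 50: 2,3,8,15,22,29. 51: 3,6,9,11,16,17,23. 52: 1,5,12,13,18,20,26. 53: 1,4,7,10,14,16,23. 54: 1,2,8,9,15,22,29. 55: 5,7,12,18,19,25,32. 56: 4,8,10,11,15,17,22. 57: 3,5,9,13,19,24,25,30. 58: 3,7,9,11,14,16,17,23. 59: 1,5,7,12,18,21,28,34. 60: 1,4,8,10,15,16,22,23. 61: 6,13,14,20,21,26,27,28. 62: 5,8,12,15,18,19,25,32. 63: 4,11,12,16,19,20,24,27,31. 64: 3,5,7,9,19,21,24,25,30. 65: 3,8,9,11,15,16,17,22,23. 66: 1,6,13,14,20,21,26,28,34. 67: 1,5,8,12,15,18,24,30,37. 68: 6,8,13,20,26,27,33,40,48. 69: 2,10,17,18,23,25,26,30,32,33. 70: 4,7,11,12,16,19,24,32,37,44. 71: 3,6,9,13,14,21,27,31,33,38.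 72: 3,5,8,9,15,19,24,25,29,30. 73: 1,6,8,13,20,22,26,29,36,42. 74: 7,14,15,21,22,28,29,34,35,36. 75: 2,7,10,17,18,23,25,30,32,37,44. 76: 4,6,11,14,16,20,27,28,31,35,39. 77: 4,8,11,12,15,16,19,24,32,37,44. 78: 3,6,8,9,13,22,27,29,31,33,38. 79: 1,7,14,15,21,22,28,29,34,36,42. 80: 2,6,10,14,17,23,26,33,38,40,45,51. 81: 2,8,10,15,17,18,23,25,30,32,37,44. 82: 5,12,13,19,20,21,24,27,28,31,35,39. 83: 4,6,8,11,16,20,22,27,31,40,45,51. 84: 3,7,9,14,15,21,22,29,35,39,41,46. 85: 2,5,13,18,21,25,26,30,33,34,38,41,46. 86: 2,6,8,10,17,22,23,26,33,38,40,45,51. 87: 5,8,12,13,19,20,24,27,31,48,52,57,63. 88: 4,7,11,14,15,16,22,28,35,39,49,53,58. 89: 4,10,12,18,20,26,28,32,34,37,40,45,49,53. 90: 2,5,8,13,18,25,26,29,30,33,38,48,52,57. 91: 2,7,10,14,15,17,22,23,34,41,46,49,53,58. 92: 5,7,12,15,19,21,24,28,29,35,36,39,43,47. 93: 3,11,17,19,25,27,32,33,35,40,41,48,49,55,61. 94: 4,8,10,12,18,20,26,32,37,40,45,48,52,63,69. 95: 2,5,7,15,18,21,25,29,30,34,41,46,55,59,64. 96: 6,13,14,20,21,22,27,28,29,31,35,36,39,43,47. 97: 1,9,16,23,24,30,31,37,38,39,44,45,46,51,52,53. 98: 3,8,11,17,19,25,27,32,33,40,44,48,51,57,63,69. 99: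 4,7,10,12,15,18,28,32,34,36,37,42,49,53,55,59. 100: 2,6,13,14,21,22,26,29,33,34,38,41,42,46,50,54. 101: 1,8,9,16,23,24,30,31,37,38,44,45,51,52,57,63,69. 102: 3,7,11,15,17,19,25,32,35,41,43,44,49,50,55,56,62. 103: 4,6,10,14,20,22,26,28,34,36,40,42,45,49,53,56,60. 104: 1,7,9,15,16,23,24,30,37,39,44,46,53,58,59,64,70,75. 105: 3,6,11,14,17,22,27,33,35,40,41,43,49,50,51,56,58,65. 106: 5,12,13,18,20,21,26,28,29,34,36,42,48,52,55,59,61,66. 107: 1,6,9,14,16,22,23,31,38,39,45,46,47,51,53,54,58,60,65. 108: 3,5,13,19,21,25,27,29,33,35,41,43,48,50,55,57,62,64,72. 109: 1,5,9,13,21,24,29,30,31,38,39,46,47,52,54,57,59,64,66,71. 110: 4,11,12,19,20,27,28,32,35,36,40,43,48,49,55,56,61,62,68,74. 111: 1,4,12,16,20,24,28,31,36,37,39,45,47,52,53,59,60,63,66,67,70. 112: 2,10,17,18,25,26,32,33,34,40,41,42,48,49,50,55,56,61,62,68,74. 113: 1,2,10,18,23,26,30,34,37,38,42,45,46,52,53,54,59,60,66,67,73,79. 114: 3,9,11,16,19,24,27,31,35,39,43,44,47,51,57,58,63,64,70,71,76,82. 115: 2,3,9,17,23,25,30,33,38,41,44,46,50,51,54,57,58,64,65,71,72,78,84. 116: 4,10,11,16,17,23,32,37,40,44,45,49,51,53,56,58,60,63,65,70,76,77,83,88. 117: 5,12,18,19,24,25,30,32,37,44,48,52,55,57,59,62,63,64,67,69,70,72,75,77,81.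 118: 6,13,20,26,27,31,33,38,40,45,48,51,52,57,61,63,66,68,69,71,73,76,78,82,83,87. 119: 7,14,21,28,34,35,39,41,46,49,53,55,58,59,61,64,66,70,71,75,76,80,82,85,89,93,97. 120: 8,15,22,29,36,42,43,47,50,54,56,60,62,65,67,68,72,73,74,77,78,79,81,83,84,86,87,88. *)

(* Defs.v *)
From HB Require Import structures.
From mathcomp Require Import all_boot all_order all_algebra all_fingroup.
From mathcomp Require Import all_solvable all_field all_character.
From mathcomp Require Import boolp.

Set Implicit Arguments.
Unset Strict Implicit.
Unset Printing Implicit Defensive.

Import Order.TTheory GRing.Theory Num.Theory.

Local Open Scope ring_scope.

(* Elements of the root lattice of E8 are lists of eight integers, the
   coordinates in the basis of simple roots; nodes are numbered from 1, so the
   coordinate at node j is the entry of index j.-1. Sums are written with foldr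
   rather than with bigops (which are locked) so that everything about the root
   systems can be evaluated. *)

Definition nodes (i : nat) : seq nat := iota 1%N i.

Definition edges : seq (nat * nat) :=
  [:: (1, 3); (3, 4); (4, 5); (5, 6); (6, 7); (7, 8); (2, 4)]%N.

Definition cartan (j k : nat) : int :=
  if j == k then 2
  else if ((j, k) \in edges) || ((k, j) \in edges) then -1 else 0.

Definition coord (v : seq int) (j : nat) : int := v`_j.-1.

Definition addv (u v : seq int) : seq int :=
  [seq coord u j + coord v j | j <- nodes 8].

Definition scalev (c : int) (v : seq int) : seq int :=
  [seq c * coord v j | j <- nodes 8].

Definition zerov : seq int := nseq 8 0.

Definition simple (j : nat) : seq int :=
  [seq ((k == j) : nat)%:Z | k <- nodes 8].

Definition form (u v : seq int) : int :=
  foldr +%R 0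
    [seq coord u j * cartan j k * coord v k | j <- nodes 8, k <- nodes 8].

Definition reflect_simple (j : nat) (v : seq int) : seq int :=
  addv v (scalev (- form v (simple j)) (simple j)).

(* Adds to s the vectors obtained from those of its part front by at most n
   reflections in the simple roots 1, ..., i. *)
Fixpoint reflection_closure (i n : nat) (s front : seq (seq int)) :=
  if n is n'.+1 then
    let images := [seq reflect_simple j v | j <- nodes i, v <- front] in
    let new := undup [seq v <- images | v \notin s] in
    reflection_closure i n' (s ++ new) new
  else s.

(* The orbit of the simple roots 1, ..., i under the group generated by their
   reflections: by Phi_closed below, 30 rounds exhaust it. *)
Definition Phi (i : nat) : seq (seq int) :=
  let s := [seq simple j | j <- nodes i] in reflection_closure i 30%N s s.

Definition height (v : seq int) : int := foldr +%R 0 v.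

Fixpoint lexgt (u v : seq int) : bool :=
  match u, v with
  | x :: u', y :: v' => (y < x) || (x == y) && lexgt u' v'
  | _, _ => false
  end.

Definition root_order (u v : seq int) : bool :=
  (height u < height v) || (height u == height v) && ((u == v) || lexgt u v).

Definition Phi8_pos : seq (seq int) :=
  sort root_order [seq v <- Phi 8 | all (fun c => 0 <= c) v].

Definition Phi_pos (i : nat) : seq (seq int) :=
  let s := Phi i in [seq v <- Phi8_pos | v \in s].

Lemma Phi_closed :
  all (fun i => let s := Phi i in
       all (fun v => all (fun j => reflect_simple j v \in s) (nodes i)) s)
    [:: 6; 7; 8]%N.
Proof. by vm_cast_no_check (erefl true). Qed.

Lemma size_Phi : [seq size (Phi i) | i <- [:: 6; 7; 8]%N] = [:: 72; 126; 240]%N.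
Proof. by vm_cast_no_check (erefl [:: 72; 126; 240]%N). Qed.

Lemma size_Phi_pos :
  [seq size (Phi_pos i) | i <- [:: 6; 7; 8]%N] = [:: 36; 63; 120]%N.
Proof. by vm_cast_no_check (erefl [:: 36; 63; 120]%N). Qed.

Definition posroot (i : nat) : Type := seq_sub (Phi_pos i).

HB.instance Definition _ (i : nat)
  := Finite.copy (posroot i) (seq_sub (Phi_pos i)).

Definition vec (i : nat) (alpha : posroot i) : seq int := ssval alpha.

(* The number m of the root alpha_m. *)
Definition label (i : nat) (alpha : posroot i) : nat :=
  (index (vec alpha) Phi8_pos).+1.

Definition nonnormal_labels : seq nat := [::
  45; 53; 57; 59; 60; 64; 67; 70; 71; 72; 73; 76; 77; 78; 80; 83; 84; 85;
  86; 87; 88; 89; 90; 91; 92; 94; 95; 98; 99; 100; 102; 103; 104; 105;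
  106; 107; 108; 109; 110; 111; 113; 114; 115; 116; 117; 118]%N.

(* The entry of index m.-1 contains the labels of the roots in the arm of
   alpha_m. *)
Definition arm_table : seq (seq nat) := [::
  (* 1 *) [::]; [::]; [::]; [::]; [::]; [::]; [::]; [::];
  (* 9 *) [:: 3];
  (* 10 *) [:: 4];
  (* 11 *) [:: 4];
  (* 12 *) [:: 5];
  (* 13 *) [:: 6];
  (* 14 *) [:: 6];
  (* 15 *) [:: 7];
  (* 16 *) [:: 1; 4];
  (* 17 *) [:: 2; 3];
  (* 18 *) [:: 2; 5];
  (* 19 *) [:: 3; 5];
  (* 20 *) [:: 4; 6];
  (* 21 *) [:: 5; 7];
  (* 22 *) [:: 6; 8];
  (* 23 *) [:: 1; 2; 10];
  (* 24 *) [:: 1; 5; 12];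
  (* 25 *) [:: 2; 3; 5];
  (* 26 *) [:: 2; 6; 13];
  (* 27 *) [:: 3; 6; 13];
  (* 28 *) [:: 4; 7; 12];
  (* 29 *) [:: 5; 8; 13];
  (* 30 *) [:: 1; 2; 5; 9];
  (* 31 *) [:: 1; 6; 9; 13];
  (* 32 *) [:: 4; 10; 11; 12];
  (* 33 *) [:: 2; 3; 6; 13];
  (* 34 *) [:: 2; 7; 10; 14];
  (* 35 *) [:: 3; 7; 11; 14];
  (* 36 *) [:: 4; 8; 12; 15];
  (* 37 *) [:: 1; 4; 10; 12; 18];
  (* 38 *) [:: 1; 2; 6; 9; 13];
  (* 39 *) [:: 1; 7; 9; 14; 16];
  (* 40 *) [:: 4; 6; 10; 11; 17];
  (* 41 *) [:: 2; 3; 7; 14; 21];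
  (* 42 *) [:: 2; 8; 10; 15; 18];
  (* 43 *) [:: 3; 8; 11; 15; 19];
  (* 44 *) [:: 3; 9; 11; 16; 17; 19];
  (* 45 *) [:: 1; 4; 6; 10; 16; 20];
  (* 46 *) [:: 1; 2; 7; 9; 14; 21];
  (* 47 *) [:: 1; 8; 9; 15; 16; 22];
  (* 48 *) [:: 5; 12; 13; 18; 19; 20];
  (* 49 *) [:: 4; 7; 10; 11; 14; 17];
  (* 50 *) [:: 2; 3; 8; 15; 22; 29];
  (* 51 *) [:: 3; 6; 9; 11; 16; 17; 23];
  (* 52 *) [:: 1; 5; 12; 13; 18; 20; 26];
  (* 53 *) [:: 1; 4; 7; 10; 14; 16; 23];
  (* 54 *) [:: 1; 2; 8; 9; 15; 22; 29];
  (* 55 *) [:: 5; 7; 12; 18; 19; 25; 32];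
  (* 56 *) [:: 4; 8; 10; 11; 15; 17; 22];
  (* 57 *) [:: 3; 5; 9; 13; 19; 24; 25; 30];
  (* 58 *) [:: 3; 7; 9; 11; 14; 16; 17; 23];
  (* 59 *) [:: 1; 5; 7; 12; 18; 21; 28; 34];
  (* 60 *) [:: 1; 4; 8; 10; 15; 16; 22; 23];
  (* 61 *) [:: 6; 13; 14; 20; 21; 26; 27; 28];
  (* 62 *) [:: 5; 8; 12; 15; 18; 19; 25; 32];
  (* 63 *) [:: 4; 11; 12; 16; 19; 20; 24; 27; 31];
  (* 64 *) [:: 3; 5; 7; 9; 19; 21; 24; 25; 30];
  (* 65 *) [:: 3; 8; 9; 11; 15; 16; 17; 22; 23];
  (* 66 *) [:: 1; 6; 13; 14; 20; 21; 26; 28; 34];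
  (* 67 *) [:: 1; 5; 8; 12; 15; 18; 24; 30; 37];
  (* 68 *) [:: 6; 8; 13; 20; 26; 27; 33; 40; 48];
  (* 69 *) [:: 2; 10; 17; 18; 23; 25; 26; 30; 32; 33];
  (* 70 *) [:: 4; 7; 11; 12; 16; 19; 24; 32; 37; 44];
  (* 71 *) [:: 3; 6; 9; 13; 14; 21; 27; 31; 33; 38];
  (* 72 *) [:: 3; 5; 8; 9; 15; 19; 24; 25; 29; 30];
  (* 73 *) [:: 1; 6; 8; 13; 20; 22; 26; 29; 36; 42];
  (* 74 *) [:: 7; 14; 15; 21; 22; 28; 29; 34; 35; 36];
  (* 75 *) [:: 2; 7; 10; 17; 18; 23; 25; 30; 32; 37; 44];
  (* 76 *) [:: 4; 6; 11; 14; 16; 20; 27; 28; 31; 35; 39];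
  (* 77 *) [:: 4; 8; 11; 12; 15; 16; 19; 24; 32; 37; 44];
  (* 78 *) [:: 3; 6; 8; 9; 13; 22; 27; 29; 31; 33; 38];
  (* 79 *) [:: 1; 7; 14; 15; 21; 22; 28; 29; 34; 36; 42];
  (* 80 *) [:: 2; 6; 10; 14; 17; 23; 26; 33; 38; 40; 45; 51];
  (* 81 *) [:: 2; 8; 10; 15; 17; 18; 23; 25; 30; 32; 37; 44];
  (* 82 *) [:: 5; 12; 13; 19; 20; 21; 24; 27; 28; 31; 35; 39];
  (* 83 *) [:: 4; 6; 8; 11; 16; 20; 22; 27; 31; 40; 45; 51];
  (* 84 *) [:: 3; 7; 9; 14; 15; 21; 22; 29; 35; 39; 41; 46];
  (* 85 *) [:: 2; 5; 13; 18; 21; 25; 26; 30; 33; 34; 38; 41; 46];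
  (* 86 *) [:: 2; 6; 8; 10; 17; 22; 23; 26; 33; 38; 40; 45; 51];
  (* 87 *) [:: 5; 8; 12; 13; 19; 20; 24; 27; 31; 48; 52; 57; 63];
  (* 88 *) [:: 4; 7; 11; 14; 15; 16; 22; 28; 35; 39; 49; 53; 58];
  (* 89 *) [:: 4; 10; 12; 18; 20; 26; 28; 32; 34; 37; 40; 45; 49; 53];
  (* 90 *) [:: 2; 5; 8; 13; 18; 25; 26; 29; 30; 33; 38; 48; 52; 57];
  (* 91 *) [:: 2; 7; 10; 14; 15; 17; 22; 23; 34; 41; 46; 49; 53; 58];
  (* 92 *) [:: 5; 7; 12; 15; 19; 21; 24; 28; 29; 35; 36; 39; 43; 47];
  (* 93 *) [:: 3; 11; 17; 19; 25; 27; 32; 33; 35; 40; 41; 48; 49; 55; 61];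
  (* 94 *) [:: 4; 8; 10; 12; 18; 20; 26; 32; 37; 40; 45; 48; 52; 63; 69];
  (* 95 *) [:: 2; 5; 7; 15; 18; 21; 25; 29; 30; 34; 41; 46; 55; 59; 64];
  (* 96 *) [:: 6; 13; 14; 20; 21; 22; 27; 28; 29; 31; 35; 36; 39; 43; 47];
  (* 97 *) [:: 1; 9; 16; 23; 24; 30; 31; 37; 38; 39; 44; 45; 46; 51; 52; 53];
  (* 98 *) [:: 3; 8; 11; 17; 19; 25; 27; 32; 33; 40; 44; 48; 51; 57; 63; 69];
  (* 99 *) [:: 4; 7; 10; 12; 15; 18; 28; 32; 34; 36; 37; 42; 49; 53; 55; 59];
  (* 100 *) [:: 2; 6; 13; 14; 21; 22; 26; 29; 33; 34; 38; 41; 42; 46; 50; 54];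
  (* 101 *) [:: 1; 8; 9; 16; 23; 24; 30; 31; 37; 38; 44; 45; 51; 52; 57; 63;
    69];
  (* 102 *) [:: 3; 7; 11; 15; 17; 19; 25; 32; 35; 41; 43; 44; 49; 50; 55; 56;
    62];
  (* 103 *) [:: 4; 6; 10; 14; 20; 22; 26; 28; 34; 36; 40; 42; 45; 49; 53; 56;
    60];
  (* 104 *) [:: 1; 7; 9; 15; 16; 23; 24; 30; 37; 39; 44; 46; 53; 58; 59; 64;
    70; 75];
  (* 105 *) [:: 3; 6; 11; 14; 17; 22; 27; 33; 35; 40; 41; 43; 49; 50; 51; 56;
    58; 65];
  (* 106 *) [:: 5; 12; 13; 18; 20; 21; 26; 28; 29; 34; 36; 42; 48; 52; 55; 59;
    61; 66];
  (* 107 *) [:: 1; 6; 9; 14; 16; 22; 23; 31; 38; 39; 45; 46; 47; 51; 53; 54;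
    58; 60; 65];
  (* 108 *) [:: 3; 5; 13; 19; 21; 25; 27; 29; 33; 35; 41; 43; 48; 50; 55; 57;
    62; 64; 72];
  (* 109 *) [:: 1; 5; 9; 13; 21; 24; 29; 30; 31; 38; 39; 46; 47; 52; 54; 57;
    59; 64; 66; 71];
  (* 110 *) [:: 4; 11; 12; 19; 20; 27; 28; 32; 35; 36; 40; 43; 48; 49; 55; 56;
    61; 62; 68; 74];
  (* 111 *) [:: 1; 4; 12; 16; 20; 24; 28; 31; 36; 37; 39; 45; 47; 52; 53; 59;
    60; 63; 66; 67; 70];
  (* 112 *) [:: 2; 10; 17; 18; 25; 26; 32; 33; 34; 40; 41; 42; 48; 49; 50; 55;
    56; 61; 62; 68; 74];
  (* 113 *) [:: 1; 2; 10; 18; 23; 26; 30; 34; 37; 38; 42; 45; 46; 52; 53; 54;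
    59; 60; 66; 67; 73; 79];
  (* 114 *) [:: 3; 9; 11; 16; 19; 24; 27; 31; 35; 39; 43; 44; 47; 51; 57; 58;
    63; 64; 70; 71; 76; 82];
  (* 115 *) [:: 2; 3; 9; 17; 23; 25; 30; 33; 38; 41; 44; 46; 50; 51; 54; 57;
    58; 64; 65; 71; 72; 78; 84];
  (* 116 *) [:: 4; 10; 11; 16; 17; 23; 32; 37; 40; 44; 45; 49; 51; 53; 56; 58;
    60; 63; 65; 70; 76; 77; 83; 88];
  (* 117 *) [:: 5; 12; 18; 19; 24; 25; 30; 32; 37; 44; 48; 52; 55; 57; 59; 62;
    63; 64; 67; 69; 70; 72; 75; 77; 81];
  (* 118 *) [:: 6; 13; 20; 26; 27; 31; 33; 38; 40; 45; 48; 51; 52; 57; 61; 63;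
    66; 68; 69; 71; 73; 76; 78; 82; 83; 87];
  (* 119 *) [:: 7; 14; 21; 28; 34; 35; 39; 41; 46; 49; 53; 55; 58; 59; 61; 64;
    66; 70; 71; 75; 76; 80; 82; 85; 89; 93; 97];
  (* 120 *) [:: 8; 15; 22; 29; 36; 42; 43; 47; 50; 54; 56; 60; 62; 65; 67; 68;
    72; 73; 74; 77; 78; 79; 81; 83; 84; 86; 87; 88]]%N.

(* The pairs (c, d) for which |Irr^mida(U)_alpha| = q^c (q - 1), with all
   degrees q^d. *)
Definition cd_table : seq (nat * nat) := [::
  (* 1 *) (0, 0); (0, 0); (0, 0); (0, 0); (0, 0);
  (* 6 *) (0, 0); (0, 0); (0, 0); (0, 1); (0, 1);
  (* 11 *) (0, 1); (0, 1); (0, 1); (0, 1); (0, 1);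
  (* 16 *) (1, 2); (1, 2); (1, 2); (1, 2); (1, 2);
  (* 21 *) (1, 2); (1, 2); (2, 3); (2, 3); (4, 3);
  (* 26 *) (2, 3); (2, 3); (2, 3); (2, 3); (5, 4);
  (* 31 *) (3, 4); (3, 4); (5, 4); (3, 4); (3, 4);
  (* 36 *) (3, 4); (5, 5); (6, 5); (4, 5); (5, 5);
  (* 41 *) (6, 5); (4, 5); (4, 5); (4, 6); (7, 6);
  (* 46 *) (7, 6); (5, 6); (4, 6); (6, 6); (7, 6);
  (* 51 *) (6, 7); (6, 7); (8, 7); (8, 7); (6, 7);
  (* 56 *) (7, 7); (6, 8); (7, 8); (8, 8); (9, 8);
  (* 61 *) (5, 8); (7, 8); (6, 9); (8, 9); (8, 9);
  (* 66 *) (7, 9); (9, 9); (7, 9); (5, 10); (8, 10);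
  (* 71 *) (7, 10); (9, 10); (9, 10); (6, 10); (7, 11);
  (* 76 *) (8, 11); (9, 11); (9, 11); (8, 11); (7, 12);
  (* 81 *) (8, 12); (7, 12); (10, 12); (8, 12); (7, 13);
  (* 86 *) (9, 13); (9, 13); (9, 13); (7, 14); (9, 14);
  (* 91 *) (8, 14); (9, 14); (7, 15); (9, 15); (9, 15);
  (* 96 *) (8, 15); (6, 16); (9, 16); (9, 16); (8, 16);
  (* 101 *) (8, 17); (9, 17); (9, 17); (8, 18); (9, 18);
  (* 106 *) (8, 18); (8, 19); (9, 19); (8, 20); (9, 20);
  (* 111 *) (9, 21); (8, 21); (8, 22); (8, 22); (8, 23);
  (* 116 *) (8, 24); (8, 25); (8, 26); (8, 27); (7, 28)]%N.

Definition mida_exp (i : nat) (alpha : posroot i) : nat * nat :=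
  nth (0, 0)%N cd_table (label alpha).-1.

Section Patterns.

Variable i : nat.
Implicit Types (alpha beta gamma delta : posroot i) (M N S : {set posroot i}).

Definition is_sum gamma delta alpha : bool :=
  vec alpha == addv (vec gamma) (vec delta).

(* The empty list is allowed: it is the case alpha - beta = 0. *)
Definition preceq beta alpha : Prop :=
  exists s : seq (posroot i),
    vec alpha = foldr addv (vec beta) [seq vec gamma | gamma <- s].

Definition normal_pattern N S : bool :=
  (N \subset S) &&
  [forall beta in N, forall gamma in S, forall delta,
     is_sum beta gamma delta ==> (delta \in N)].

Definition normal_closure M S : {set posroot i} :=
  \bigcap_(N : {set posroot i} | normal_pattern N S && (M \subset N)) N.

Definition Rnormal : {set posroot i} :=
  [set alpha | label alpha \notin nonnormal_labels].

Definition arm alpha : {set posroot i} :=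
  [set gamma | label gamma \in nth [::] arm_table (label alpha).-1].

Definition leg alpha : {set posroot i} :=
  [set delta | [exists gamma in arm alpha, is_sum gamma delta alpha]].

Definition source alpha : {set posroot i} := ~: arm alpha.

Definition kset alpha : {set posroot i} :=
  [set beta | ~~ `[< preceq beta alpha >]].

Definition leg_bar alpha : {set posroot i} :=
  normal_closure (leg alpha :|: kset alpha) (source alpha) :\: kset alpha.

Definition Tbar_kernel alpha : {set posroot i} :=
  if alpha \in Rnormal then alpha |: (leg alpha :|: kset alpha)
  else alpha |: (leg_bar alpha :|: kset alpha).

End Patterns.

(* The Lie algebra of type E_i has the basis h_1, ..., h_i (inl, the simple
   coroots) and e_delta for the roots delta (inr). Its structure constants are
   given by the Frenkel-Kac cocycle eps, a bimultiplicative function with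
   eps(u, u) = (-1)^((u, u)/2) and eps(u, v) eps(v, u) = (-1)^(u, v):
     [h, e_delta] = <delta, h> e_delta,
     [e_gamma, e_delta] = eps(gamma, delta) e_(gamma + delta)
       if gamma + delta is a root,
     [e_gamma, e_(-gamma)] = - h_gamma,
   where h_gamma is the coroot of gamma, whose coordinates are those of gamma
   as the diagram is simply laced. Up to replacing e_delta by - e_delta for the
   negative roots delta this is a Chevalley basis; root subgroups do not depend
   on such signs. *)
Definition eps (u v : seq int) : int :=
  (-1) ^ (foldr +%R 0
    [seq (if (j == k) || ((j, k) \in edges) then coord u j * coord v k else 0)
       | j <- nodes 8, k <- nodes 8]).

Definition lie_basis (i : nat) : seq (nat + seq int) :=
  [seq inl j | j <- nodes i] ++ [seq inr delta | delta <- Phi i].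

(* The coefficient of b' in [e_gamma, b]. *)
Definition bracket (gamma : seq int) (b' b : nat + seq int) : int :=
  match b', b with
  | inl _, inl _ => 0
  | inr delta', inl j => if delta' == gamma then - form gamma (simple j) else 0
  | inl j, inr delta =>
      if addv gamma delta == zerov then - coord gamma j else 0
  | inr delta', inr delta =>
      if delta' == addv gamma delta then eps gamma delta else 0
  end.

(* The basis has (lie_dim i).+1 elements; 'GL_n requires a successor. *)
Definition lie_dim (i : nat) : nat := (size (lie_basis i)).-1.

(* The matrix of ad e_gamma, acting on column vectors. *)
Definition ad (i : nat) (gamma : seq int) : 'M[int]_((lie_dim i).+1) :=
  \matrix_(a, b) bracket gamma (nth (inl 0%N) (lie_basis i) a)
                               (nth (inl 0%N) (lie_basis i) b).

Section Groups.

Variables (i : nat) (F : finFieldType).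
Implicit Types (alpha gamma : posroot i).

(* exp(t ad e_gamma), in which (ad e_gamma)^k / k! is an integral matrix for
   all k and vanishes for k >= 3. *)
Definition root_elt gamma (t : F) : 'M[F]_((lie_dim i).+1) :=
  \sum_(k < 3) t ^+ k *:
    map_mx (fun z : int => (z %/ (k`!)%:Z)%Z%:~R) (ad i (vec gamma) ^+ k).

Local Notation gT := {'GL_((lie_dim i).+1)[F]}.

Definition root_subgroup gamma : {set gT} :=
  [set g | [exists t : F, GLval g == root_elt gamma t]].

Definition pattern_group (S : {set posroot i}) : {group gT} :=
  <<\bigcup_(gamma in S) root_subgroup gamma>>%G.

Definition U : {group gT} := pattern_group [set: posroot i].

Definition Xgroup alpha : {group gT} := pattern_group [set alpha].

Definition Sgroup alpha : {group gT} := pattern_group (source alpha).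

(* S_alpha is the semidirect product of this group with X_alpha; the quotient
   by it is what identifies X_alpha with a quotient of S_alpha. *)
Definition Xcompl alpha : {group gT} := pattern_group (source alpha :\ alpha).

Definition Tbar alpha : {group coset_of (pattern_group (Tbar_kernel alpha))} :=
  (Sgroup alpha / pattern_group (Tbar_kernel alpha))%G.

(* Sets of characters are represented by duplicate-free lists, so size is the
   cardinality. *)
Definition rs (chi : 'CF(U)) : {set posroot i} :=
  [set gamma | (root_subgroup gamma \subset 'Z(chi)%CF) &&
               ~~ (root_subgroup gamma \subset cfker chi)].

Definition Irr_at alpha : seq 'CF(U) :=
  [seq chi : 'CF(U) <- irr U | rs chi == [set alpha]].

Definition Irr_mida alpha : seq 'CF(U) :=
  [seq chi : 'CF(U) <- Irr_at alpha |
     all (fun psi : 'CF(U) => chi 1%g <= psi 1%g) (Irr_at alpha)].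

(* cfSdprod sdX lambda maps k * x to lambda x for k in Xcompl alpha and x in
   Xgroup alpha: it is the inflation of lambda along the quotient by
   Xcompl alpha. *)
Definition Psi alpha (sdX : (Xcompl alpha ><| Xgroup alpha)%g = Sgroup alpha)
    (p : 'CF(Tbar alpha) * 'CF(Xgroup alpha)) : 'CF(U) :=
  'Ind[U, Sgroup alpha] ((p.1 %% pattern_group (Tbar_kernel alpha))%CF *
                         cfSdprod sdX p.2).

End Groups.

Definition Irr_lin (gT : finGroupType) (G : {group gT}) : seq 'CF(G) :=
  [seq mu <- irr G | mu \is a linear_char].

Definition Irr_nontriv (gT : finGroupType) (G : {group gT}) : seq 'CF(G) :=
  [seq lambda <- irr G | lambda != 1].

Definition one_to_one (T1 T2 : eqType) (A : seq T1) (B : seq T2)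
    (f : T1 -> T2) : Prop :=
  [/\ {in A, forall x, f x \in B},
      {in A &, injective f} &
      {in B, forall y, exists2 x, x \in A & f x = y}].

(* Main.v *)
From Pilot Require Import Defs.
From HB Require Import structures.
From mathcomp Require Import all_boot all_order all_algebra all_fingroup.
From mathcomp Require Import all_solvable all_field all_character.
From mathcomp Require Import boolp.
From mathcomp Require Import ring zify.
From Stdlib Require BinNat.
Import Pilot.Defs.

Set Implicit Arguments.
Unset Strict Implicit.
Unset Printing Implicit Defensive.

Import Order.TTheory GRing.Theory Num.Theory.

Local Open Scope ring_scope.

(** Why the theorem holds. Let alpha be a positive root, k the set of the roots
    not below alpha, and q the order of the field.

    The irreducible characters of U with central root support alpha are those that
    are trivial on P(k) and not on X_alpha (root_support): X_alpha is central
    modulo P(k), and from any other root below alpha a chain of sums leads up to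
    alpha.

    The arms and the legs pair off: an arm gamma and its leg delta satisfy
    gamma + delta = alpha, so that the commutators of X_gamma and X_delta fill
    X_alpha. If such a delta is central apart from gamma, that is, if the
    commutators of X_delta lie in X_alpha or in the kernel found so far, and if the
    pattern without gamma is closed, then Clifford theory shows that induction is a
    one to one correspondence from the characters of the pattern group without
    gamma that are trivial on X_delta (armleg_one_to_one). Repeating this removes
    all arms and leaves the source, with the legs added to the kernel.

    For the roots outside R^normal the process gets stuck, and one uses that the
    characters in question have least degree. The arms and the legs generate a
    Heisenberg group, all of whose characters over a nontrivial one of X_alpha have
    degree q^n, with n arms. So every character over alpha has at least this degree,
    and if it has this degree it stays irreducible on the Heisenberg group; then a
    root subgroup that commutes with that group acts by scalars, and its commutators
    are in the kernel (over_root_degree_ge, reduced_kernel). With these roots added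
    to the kernel the removal of arms can go on. At the end the characters are
    linear, as they have least degree, and for linear characters everything that was
    added to the kernel besides the legs and k consists of commutators
    (over_root_linear).

    On the source X_alpha has a complement, and it is central modulo the kernel, so
    that the characters over alpha are the products of a character of T-bar and a
    nontrivial character of X_alpha (central_twist_one_to_one). The linear
    characters of T-bar are counted by the index of its derived subgroup, which is
    the image of a pattern subgroup (index_der1_Tbar); its order is a power of q
    because pattern groups have the order predicted by the number of their roots
    (card_pattern), which in turn follows from the action on the Lie algebra
    (root_group_free).

    Two facts remain. The root elements satisfy the commutator relations
    [x_b(s), x_c(t)] = x_(b + c)(+-s t), or commute if b + c is not a root: this is
    derived from the Jacobi identity, which is proved from the inner products of
    roots and the bimultiplicativity of the sign cocycle (nested_comm), and from the
    relations among divided squares, proved over the integers (heisenberg_int).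
    And for each of the 219 positive roots of E6, E7 and E8 there is an order in
    which the arms can be removed; it is found by a greedy search on the table of
    sums of roots, whose verdict is computed (roots_ok) and whose steps are instances
    of the two reductions above (reduceP). *)

(** * Characters and their centres *)

Section CentralCharacters.

Local Open Scope group_scope.
Local Open Scope ring_scope.

Variables (gT : finGroupType) (G : {group gT}).
Implicit Types (chi : 'CF(G)) (g z : gT).

Lemma cfcenterP chi z : chi \in irr G -> z \in G ->
  reflect {in G, forall g, [~ z, g]%g \in cfker chi} (z \in 'Z(chi)%CF).
Proof.
move=> irr_chi Gz; rewrite -(cfIirrE irr_chi); move: (cfIirr chi) => j.
have nKG := subsetP (normal_norm (cfker_normal 'chi_j)).
have -> : (z \in 'Z('chi_j)%CF) = (coset (cfker 'chi_j) z \in 'Z(G / cfker 'chi_j)%g).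
  rewrite -cfcenter_eq_center; apply/idP/idP; first exact: mem_quotient.
  case/morphimP=> z' Nz' Zz' /(rcoset_kercosetP (nKG z Gz) Nz') /rcosetP[k Kk ->].
  by rewrite groupM // (subsetP (normal_sub (cfker_center_normal _))).
rewrite inE mem_quotient //=; apply: (iffP centP) => [cz g Gg | cz _ /morphimP[g Ng Gg ->]].
  apply: coset_idr; first by rewrite nKG ?groupR.
  rewrite morphR ?nKG //; apply/eqP/commgP/cz; exact: mem_quotient.
by apply/commgP; rewrite -morphR ?nKG //; apply/eqP/coset_id/cz.
Qed.

End CentralCharacters.

Section CentralValues.

Local Open Scope group_scope.
Local Open Scope ring_scope.

Variables (gT : finGroupType) (G : {group gT}).
Implicit Types (chi : 'CF(G)) (g z : gT).

(** An element of the centre of a character acts as a scalar. *)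
Lemma cfcenterMr chi g z : chi \is a character -> g \in G ->
  z \in 'Z(chi)%CF -> chi (g * z)%g = chi g * (chi z / chi 1%g).
Proof.
case/char_reprP=> [[n rG] ->]; rewrite cfcenter_repr /=.
move=> Gg /setIdP[Gz /is_scalar_mxP[c Ec]].
rewrite !cfunE !groupM // Gg Gz group1 !mulr1n repr_mxM // Ec mul_mx_scalar mxtraceZ.
rewrite repr_mx1 mxtrace_scalar mxtrace1 mulrC.
case: n rG Ec => [|n] rG Ec; first by rewrite /mxtrace !big_ord0 !mul0r.
by rewrite -(mulr_natr c) mulfK // pnatr_eq0.
Qed.

(** Conjugating g by h multiplies it by the commutator, which acts by a scalar
    other than 1; as chi is a class function its value at g is zero. *)
Lemma cfcenter_vanish chi g h : chi \in irr G -> g \in G -> h \in G ->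
  [~ g, h]%g \in 'Z(chi)%CF -> [~ g, h]%g \notin cfker chi -> chi g = 0.
Proof.
move=> irr_chi Gg Gh Zc nKc; have Nchi := irrWchar irr_chi.
have Gc : [~ g, h]%g \in G by rewrite groupR.
have nz1 : chi 1%g != 0 by case/irrP: irr_chi => j ->; apply: irr1_neq0.
have := cfunJ chi g Gh; rewrite conjg_mulR (cfcenterMr Nchi Gg Zc) => /eqP.
rewrite -subr_eq0 -{2}[chi g]mulr1 -mulrBr mulf_eq0 => /orP[/eqP // | ].
rewrite subr_eq0 => /eqP E1; case/negP: nKc; case/irrP: irr_chi => j Dj.
rewrite Dj cfkerEirr inE -Dj; apply/eqP.
by rewrite -[LHS](divfK nz1) E1 mul1r.
Qed.

(** By orthogonality on the cyclic group it generates, a central element that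
    is not in the kernel forces the sum of the values over a subgroup that
    contains it to vanish. *)
Lemma sum_cfcenter_eq0 chi (Y : {group gT}) : chi \is a character ->
  Y \subset 'Z(chi)%CF -> ~~ (Y \subset cfker chi) ->
  \sum_(y in Y) chi y = 0.
Proof.
move=> Nchi sYZ /subsetPn[z Yz nKz].
have sZG := cfcenter_sub chi; have sYG := subset_trans sYZ sZG.
have Gz := subsetP sYG z Yz.
have nz1 : chi 1%g != 0.
  apply: contra nKz => z1; move: z1; rewrite char1_eq0 // => /eqP->.
  by rewrite cfker_cfun0.
have E : \sum_(y in Y) chi y = (\sum_(y in Y) chi y) * (chi z / chi 1%g).
  rewrite {1}(reindex_inj (mulIg z)) mulr_suml /=.
  rewrite (eq_bigl (mem Y)) => [|y]; last by rewrite /= groupMr.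
  by apply: eq_bigr => y Yy; rewrite cfcenterMr ?(subsetP sYG) ?(subsetP sYZ).
apply/eqP; move/eqP: E; rewrite -subr_eq0 -{1}[\sum_(y in Y) _]mulr1 -mulrBr mulf_eq0.
case/orP=> //; rewrite subr_eq0 eq_sym => /eqP E1; case/negP: nKz.
by rewrite cfkerEchar // inE Gz -[chi z](divfK nz1) E1 mul1r /=.
Qed.

(** Modulo the kernel of chi the element b centralises H, so it is central in
    the group generated by H and b, to which chi restricts irreducibly: it acts
    by a scalar. *)
Lemma cfcenter_of_irr_Res chi (H : {group gT}) b :
  chi \is a character -> H \subset G -> 'Res[H] chi \in irr H -> b \in G ->
  {in H, forall h, [~ b, h]%g \in cfker chi} -> b \in 'Z(chi)%CF.
Proof.
move=> Nchi sHG irrH Gb cbH; have nsK := cfker_normal chi.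
have nKG := subsetP (normal_norm nsK).
set J := (<[b]> <*> H)%G.
have sHJ : H \subset J by apply: joing_subr.
have Jb : b \in J by rewrite (subsetP (joing_subl _ _)) ?cycle_id.
have sJG : J \subset G by rewrite join_subG cycle_subG Gb.
have NchiJ : 'Res[J] chi \is a character by apply: cfRes_char.
have irrJ : 'Res[J] chi \in irr J.
  by apply: (@cfRes_irr_irr _ J H) => //; rewrite cfResRes.
have: b \in 'Z('Res[J] chi)%CF.
  have sub: (J \subset coset (cfker chi) @*^-1 'C[coset (cfker chi) b])%g.
    rewrite join_subG cycle_subG inE nKG //= inE cent1id /=.
    apply/subsetP=> h Hh; have Gh := subsetP sHG h Hh.
    apply/morphpreP; split; first exact: nKG.
    apply/cent1P/esym/commgP.
    by rewrite -morphR ?nKG //; apply/eqP/coset_id/cbH.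
  apply/cfcenterP => // g Jg; rewrite cfker_Res // inE groupR //=.
  have Gg := subsetP sJG g Jg.
  have /morphpreP[_ /cent1P/esym/commgP] := subsetP sub g Jg.
  by rewrite -morphR ?nKG // => /eqP/coset_idr; apply; rewrite nKG ?groupR.
by rewrite !char_cfcenterE // !cfResE.
Qed.

End CentralValues.

(** * The arm and leg reduction *)

(** In this section X and Y are two subgroups that are put in duality by the
    commutator with values in Z, which is central modulo K. The characters of A
    that are trivial on K but not on Z are then induced, one to one, from a normal
    subgroup H that centralises Y modulo K and is supplemented by X: the arm X is
    removed and the leg Y moves to the kernel. *)
Section ArmLeg.

Local Open Scope group_scope.
Local Open Scope ring_scope.

Variables (gT : finGroupType) (A H K X Y : {group gT}) (Z : {set gT}).

Hypotheses (nsHA : H <| A) (defA : (H * X)%g = A).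
Hypotheses (sKH : K \subset H) (sYH : Y \subset H) (sZH : Z \subset H).
Hypothesis nsKA : K <| A.
Hypothesis cZA : {in Z & A, forall z a, [~ z, a]%g \in K}.
Hypothesis cYH : {in Y & H, forall y h, [~ y, h]%g \in K}.
Hypothesis pairX : {in X & Z, forall x z, x != 1%g ->
  exists2 y, y \in Y & [~ y, x]%g = z}.
Hypothesis pairY : {in Y & Z, forall y z, y != 1%g ->
  exists2 x, x \in X & [~ y, x]%g = z}.

Definition armleg_top := [seq chi : 'CF(A) <- irr A |
  (K \subset cfker chi) && ~~ (Z \subset cfker chi)].

Definition armleg_bottom := [seq psi : 'CF(H) <- irr H |
  [&& K \subset cfker psi, Y \subset cfker psi & ~~ (Z \subset cfker psi)]].

Let sHA := normal_sub nsHA.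
Let nHA := subsetP (normal_norm nsHA).

Let sXA : X \subset A.
Proof. by rewrite -defA mulG_subr. Qed.

(** The commutators of a nontrivial element of X with Y exhaust Z, so that it
    cannot fix a character of H that is trivial on Y but not on Z. *)
Lemma armleg_stable (psi : 'CF(H)) a : Y \subset cfker psi ->
    ~~ (Z \subset cfker psi) ->
  a \in A -> Y \subset cfker (psi ^ a)%CF -> a \in H.
Proof.
move=> sYK /subsetPn[z Zz nKz]; rewrite -defA => /mulsgP[h x Hh Xx ->] sYKa.
have [-> | ntx] := eqVneq x 1%g; first by rewrite mulg1.
have [Ax Ah] := (subsetP sXA x Xx, subsetP sHA h Hh).
have [|y Yy Dz] := pairX (groupVr Xx) Zz; first by rewrite eq_invg1.
case/negP: nKz; have := subsetP sYKa y Yy.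
rewrite cfker_conjg ?nHA ?groupM // mem_conjg invMg conjgM memJ_norm; last first.
  by rewrite groupV (subsetP (normal_norm (cfker_normal psi))).
by rewrite conjg_mulR Dz groupMl // (subsetP sYK).
Qed.

Lemma armleg_inertia (psi : 'CF(H)) : Y \subset cfker psi ->
  ~~ (Z \subset cfker psi) -> 'I_A[psi] = H.
Proof.
move=> sYK nZK; apply/eqP; rewrite eqEsubset sub_Inertia // andbT.
apply/subsetP=> a /setIP[Aa Ia]; apply: (armleg_stable sYK nZK Aa).
by move: Ia; rewrite inE => /andP[_ /eqP->].
Qed.

Lemma armleg_Ind_irr psi : psi \in armleg_bottom -> 'Ind[A] psi \in irr A.
Proof.
rewrite mem_filter => /andP[/and3P[sKK sYK nZK] /irrP[j Dpsi]].
have [irrI _ _ _ _] := constt_Inertia_bijection j nsHA.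
rewrite Dpsi in sYK nZK *; have E := armleg_inertia sYK nZK.
have {}E : 'I_A['chi_j]%G = H by apply/val_inj.
move: irrI; rewrite E => irrI; apply: irrI.
by rewrite cfInd_id constt_irr inE.
Qed.

Lemma armleg_kerInd psi : psi \in armleg_bottom ->
  (K \subset cfker ('Ind[A] psi)) && ~~ (Z \subset cfker ('Ind[A] psi)).
Proof.
rewrite mem_filter => /andP[/and3P[sKK sYK nZK] /irrP[j Dpsi]].
rewrite Dpsi in sKK nZK *; rewrite cfker_Ind_irr // sub_gcore ?normal_norm // sKK.
by apply: contra nZK => /subset_trans; apply; apply: gcore_sub.
Qed.

Lemma armleg_Ind_mem psi : psi \in armleg_bottom -> 'Ind[A] psi \in armleg_top.
Proof.
by move=> Bpsi; rewrite mem_filter armleg_kerInd ?armleg_Ind_irr.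
Qed.

(** By Clifford theory two characters with the same induced character are
    conjugate in A, and the conjugating element is in H because both are trivial
    on Y. *)
Lemma armleg_inj : {in armleg_bottom &, injective 'Ind[A]}.
Proof.
move=> psi1 psi2 B1 B2 E12; have irr1 := armleg_Ind_irr B1.
move: B1 B2; rewrite !mem_filter.
case/andP=> /and3P[_ sY1 nZ1] /irrP[j1 D1] /andP[/and3P[_ sY2 _] /irrP[j2 D2]].
have [j Dj] := irrP irr1.
have C1: j1 \in irr_constt ('Res[H] 'chi_j).
  by rewrite -constt_Ind_Res -D1 Dj constt_irr inE.
have C2: j2 \in irr_constt ('Res[H] 'chi_j).
  by rewrite -constt_Ind_Res -D2 -E12 Dj constt_irr inE.
have: ('chi_j2 \in 'chi_j1 ^: A)%CF.
  apply: contraLR C2 => nC; rewrite irr_consttE negbK.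
  rewrite (Clifford_Res_sum_cfclass nsHA C1) cfdotZl cfdot_suml.
  rewrite big1_seq ?mulr0 // => _ /andP[_ /cfclassP[a Aa ->]].
  rewrite -conjg_IirrE cfdot_irr; case: eqP => // Ej; case/cfclassP: nC.
  by exists a; rewrite // -conjg_IirrE Ej.
case/cfclassP=> a Aa; rewrite -D1 -D2 => E; rewrite E.
by rewrite E in sY2; rewrite cfConjg_id // (armleg_stable sY1 nZ1).
Qed.

(** The restriction of chi to Y is a multiple of the regular character, as it
    vanishes off 1; hence chi has a constituent over H on which Y has a fixed
    vector, and there Y acts trivially, being central in H modulo K. *)
Lemma armleg_surj chi : chi \in armleg_top ->
  exists2 psi, psi \in armleg_bottom & 'Ind[A] psi = chi.
Proof.
rewrite mem_filter => /andP[/andP[sKK nZK] irr_chi].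
have Nchi := irrWchar irr_chi; have [i Di] := irrP irr_chi.
have sYA := subset_trans sYH sHA; have sZA := subset_trans sZH sHA.
have sZZ : {in Z, forall z, z \in 'Z(chi)%CF}.
  move=> z Zz; apply/cfcenterP; rewrite ?(subsetP sZA) // => a Aa.
  by rewrite (subsetP sKK) ?cZA.
(* Moving y by X multiplies chi y by a value of the nontrivial central
   character on Z. *)
have chiY0 : {in Y, forall y, y != 1%g -> chi y = 0}.
  move=> y Yy nty; have [z Zz nKz] := subsetPn nZK.
  have [x Xx Dz] := pairY Yy Zz nty.
  have [Ay Ax] := (subsetP sYA y Yy, subsetP sXA x Xx).
  by apply: (cfcenter_vanish irr_chi Ay Ax); rewrite Dz ?sZZ.
have: '['Res[H] chi, 'Ind[H, Y] 1] != 0.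
  rewrite -cfdot_Res_l cfResRes // cfdotE (big_setD1 1%g) ?group1 //=.
  rewrite big1 => [|y /setD1P[nty Yy]]; last first.
    by rewrite cfResE // chiY0 // mul0r.
  rewrite addr0 cfResE ?group1 // cfun1E group1 conjC1 mulr1 mulf_neq0 //.
    by rewrite invr_eq0 neq0CG.
  by rewrite Di irr1_neq0.
rewrite cfdot_sum_irr => nz_sum.
have [j /andP[Cj Ij]]: exists j, ('['Res[H] chi, 'chi_j] != 0) &&
                                 ('['Ind[H, Y] 1, 'chi_j] != 0).
  apply/existsP; apply: contraR nz_sum; rewrite negb_exists => /forallP z_sum.
  apply/eqP/big1 => j _; apply/eqP; have := z_sum j; rewrite negb_and !negbK.
  by case/orP=> /eqP->; rewrite ?conjC0 ?mul0r ?mulr0.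
have Cj' : j \in irr_constt ('Res[H] 'chi_i) by rewrite irr_consttE -Di.
have sKKj : K \subset cfker 'chi_j.
  have sub := cfker_constt (cfRes_char H Nchi) Cj.
  by apply: subset_trans sub; rewrite cfker_Res // subsetI sKH.
have sYKj : Y \subset cfker 'chi_j.
  apply: contraR Ij => nYK; rewrite -cfdot_Res_r cfdotC cfdotE.
  apply/eqP; rewrite (eq_bigr (fun y => 'chi_j y)) => [|y Yy]; last first.
    by rewrite cfResE // cfun1E Yy conjC1 mulr1.
  rewrite sum_cfcenter_eq0 ?irr_char ?mulr0 ?conjC0 //.
  apply/subsetP=> y Yy; have Hy := subsetP sYH y Yy.
  by apply/cfcenterP; rewrite ?mem_irr // => h Hh; rewrite (subsetP sKKj) ?cYH.
have nZKj : ~~ (Z \subset cfker 'chi_j).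
  apply: contra nZK => sZKj; have Cij : i \in irr_constt ('Ind[A] 'chi_j).
    by rewrite constt_Ind_Res.
  rewrite Di; apply: subset_trans (cfker_constt _ Cij); last first.
    by rewrite cfInd_char ?irr_char.
  rewrite cfker_Ind_irr //; apply/subsetP=> z Zz; apply/bigcapP=> a Aa.
  rewrite mem_conjg conjg_mulR groupM //; first exact: (subsetP sZKj).
  by apply: (subsetP sKKj); rewrite cZA ?groupV.
exists 'chi_j; first by rewrite mem_filter sKKj sYKj nZKj mem_irr.
have /armleg_Ind_irr/irrP[k Dk] : 'chi_j \in armleg_bottom.
  by rewrite mem_filter sKKj sYKj nZKj mem_irr.
have: i \in irr_constt ('Ind[A] 'chi_j) by rewrite constt_Ind_Res.
by rewrite Dk constt_irr inE Di => /eqP->.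
Qed.

Lemma armleg_one_to_one : one_to_one armleg_bottom armleg_top 'Ind[A].
Proof. by split; [apply: armleg_Ind_mem | apply: armleg_inj | apply: armleg_surj]. Qed.

End ArmLeg.

Section CharacterFacts.

Local Open Scope group_scope.
Local Open Scope ring_scope.

Variables (gT : finGroupType) (G : {group gT}).

Lemma cfcenter_full_lin (chi : 'CF(G)) : chi \in irr G ->
  G \subset 'Z(chi)%CF -> chi \is a linear_char.
Proof.
move=> irr_chi sGZ; have Nchi := irrWchar irr_chi.
have Z_G : 'Z(chi)%CF = G by apply/eqP; rewrite eqEsubset cfcenter_sub.
rewrite qualifE /= Nchi /=; have [j Dj] := irrP irr_chi.
have [le1 _] := irr1_bound j; rewrite -Dj Z_G indexgg in le1.
have [n Dn] : exists n, chi 1%g = n%:R by apply/natrP; rewrite Dj Cnat_irr1.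
have n_gt0 : (0 < n)%N by rewrite -(ltr_nat algC) -Dn Dj irr1_gt0.
rewrite Dn -natrX ler_nat in le1 *; rewrite pnatr_eq1.
by case: n n_gt0 le1 {Dn} => [|[]].
Qed.

Lemma eq_mem_one_to_one (T1 T2 : eqType) (s1 s1' : seq T1) (s2 s2' : seq T2) f :
  s1 =i s1' -> s2 =i s2' -> one_to_one s1 s2 f -> one_to_one s1' s2' f.
Proof.
move=> E1 E2 [im inj surj]; split=> [x | x y | y].
- by rewrite -E1 -E2; apply: im.
- by rewrite -!E1; apply: inj.
by rewrite -E2 => /surj[x]; rewrite E1; exists x.
Qed.

Lemma one_to_one_filter (T1 T2 : eqType) (s1 : seq T1) (s2 : seq T2) f
    (p1 : pred T1) (p2 : pred T2) :
    one_to_one s1 s2 f -> {in s1, forall x, p1 x = p2 (f x)} ->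
  one_to_one (filter p1 s1) (filter p2 s2) f.
Proof.
case=> im inj surj E; split=> [x | x x' | y].
- by rewrite !mem_filter => /andP[px sx]; rewrite -E // px im.
- by rewrite !mem_filter => /andP[_ sx] /andP[_ sx']; apply: inj.
rewrite mem_filter => /andP[py /surj[x sx Exy]].
by exists x; rewrite // mem_filter sx E // Exy py.
Qed.

End CharacterFacts.

(** * Twisting by a linear character of a central complement *)

Section CentralTwist.

Local Open Scope group_scope.
Local Open Scope ring_scope.

Variables (gT : finGroupType) (G C Z K N : {group gT}) (sd : (C ><| Z)%g = G).

Hypotheses (abZ : abelian Z) (nsNG : N <| G).
Hypotheses (sKC : K \subset C) (sKN : K \subset N) (sZN : Z \subset N).
Hypothesis sNKZ : N \subset K <*> Z.
Hypothesis cZG : {in Z & G, forall z g, [~ z, g]%g \in K}.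

Definition central_twist (p : 'CF(G / N) * 'CF(Z)) : 'CF(G) :=
  (p.1 %% N)%CF * cfSdprod sd p.2.

Let sZG : Z \subset G.
Proof. exact: subset_trans sZN (normal_sub nsNG). Qed.

Lemma irr_abelian_lin (lambda : 'CF(Z)) : lambda \in irr Z -> lambda \is a linear_char.
Proof. by case/irrP=> j ->; apply/char_abelianP. Qed.

Lemma central_twist_lin lambda : lambda \in irr Z -> cfSdprod sd lambda \is a linear_char.
Proof. by move/irr_abelian_lin; rewrite cfSdprod_lin_char. Qed.

Lemma central_twist_val (mu : 'CF(G / N)) lambda :
  {in Z, forall z, central_twist (mu, lambda) z = mu 1%g * lambda z}.
Proof.
move=> z Zz; rewrite cfunE /= cfSdprodEr // -(cfMod1 mu); congr (_ * _).
by rewrite -[z]mulg1 cfkerMl // (subsetP (cfker_mod mu nsNG)) // (subsetP sZN).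
Qed.

Lemma central_twist_val1 (mu : 'CF(G / N)) lambda : lambda \in irr Z ->
  central_twist (mu, lambda) 1%g = mu 1%g.
Proof.
by move=> irr_l; rewrite central_twist_val // (lin_char1 (irr_abelian_lin irr_l)) mulr1.
Qed.

(** As Z is central modulo K, a character chi over K acts on it through a linear
    character, which extends to G because C is a complement: dividing by the
    extension gives a character of the quotient by K Z. *)
Lemma central_twist_one_to_one :
  one_to_one [seq (mu, lambda) | mu <- irr (G / N), lambda <- Irr_nontriv Z]
    [seq chi : 'CF(G) <- irr G | (K \subset cfker chi) && ~~ (Z \subset cfker chi)]
    central_twist.
Proof.
split=> [_ /allpairsP[[mu lambda] [/= irr_mu irr_l ->]] | x y | chi].
- move: irr_l; rewrite mem_filter => /andP[nt_l irr_l].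
  have Llam := central_twist_lin irr_l.
  have irr_chi : central_twist (mu, lambda) \in irr G.
    by rewrite /central_twist mulrC mul_lin_irr // cfMod_irr.
  rewrite mem_filter irr_chi andbT; apply/andP; split.
    apply: subset_trans (cfker_mul _ _); rewrite subsetI.
    rewrite (subset_trans sKN (cfker_mod mu nsNG)) /=.
    exact: subset_trans sKC (cfker_sdprod _ _).
  apply: contra nt_l => sZK; apply/eqP/cfun_inP=> z Zz; rewrite cfun1E Zz.
  have nz_mu : mu 1%g != 0 by case/irrP: irr_mu => j ->; apply: irr1_neq0.
  apply: (mulfI nz_mu); rewrite -(central_twist_val mu lambda Zz) mulr1.
  rewrite -(central_twist_val1 mu irr_l) -[z]mulg1 cfkerMl //.
  exact: subsetP sZK z Zz.
- move=> /allpairsP[[mu lambda] [/= irr_mu irr_l ->]].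
  move=> /allpairsP[[mu' lambda'] [/= irr_mu' irr_l' ->]] E.
  move: irr_l irr_l'; rewrite !mem_filter => /andP[_ irr_l] /andP[_ irr_l'].
  have Emu1 : mu 1%g = mu' 1%g.
    by rewrite -(central_twist_val1 mu irr_l) E central_twist_val1.
  have nz_mu : mu 1%g != 0 by case/irrP: irr_mu => j ->; apply: irr1_neq0.
  have El : lambda = lambda'.
    apply/cfun_inP=> z Zz; apply: (mulfI nz_mu).
    by rewrite -central_twist_val // E central_twist_val // Emu1.
  rewrite -El in E *; congr (_, _); apply: (can_inj (cfModK nsNG)).
  exact: (mulIr (lin_char_unitr (central_twist_lin irr_l)) E).
rewrite mem_filter => /andP[/andP[sKK nZK] irr_chi].
have Nchi := irrWchar irr_chi.
have nz_chi : chi 1%g != 0 by case/irrP: irr_chi => j ->; apply: irr1_neq0.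
have sZZ : Z \subset 'Z(chi)%CF.
  apply/subsetP=> z Zz; apply/cfcenterP=> // [|g Gg]; first exact: subsetP sZG z Zz.
  by rewrite (subsetP sKK) ?cZG.
have [xi Lxi Dxi] := cfcenter_Res chi.
pose lambda := 'Res[Z] xi; have Llam : lambda \is a linear_char by apply: cfRes_lin_char.
have chiZ : {in Z, forall z, chi z = chi 1%g * lambda z}.
  move=> z Zz; have Zchi_z := subsetP sZZ z Zz.
  have := congr1 (fun f : 'CF(_) => f z) Dxi.
  by rewrite cfResE ?cfcenter_sub // cfunE /lambda cfResE.
have irr_l : lambda \in irr Z by apply: lin_char_irr.
have Llam' := central_twist_lin irr_l.
pose psi := chi * (cfSdprod sd lambda)^*%CF.
have irr_psi : psi \in irr G by rewrite /psi mulrC mul_lin_irr // cfConjC_lin_char.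
have Dchi : psi * cfSdprod sd lambda = chi.
  by rewrite /psi -mulrA [(_^*)%CF * _]mulrC mul_conjC_lin_char ?mulr1.
have sNpsi : N \subset cfker psi.
  apply: subset_trans sNKZ _; rewrite join_subG /=; apply/andP; split.
    apply: subset_trans (cfker_mul _ _); rewrite subsetI sKK cfker_aut.
    exact: subset_trans sKC (cfker_sdprod _ _).
  apply/subsetP=> z Zz; rewrite cfkerEchar ?irrWchar // inE (subsetP sZG) //=.
  rewrite !cfunE chiZ // !cfSdprodEr // -mulrA -normCK normC_lin_char // expr1n.
  by rewrite (lin_char1 Llam) rmorph1.
exists ((psi / N)%CF, lambda); last by rewrite /central_twist /= cfQuoK.
apply/allpairsP; exists ((psi / N)%CF, lambda); split=> //=; first by rewrite cfQuo_irr.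
rewrite mem_filter irr_l andbT; apply: contra nZK => /eqP l1.
apply/subsetP=> z Zz; rewrite cfkerEchar // inE (subsetP sZG) //= chiZ // l1 cfun1E Zz.
by rewrite mulr1.
Qed.

Lemma central_twist_lin_one_to_one :
  one_to_one [seq (mu, lambda) | mu <- Irr_lin (G / N), lambda <- Irr_nontriv Z]
    [seq chi : 'CF(G) <- irr G | [&& K \subset cfker chi, ~~ (Z \subset cfker chi)
       & chi 1%g == 1]]
    central_twist.
Proof.
have := one_to_one_filter (p1 := fun p : 'CF(G / N) * 'CF(Z) => p.1 1%g == 1)
  (p2 := fun chi : 'CF(G) => chi 1%g == 1) central_twist_one_to_one.
move=> E; apply: eq_mem_one_to_one (E _) => [p | chi | [mu lambda]].
- rewrite mem_filter; apply/andP/allpairsP=> [[/eqP p1 /allpairsP[[mu l] [/= irr_mu irr_l Ep]]] |].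
    exists (mu, l); split=> //; rewrite mem_filter irr_mu andbT.
    by rewrite qualifE /= irrWchar // -p1 Ep /=.
  case=> [[mu l] [/=]]; rewrite mem_filter => /andP[Lmu irr_mu] irr_l ->.
  by split; [apply/eqP/lin_char1 | apply/allpairsP; exists (mu, l)].
- by rewrite !mem_filter; case: (K \subset _); case: (Z \subset _); case: (_ == 1).
case/allpairsP=> [[mu' l'] [/= irr_mu irr_l [-> ->]]].
move: irr_l; rewrite mem_filter => /andP[_ irr_l]; by rewrite central_twist_val1.
Qed.

End CentralTwist.

(** * Pattern subgroups *)

Section PatternCombinatorics.

Variables (R : finType) (sum : R -> R -> R -> bool).
Implicit Types (beta gamma delta : R) (N S : {set R}).

Definition ideal N S : bool :=
  (N \subset S) &&
  [forall beta in N, forall gamma in S, forall delta,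
     sum beta gamma delta ==> (delta \in N)].

Lemma idealP N S : reflect (N \subset S /\
    forall beta gamma delta, beta \in N -> gamma \in S ->
      sum beta gamma delta -> delta \in N)
  (ideal N S).
Proof.
apply: (iffP andP) => [[sNS /forall_inP nNS] | [sNS nNS]]; split=> //.
  move=> beta gamma delta Nb Sg bcd; have /forall_inP/(_ gamma Sg) := nNS beta Nb.
  by move/forallP/(_ delta)/implyP; apply.
apply/forall_inP=> beta Nb; apply/forall_inP=> gamma Sg.
by apply/forallP=> delta; apply/implyP; apply: nNS.
Qed.

Lemma ideal_closed N S : ideal N S -> ideal N N.
Proof.
case/idealP=> sNS nNS; apply/idealP; split=> // b g d Nb Ng.
by apply: nNS => //; apply: (subsetP sNS).
Qed.

End PatternCombinatorics.

Section PatternGroups.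

Local Open Scope group_scope.
Local Open Scope ring_scope.

Variables (R : finType) (sum : R -> R -> R -> bool) (label : R -> nat).
Variables (gT : finGroupType) (q : nat) (X : R -> {group gT}).
Implicit Types (alpha beta gamma delta eta : R) (K N S T : {set R}).

Local Notation ideal := (ideal sum).

Hypothesis sumC : forall beta gamma delta,
  sum beta gamma delta = sum gamma beta delta.
Hypothesis sum_label : forall beta gamma delta,
  sum beta gamma delta -> (label beta < label delta)%N.
Hypothesis sum_cancel : forall beta gamma gamma' delta,
  sum beta gamma delta -> sum beta gamma' delta -> gamma = gamma'.
Hypothesis label_inj : injective (label).

Hypothesis q_gt1 : (1 < q)%N.
Hypothesis card_X : forall gamma, #|X gamma| = q.
Hypothesis abelian_X : forall gamma, abelian (X gamma).
Hypothesis X_sum : forall beta gamma delta, sum beta gamma delta ->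
  {in X beta & X gamma, forall b c, [~ b, c]%g \in X delta}.
(** The commutator formula of two root subgroups is bilinear in the parameters,
    so the commutators with one nontrivial element exhaust the third subgroup. *)
Hypothesis X_pair : forall beta gamma delta, sum beta gamma delta ->
  {in X beta & X delta, forall b d, b != 1%g ->
     exists2 c, c \in X gamma & [~ b, c]%g = d}.
Hypothesis X_comm : forall beta gamma, (forall delta, ~~ sum beta gamma delta) ->
  {in X beta & X gamma, forall b c, [~ b, c]%g = 1%g}.

Definition pattern S : {group gT} := <<\bigcup_(gamma in S) X gamma>>%G.

Hypothesis X_free : forall gamma,
  X gamma :&: pattern [set delta | (label gamma < label delta)%N] = 1%g.

Lemma pattern_subP S (G : {group gT}) :
  reflect {in S, forall gamma, X gamma \subset G} (pattern S \subset G).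
Proof. by rewrite gen_subG; apply: bigcupsP. Qed.

Lemma root_sub_pattern S gamma : gamma \in S -> X gamma \subset pattern S.
Proof. by move=> Sg; apply: sub_gen; apply: bigcup_sup Sg. Qed.

Lemma pattern_sub S T : S \subset T -> pattern S \subset pattern T.
Proof. by move=> sST; apply/pattern_subP=> g Sg; rewrite root_sub_pattern // (subsetP sST). Qed.

Lemma pattern1 gamma : pattern [set gamma] = X gamma.
Proof. by apply/val_inj; rewrite /= big_set1 genGid. Qed.

Lemma root_commg beta gamma K :
  (forall delta, sum beta gamma delta -> delta \in K) ->
  {in X beta & X gamma, forall b c, [~ b, c]%g \in pattern K}.
Proof.
move=> sumK b c Xb Xc; case: (pickP (sum beta gamma)) => [d bcd | no].
  by apply: (subsetP (root_sub_pattern (sumK d bcd))); apply: X_sum Xb Xc.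
by rewrite (X_comm _ Xb Xc) // => d; rewrite no.
Qed.

Lemma pattern_normal N S : ideal N S -> pattern N <| pattern S.
Proof.
case/idealP=> sNS nNS; rewrite /normal pattern_sub //=.
apply/pattern_subP=> g Sg; apply/normsP=> x Xx; apply/eqP; rewrite eqEcard cardJg leqnn andbT.
rewrite sub_conjg; apply/pattern_subP=> beta Nb; apply/subsetP=> b Xb.
rewrite mem_conjg invgK conjg_mulR groupM //; first exact: subsetP (root_sub_pattern Nb) b Xb.
by apply: (root_commg _ Xb Xx) => d; apply: nNS.
Qed.

Lemma pattern_commg S T K beta : ideal K S -> T \subset S -> beta \in S ->
  (forall gamma delta, gamma \in T -> sum beta gamma delta -> delta \in K) ->
  {in X beta & pattern T, forall b a, [~ b, a]%g \in pattern K}.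
Proof.
move=> nKS sTS Sb sumK b a Xb; have [_ /subsetP nPK] := andP (pattern_normal nKS).
have nb : b \in 'N(pattern K) by rewrite nPK // (subsetP (root_sub_pattern Sb)).
have sub: pattern T \subset coset (pattern K) @*^-1 'C[coset (pattern K) b].
  apply/pattern_subP=> g Tg; apply/subsetP=> x Xx; have nx : x \in 'N(pattern K).
    by rewrite nPK // (subsetP (root_sub_pattern (subsetP sTS g Tg))).
  apply/morphpreP; split=> //; apply/cent1P/esym/commgP; rewrite -morphR //.
  by apply/eqP/coset_id; apply: (root_commg _ Xb Xx) => d; apply: sumK.
move=> Sa; have /morphpreP[na /cent1P/esym/commgP] := subsetP sub a Sa.
by rewrite -morphR // => /eqP/coset_idr; apply; rewrite groupR.
Qed.

Lemma ideal_remove S gamma : ideal (S :\ gamma) (S :\ gamma) ->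
  gamma \in S -> ideal S S -> ideal (S :\ gamma) S.
Proof.
move=> /idealP[_ cl'] Sg /idealP[_ cl].
apply/idealP; split=> [|b e d S'b Se bcd]; first exact: subsetDl.
have [Eeg | neg] := eqVneq e gamma; last by apply: cl' bcd; rewrite // !inE neg.
have [_ Sb] := setD1P S'b; rewrite !inE (cl b e) // andbT -Eeg.
by apply: contraTneq bcd => ->; apply/negP; rewrite sumC => /sum_label; rewrite ltnn.
Qed.

Lemma pattern_mul_root S gamma : ideal (S :\ gamma) S -> gamma \in S ->
  (pattern (S :\ gamma) * X gamma)%g = pattern S.
Proof.
move=> /pattern_normal/andP[sNP nNP] Sg; rewrite -norm_joinEr; last first.
  by apply: subset_trans nNP; apply: root_sub_pattern.
apply/eqP; rewrite eqEsubset join_subG sNP root_sub_pattern //=.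
apply/pattern_subP=> d Sd; have [-> | ndg] := eqVneq d gamma; first exact: joing_subr.
by apply: subset_trans (joing_subl _ _); rewrite root_sub_pattern // !inE ndg.
Qed.

Lemma min_label S gamma0 : gamma0 \in S ->
  exists2 gamma, gamma \in S & {in S, forall delta, label gamma <= label delta}%N.
Proof. by case/(arg_minnP label) => g Sg min_g; exists g. Qed.

Lemma max_label S gamma0 : gamma0 \in S ->
  exists2 gamma, gamma \in S & {in S, forall delta, label delta <= label gamma}%N.
Proof. by case/(arg_maxnP label) => g Sg max_g; exists g. Qed.

(** Removing the root with the least label from a closed set leaves a closed
    set, as sums have larger labels. *)
Lemma closed_remove_min S gamma : ideal S S -> gamma \in S ->
  {in S, forall delta, label gamma <= label delta}%N ->
  ideal (S :\ gamma) (S :\ gamma).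
Proof.
move=> /idealP[_ cl] Sg min_g; apply/idealP; split=> // b e d.
move=> /setD1P[_ Sb] /setD1P[_ Se] bcd; rewrite !inE (cl b e) // andbT.
by apply: contraTneq (sum_label bcd) => ->; rewrite -leqNgt min_g.
Qed.

(** On the patterns of all roots from some rank on, each root subgroup meets the
    rest trivially, so the orders multiply. *)
Lemma card_pattern_above m (S := [set delta : R | (m <= label delta)%N]) :
  #|pattern S| = (q ^ #|S|)%N.
Proof.
have [n] := ubnP #|S|; elim: n m @S => // n IHn m S; rewrite ltnS => leSn.
have inS d : (d \in S) = (m <= label d)%N by rewrite in_set.
have [S0 | [g0 Sg0]] := set_0Vmem S.
  by rewrite S0 cards0; apply/eqP; rewrite -trivg_card1 /pattern /= big_set0 gen0.
have [g Sg min_g] := min_label Sg0.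
have clS : ideal S S.
  apply/idealP; split=> // b c d; rewrite !inS => le_mb _ /sum_label/ltnW.
  exact: leq_trans.
have clS' := closed_remove_min clS Sg min_g.
have E : S :\ g = [set delta | (label g < label delta)%N].
  apply/setP=> d; rewrite in_setD1 inS in_set [(label g < _)%N]ltn_neqAle (inj_eq label_inj) eq_sym.
  apply: andb_id2l => ndg; apply/idP/idP => [mltd | ]; last first.
    by apply: leq_trans; move: Sg; rewrite inS.
  by apply: min_g; rewrite inS.
have cS := cardsD1 g S; rewrite Sg in cS.
rewrite -(pattern_mul_root (ideal_remove clS' Sg clS) Sg) TI_cardMg; last first.
  by rewrite E setIC X_free.
have := IHn (label g).+1; rewrite -E => IH.
rewrite card_X IH; last by rewrite cS in leSn.
by rewrite [in RHS]cS expnD expn1 mulnC.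
Qed.

Lemma card_pattern_le S : ideal S S -> (#|pattern S| <= q ^ #|S|)%N.
Proof.
have [n] := ubnP #|S|; elim: n S => // n IHn S; rewrite ltnS => leSn clS.
have [-> | [g0 Sg0]] := set_0Vmem S.
  by rewrite cards0 /pattern /= big_set0 gen0 cards1.
have [g Sg min_g] := min_label Sg0.
have clS' := closed_remove_min clS Sg min_g.
have cS := cardsD1 g S; rewrite Sg in cS.
rewrite -(pattern_mul_root (ideal_remove clS' Sg clS) Sg) cS expnD expn1 mulnC.
have le1: (#|(pattern (S :\ g) * X g)%g| <= #|pattern (S :\ g)| * #|X g|)%N.
  by rewrite mul_cardG leq_pmulr // cardG_gt0.
apply: leq_trans le1 _; rewrite card_X leq_mul2r IHn ?orbT //.
by rewrite cS in leSn.
Qed.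

(** Adding to a closed set the missing root with the largest label keeps it
    closed; climbing in this way to the full pattern shows that no order is
    lost on the way. *)
Lemma card_pattern S : ideal S S -> #|pattern S| = (q ^ #|S|)%N.
Proof.
move=> clS; apply/eqP; rewrite eqn_leq card_pattern_le //=.
have [n] := ubnP #|~: S|; elim: n S clS => // n IHn S clS; rewrite ltnS => leSn.
have [S0 | [g0 Sg0]] := set_0Vmem (~: S).
  have -> : S = [set delta : R | (0 <= label delta)%N].
    by apply/setP=> d; have:= in_set0 d; rewrite -S0 !inE => /negbFE->.
  by rewrite -card_pattern_above.
have [g Sg max_g] := max_label Sg0.
have nSg : g \notin S by rewrite inE in Sg.
set T := g |: S; have Tg : g \in T by rewrite setU11.
have ES : T :\ g = S.
  by rewrite setU1K.
have up : forall b c d, b \in T -> c \in T -> sum b c d -> d \in T.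
  have half b d : b \in T -> sum g b d -> d \in T.
    move=> Tb bcd; rewrite !inE orbC -implyNb; apply/implyP=> nSd.
    by have := sum_label bcd; rewrite ltnNge max_g //= inE.
  move=> b c d; have [-> _ Tc | nbg Tb] := eqVneq b g; first exact: (half c).
  have [-> _ | ncg Tc] := eqVneq c g; first by rewrite sumC; apply: (half b).
  case/idealP: clS => _ cl bcd; rewrite !inE (cl b c) ?orbT //.
    by move: Tb; rewrite !inE (negPf nbg).
  by move: Tc; rewrite !inE (negPf ncg).
have clT : ideal T T by apply/idealP; split.
have := IHn T clT.
have -> : (#|~: T| < n)%N.
  apply: leq_trans leSn; rewrite setCU setIC -setDE [X in (_ < X)%N](cardsD1 g).
  by rewrite Sg.
move/(_ isT); rewrite /T cardsU1 nSg expnD expn1 -/T.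
have nST : ideal (T :\ g) T by apply: ideal_remove; rewrite ?ES.
rewrite -(pattern_mul_root nST Tg) ES => leT.
rewrite -(leq_pmul2l (ltnW q_gt1)); apply: leq_trans leT _.
by rewrite -(card_X g) mulnC mul_cardG leq_pmulr // cardG_gt0.
Qed.

Lemma indexg_pattern N S : ideal S S -> ideal N S ->
  #|pattern S : pattern N| = (q ^ (#|S| - #|N|))%N.
Proof.
move=> clS nNS; have [sNS _] := andP nNS; have sPP := pattern_sub sNS.
rewrite -divgS // !card_pattern ?(ideal_closed nNS) // expnB ?subset_leq_card //.
exact: ltnW.
Qed.

Lemma pattern_sdprod S alpha : ideal S S -> alpha \in S ->
  ideal (S :\ alpha) (S :\ alpha) ->
  (pattern (S :\ alpha) ><| pattern [set alpha])%g = pattern S.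
Proof.
move=> clS Sa clS'; have nSS := ideal_remove clS' Sa clS.
have [_ nPP] := andP (pattern_normal nSS).
rewrite pattern1 sdprodE ?pattern_mul_root //; first exact: subset_trans (root_sub_pattern Sa) nPP.
apply: cardMg_TI; rewrite pattern_mul_root // !card_pattern // card_X (cardsD1 alpha S) Sa.
by rewrite expnD expn1 mulnC.
Qed.

(** * Reduction of the characters over a root *)

Section Reduction.

Variables (alpha : R) (A : {set R}).

(** The characters over the root alpha that are trivial on K; the flag restricts
    to those whose degree is least. *)
Definition over_root (b : bool) S K : seq 'CF(pattern S) :=
  [seq chi <- irr (pattern S) |
     [&& pattern K \subset cfker chi, ~~ (X alpha \subset cfker chi)
       & b ==> (chi 1%g == (q ^ #|A :&: S|)%:R)]].

(** The group P(S) / P(K) exists and contains X_alpha as a central subgroup. *)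
Definition central_mod S K : Prop :=
  [/\ ideal S S, ideal K S, alpha \in S, alpha \notin K &
      forall eta delta, eta \in S -> sum alpha eta delta -> delta \in K].

Lemma sum_neq beta gamma delta : sum beta gamma delta -> beta != delta.
Proof. by move=> /sum_label; apply: contraTneq => ->; rewrite ltnn. Qed.

Lemma sum_irr gamma delta : ~~ sum gamma gamma delta.
Proof.
apply/negP=> ggd; have root_neq1 d : exists2 b, b \in X d & b != 1%g.
  by apply/trivgPn; rewrite trivg_card1 card_X neq_ltn q_gt1 orbT.
have [[b Xb ntb] [d Xd /eqP[]]] := (root_neq1 gamma, root_neq1 delta).
have [c Xc <-] := X_pair ggd Xb Xd ntb.
by apply/eqP/commgP; apply: (centsP (abelian_X gamma)).
Qed.

Lemma pattern_setU1 gamma K (G : {group gT}) :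
  (pattern (gamma |: K) \subset G) = (X gamma \subset G) && (pattern K \subset G).
Proof.
apply/idP/andP => [sG | [sXG /pattern_subP sKG]].
  split; last by apply: subset_trans sG; apply: pattern_sub (subsetUr _ _).
  by apply: subset_trans sG; apply: root_sub_pattern (setU11 _ _).
by apply/pattern_subP=> d /setU1P[-> // | /sKG].
Qed.

Lemma cardsI_remove S gamma : gamma \in A -> gamma \in S ->
  #|A :&: S| = #|A :&: (S :\ gamma)|.+1.
Proof. by move=> Ag Sg; rewrite setIDA (cardsD1 gamma (A :&: S)) inE Ag Sg. Qed.

(** The arm and leg correspondence for X_gamma and X_delta; induction multiplies
    the degree by q, which is the effect of one more arm on the least degree. *)
Lemma remove_arm b S K gamma delta :
    central_mod S K -> gamma \in A -> gamma \in S -> delta \in S ->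
    sum delta gamma alpha -> ideal (S :\ gamma) (S :\ gamma) ->
    (forall eta eps, eta \in S -> sum delta eta eps -> eps \in alpha |: K) ->
  central_mod (S :\ gamma) (delta |: K) /\
  one_to_one (over_root b (S :\ gamma) (delta |: K)) (over_root b S K)
             ('Ind[pattern S] : 'CF(pattern (S :\ gamma)) -> 'CF(pattern S)).
Proof.
move=> [clS idK Sa nKa cK] Ag Sg Sd dga clS' dS.
have nSS := ideal_remove clS' Sg clS; have [sKS nK] := idealP _ _ _ idK.
have nKg : gamma \notin K.
  by apply: contra nKa => Kg; apply: (nK gamma delta); rewrite // sumC.
have neq_dg : delta != gamma.
  by apply: contraTneq dga => ->; apply: sum_irr.
have neq_da : delta != alpha := sum_neq dga.
have neq_ga : gamma != alpha by apply: (@sum_neq _ delta); rewrite sumC.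
have sKS' : K \subset S :\ gamma.
  by rewrite subsetD1 sKS.
have idK' : ideal (delta |: K) (S :\ gamma).
  apply/idealP; split=> [|x y z].
    by rewrite subUset sub1set !inE neq_dg Sd.
  case/setU1P=> [-> /setD1P[nyg Sy] dyz | Kx /setD1P[_ Sy] xyz].
    have := dS y z Sy dyz; rewrite !inE => /predU1P[Eza | -> ]; last exact: orbT.
    by case/eqP: nyg; apply: sum_cancel dyz _; rewrite Eza.
  by rewrite !inE (nK x y) ?orbT.
split.
  split=> //.
  - by rewrite !inE eq_sym neq_ga.
  - by rewrite !inE eq_sym negb_or neq_da.
  by move=> e d /setD1P[_ Se] aed; rewrite !inE (cK e) ?orbT.
have top := @armleg_one_to_one _ (pattern S) (pattern (S :\ gamma)) (pattern K) (X gamma) (X delta) (X alpha).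
have Sg' : pattern (S :\ gamma) \subset pattern S by apply: pattern_sub; apply: subsetDl.
have Ss' : delta \in S :\ gamma by rewrite !inE neq_dg.
have Sa' : alpha \in S :\ gamma by rewrite !inE eq_sym neq_ga.
have {}top : one_to_one
    (armleg_bottom (pattern (S :\ gamma)) (pattern K) (X delta) (X alpha))
    (armleg_top (pattern S) (pattern K) (X alpha)) 'Ind[pattern S].
  apply: top.
  - exact: pattern_normal.
  - exact: pattern_mul_root.
  - exact: pattern_sub.
  - exact: root_sub_pattern.
  - exact: root_sub_pattern.
  - exact: pattern_normal.
  - exact: (pattern_commg idK).
  - apply: (pattern_commg (S := S :\ gamma)) => // [|e d].
      by apply/idealP; split=> // x y z Kx /setD1P[_]; apply: nK.
    move=> /setD1P[neg Se] ded; have := dS e d Se ded; rewrite !inE.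
    case/predU1P=> // Eda; case/eqP: neg; apply: sum_cancel ded _.
    by rewrite Eda.
  - move=> x z Xx Xz ntx.
    rewrite sumC in dga; have [y Xy Dz] := X_pair dga Xx (groupVr Xz) ntx.
    by exists y; rewrite // -invg_comm Dz invgK.
  - by move=> y z Xy Xz nty; apply: (X_pair dga).
have [sSP _] := andP (pattern_normal nSS).
have := one_to_one_filter
  (p1 := fun psi : 'CF(pattern (S :\ gamma)) => b ==> (psi 1%g == (q ^ #|A :&: (S :\ gamma)|)%:R))
  (p2 := fun chi : 'CF(pattern S) => b ==> (chi 1%g == (q ^ #|A :&: S|)%:R)) top.
rewrite /armleg_bottom /armleg_top -!filter_predI.
have -> : over_root b S K = [seq chi <- irr (pattern S) |
   predI (fun chi : 'CF(pattern S) => b ==> (chi 1%g == (q ^ #|A :&: S|)%:R))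
     (fun chi : 'CF(pattern S) => (pattern K \subset cfker chi) && ~~ (X alpha \subset cfker chi)) chi].
  by apply: eq_filter => chi /=; rewrite andbA andbC.
move=> E.
have <- : [seq psi <- irr (pattern (S :\ gamma)) |
    predI (fun psi : 'CF(pattern (S :\ gamma)) => b ==> (psi 1%g == (q ^ #|A :&: (S :\ gamma)|)%:R))
     (fun psi : 'CF(pattern (S :\ gamma)) => [&& pattern K \subset cfker psi, X delta \subset cfker psi &
       ~~ (X alpha \subset cfker psi)]) psi] = over_root b (S :\ gamma) (delta |: K).
  by apply: eq_filter => psi /=; rewrite pattern_setU1 -!andbA andbC -!andbA andbCA.
apply: E => psi _; case: b => //=.
rewrite cfInd1 // (indexg_pattern clS nSS) (cardsI_remove Ag Sg) (cardsD1 gamma S) Sg.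
rewrite addnK expn1 expnS natrM (inj_eq (mulfI _)) // pnatr_eq0 -lt0n.
exact: ltnW.
Qed.

Definition leg_in S : {set R} :=
  [set delta in S | [exists gamma in A :&: S, sum delta gamma alpha]].

Lemma mem_leg_in S delta : (delta \in leg_in S) =
  (delta \in S) && [exists gamma in A :&: S, sum delta gamma alpha].
Proof. by rewrite in_set. Qed.

(** The root subgroups of the arms and the legs generate a Heisenberg group with
    centre X_alpha. *)
Definition heisenberg S : Prop :=
  {in A :&: S, forall gamma, exists2 delta, delta \in S :\: A & sum delta gamma alpha} /\
  {in (A :&: S) :|: leg_in S &, forall beta gamma delta,
     sum beta gamma delta -> delta = alpha}.

Lemma mem_over_root S K b chi : (chi \in over_root b S K) =
  [&& chi \in irr (pattern S), pattern K \subset cfker chi, ~~ (X alpha \subset cfker chi)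
    & b ==> (chi 1%g == (q ^ #|A :&: S|)%:R)].
Proof. by rewrite mem_filter andbC. Qed.

(** In a Heisenberg group every arm can be removed, down to an abelian group. *)
Lemma heisenberg_degree S K : central_mod S K -> heisenberg S ->
    S \subset K :|: (alpha |: ((A :&: S) :|: leg_in S)) ->
  {in over_root false S K, forall chi : 'CF(pattern S), chi 1%g = (q ^ #|A :&: S|)%:R}.
Proof.
have [n] := ubnP #|A :&: S|; elim: n S K => // n IHn S K; rewrite ltnS => leASn.
move=> cSK [hleg hsum] sS chi; have [clS idK Sa nKa cK] := cSK.
have [_ nK] := idealP _ _ _ idK.
have sumS beta gamma delta : beta \in S -> gamma \in S -> sum beta gamma delta ->
    delta \in alpha |: K.
  move=> Sb Sg bgd; rewrite in_setU1 orbC -implyNb; apply/implyP=> nKd.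
  have h x y : x \in S -> y \in S -> sum x y delta -> x \in (A :&: S) :|: leg_in S.
    move=> Sx Sy xyd; have /setUP[Kx | /setU1P[Ex | //]] := subsetP sS x Sx.
      by case/negP: nKd; apply: nK xyd.
    by case/negP: nKd; rewrite Ex in xyd; apply: cK xyd.
  apply/eqP/(hsum _ _ (h _ _ Sb Sg bgd) _ _ bgd).
  by apply: (h gamma beta); rewrite // sumC.
have [AS0 | [gamma ASg]] := set_0Vmem (A :&: S).
  rewrite mem_over_root AS0 cards0 expn0 => /and4P[irr_chi sKK nXK _].
  apply/eqP; suff: chi \is a linear_char by rewrite qualifE => /andP[].
  apply: cfcenter_full_lin => //; apply/pattern_subP=> beta Sb; apply/subsetP=> b Xb.
  apply/cfcenterP=> // [|a Sa']; first exact: subsetP (root_sub_pattern Sb) b Xb.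
  have [Ea | nba] := eqVneq beta alpha.
    rewrite (subsetP sKK) //; apply: (pattern_commg idK (subxx S) Sb) => // g d Sg.
    by rewrite Ea; apply: cK.
  have Kb : beta \in K.
    have /setUP[// | /setU1P[Eb | ]] := subsetP sS beta Sb; first by rewrite Eb eqxx in nba.
    rewrite AS0 set0U inE Sb /= => /exists_inP[gamma].
    by rewrite AS0 inE.
  by rewrite (subsetP sKK) //; apply: (pattern_commg idK (subxx S) Sb) => // g d Sg; apply: nK.
have [Ag Sg] := setIP ASg; have [delta /setDP[Sd nAd] dga] := hleg gamma ASg.
have clS' : ideal (S :\ gamma) (S :\ gamma).
  apply/idealP; split=> // x y z /setD1P[_ Sx] /setD1P[_ Sy] xyz.
  have [_ cl] := idealP _ _ _ clS; rewrite !inE (cl x y) // andbT.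
  have := sumS x y z Sx Sy xyz; apply: contraTneq => ->.
  rewrite !inE negb_or; apply/andP; split.
    by apply: (@sum_neq _ delta); rewrite sumC.
  by apply: contra nKa => Kg; apply: (nK gamma delta); rewrite // sumC.
have [cSK' red] := remove_arm false cSK Ag Sg Sd dga clS' (fun e => sumS delta e ^~ Sd).
have nSS := ideal_remove clS' Sg clS; have [sPP _] := andP (pattern_normal nSS).
have sub' : (A :&: (S :\ gamma)) :|: leg_in (S :\ gamma) \subset (A :&: S) :|: leg_in S.
  apply/subsetP=> x; rewrite !inE => /orP[/and3P[-> _ ->] // |].
  case/andP=> /andP[_ Sx] /exists_inP[y]; rewrite !inE => /and3P[Ay _ Sy] xya.
  by rewrite Sx; apply/orP; right; apply/exists_inP; exists y; rewrite ?inE ?Ay.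
have hS' : heisenberg (S :\ gamma).
  split=> [g' /setIP[Ag' /setD1P[_ Sg']] | x y xS yS z].
    have [|d' /setDP[Sd' nAd'] dga'] := hleg g'; first by rewrite inE Ag'.
    exists d'; rewrite // !inE nAd' Sd' andbT.
    by apply: contraNneq nAd' => ->.
  by apply: hsum; apply: (subsetP sub').
have sS' : S :\ gamma \subset (delta |: K) :|:
    (alpha |: ((A :&: (S :\ gamma)) :|: leg_in (S :\ gamma))).
  apply/subsetP=> x /setD1P[nxg Sx]; move: (subsetP sS x Sx); rewrite !inE nxg Sx /=.
  case/or4P=> [-> | -> | -> | /exists_inP[y /setIP[Ay Sy] xya]]; rewrite ?orbT //.
  have [Ey | nyg] := eqVneq y gamma; last first.
    by do 3!(apply/orP; right); apply/exists_inP; exists y; rewrite ?inE ?Ay ?nyg.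
  rewrite Ey in xya; rewrite (_ : x = delta) ?eqxx //.
  by apply: sum_cancel (etrans (sumC _ _ _) dga); rewrite sumC.
case: red => _ _ surj /surj[psi Fpsi <-].
have lt_n : (#|A :&: (S :\ gamma)| < n)%N by rewrite -(cardsI_remove Ag Sg).
rewrite cfInd1 // (IHn _ _ lt_n cSK' hS' sS' _ Fpsi) (indexg_pattern clS nSS).
by rewrite (cardsD1 gamma S) Sg addnK expn1 -natrM (cardsI_remove Ag Sg) expnS.
Qed.

(** The restriction of chi to the Heisenberg subgroup has a constituent that is
    nontrivial on X_alpha, and that has degree q^n where n is the number of arms.
    If chi itself has this degree its restriction is irreducible, and a root
    subgroup that commutes with the Heisenberg subgroup acts by scalars. *)
Lemma over_root_degree_ge S K : central_mod S K -> heisenberg S ->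
  {in over_root false S K, forall chi : 'CF(pattern S),
     (q ^ #|A :&: S|)%:R <= chi 1%g /\
     (chi 1%g = (q ^ #|A :&: S|)%:R ->
      {in S, forall beta,
        {in (A :&: S) :|: leg_in S, forall eta delta,
          sum beta eta delta -> delta \in K} ->
        X beta \subset 'Z(chi)%CF})}.
Proof.
move=> cSK [hleg hsum] chi; have [clS idK Sa nKa cK] := cSK.
have [sKS nK] := idealP _ _ _ idK.
rewrite mem_over_root andbT => /and3P[irr_chi sKK nXK].
have Nchi := irrWchar irr_chi.
pose hS := (A :&: S) :|: leg_in S; pose T := K :|: (alpha |: hS).
have sTS : T \subset S.
  rewrite !subUset sKS sub1set Sa subsetIr /=.
  by apply/subsetP=> x; rewrite inE => /andP[].
have EAT : A :&: T = A :&: S.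
  apply/eqP; rewrite eqEsubset setIS //=; apply/subsetP=> x ASx.
  by have [Ax Sx] := setIP ASx; rewrite in_setI Ax /T /hS !in_setU ASx !orbT.
have ELT : leg_in T = leg_in S.
  apply/setP=> x; rewrite !mem_leg_in EAT; apply: andb_id2r => exx.
  apply/idP/idP => [Tx | Sx]; first exact: (subsetP sTS).
  by rewrite /T /hS !in_setU mem_leg_in Sx exx !orbT.
have TP x : x \in T -> [\/ x \in K, x = alpha | x \in hS].
  case/setUP=> [Kx | /setU1P[Ex | hx]]; [exact: Or31 | exact: Or32 | exact: Or33].
have sumT beta gamma delta : beta \in T -> gamma \in T -> sum beta gamma delta ->
    delta \in alpha |: K.
  move=> Tb Tg bgd; have [Sb Sg] := (subsetP sTS _ Tb, subsetP sTS _ Tg).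
  rewrite in_setU1; case: (TP _ Tb) => [Kb | Eb | hb].
  - by rewrite (nK beta gamma) ?orbT.
  - by rewrite Eb in bgd; rewrite (cK gamma) ?orbT.
  case: (TP _ Tg) => [Kg | Eg | hg].
  - by rewrite (nK gamma beta) ?orbT // sumC.
  - by rewrite Eg sumC in bgd; rewrite (cK beta) ?orbT.
  by rewrite (hsum beta gamma hb hg delta bgd) eqxx.
have cTK : central_mod T K.
  split=> // [|||e d Te]; last by apply: cK; apply: (subsetP sTS).
  - apply/idealP; split=> // b c d Tb Tc bcd.
    by have := sumT b c d Tb Tc bcd; rewrite !inE => /orP[] ->; rewrite ?orbT.
  - apply/idealP; split=> [|b c d Kb Tc]; first exact: subsetUl.
    by apply: nK => //; apply: (subsetP sTS).
  by rewrite !inE eqxx orbT.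
have hT : heisenberg T.
  split; rewrite EAT ?ELT // => g ASg; have [d /setDP[Sd nAd] dga] := hleg g ASg.
  exists d; rewrite // in_setD nAd /T /hS !in_setU mem_leg_in Sd /=.
  by have -> : [exists g in A :&: S, sum d g alpha]; [apply/exists_inP; exists g | rewrite !orbT].
have degT : {in over_root false T K, forall theta : 'CF(pattern T),
    theta 1%g = (q ^ #|A :&: S|)%:R}.
  by rewrite -EAT; apply: heisenberg_degree => //; rewrite EAT ELT.
have sPP := pattern_sub sTS.
have NchiT : 'Res[pattern T] chi \is a character by apply: cfRes_char.
have [j Cj nXKj] : exists2 j, j \in irr_constt ('Res[pattern T] chi) &
    ~~ (X alpha \subset cfker 'chi_j).
  apply/exists_inP; apply: contraR nXK; rewrite negb_exists_in => /forall_inP allK.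
  apply: subset_trans (_ : cfker ('Res[pattern T] chi) \subset _); last first.
    by rewrite cfker_Res // subsetIr.
  rewrite cfkerE // subsetI root_sub_pattern; last by rewrite !inE eqxx orbT.
  by apply/bigcapsP=> j /allK; rewrite negbK.
have sKKj : pattern K \subset cfker 'chi_j.
  apply: subset_trans (cfker_constt NchiT Cj); rewrite cfker_Res // subsetI sKK.
  by rewrite pattern_sub // subsetUl.
have deg_j : 'chi_j 1%g = (q ^ #|A :&: S|)%:R.
  by apply: degT; rewrite mem_over_root mem_irr sKKj nXKj.
split=> [|deg_chi beta Sb sum_b].
  by rewrite -deg_j -(cfRes1 (pattern T) chi) char1_ge_constt.
have irrT : 'Res[pattern T] chi \in irr (pattern T).
  have [chi' Nchi' Dchi] := constt_charP _ NchiT Cj.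
  suff z_chi' : chi' = 0 by rewrite Dchi z_chi' addr0 mem_irr.
  apply/eqP; rewrite -char1_eq0 //; have := congr1 (fun f : 'CF(_) => f 1%g) Dchi.
  rewrite cfRes1 deg_chi cfunE deg_j => /eqP.
  by rewrite -{1}[(q ^ _)%:R]addr0 (inj_eq (addrI _)) eq_sym.
apply/subsetP=> b Xb; have Sb' := subsetP (root_sub_pattern Sb) b Xb.
apply: cfcenter_of_irr_Res irrT Sb' _ => // h Th; rewrite (subsetP sKK) //.
apply: (pattern_commg idK sTS Sb) => // e d Te bed; have Se := subsetP sTS e Te.
case: (TP e Te) => [Ke | Ee | he]; last exact: sum_b bed.
  by apply: (nK e beta); rewrite // sumC.
by apply: (cK beta) => //; rewrite -Ee sumC.
Qed.

Lemma root_neq1 gamma : exists2 x, x \in X gamma & x != 1%g.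
Proof. by apply/trivgPn; rewrite trivg_card1 card_X neq_ltn q_gt1 orbT. Qed.

(** The kernel is normal, and the commutators of a nontrivial element of X_beta
    fill the subgroups of the sums. *)
Lemma kernel_ideal S (chi : 'CF(pattern S)) : ideal S S ->
  ideal [set gamma in S | X gamma \subset cfker chi] S.
Proof.
move=> clS; have [_ cl] := idealP _ _ _ clS; apply/idealP; split=> [|b c d].
  by apply/subsetP=> x; rewrite inE => /andP[].
rewrite !inE => /andP[Sb sXK] Sc bcd; rewrite (cl b c) //=.
have [x Xx ntx] := root_neq1 b; apply/subsetP=> z Xz.
have [y Xy <-] := X_pair bcd Xx Xz ntx.
have nKP := subsetP (normal_norm (cfker_normal chi)).
rewrite groupM ?groupV ?memJ_norm ?(subsetP sXK) ?nKP //.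
exact: subsetP (root_sub_pattern Sc) y Xy.
Qed.

(** For characters of least degree the subgroups of the roots that commute with
    the arms and the legs act by scalars, so their commutators are in the kernel. *)
Lemma enlarge_kernel S K K' : central_mod S K -> heisenberg S ->
    ideal K' S -> alpha \notin K' -> K \subset K' ->
    {in K' :\: K, forall delta, exists beta gamma, [/\ beta \in S, gamma \in S,
       {in (A :&: S) :|: leg_in S, forall eta eps,
          sum beta eta eps -> eps \in K} &
       sum beta gamma delta]} ->
  central_mod S K' /\ over_root true S K' = over_root true S K.
Proof.
move=> cSK hS idK' nK'a sKK' forced; have [clS idK Sa nKa cK] := cSK.
split; first by split=> // e d Se aed; apply: (subsetP sKK'); apply: cK aed.
apply: eq_in_filter => chi irr_chi; apply/and3P/and3P=> [] [sKK nXK deg]; split=> //.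
  exact: subset_trans (pattern_sub sKK') sKK.
have Fchi : chi \in over_root false S K by rewrite mem_over_root irr_chi sKK nXK.
have [_ /(_ (eqP deg)) Zchi] := over_root_degree_ge cSK hS Fchi.
apply/pattern_subP=> d K'd; have [Kd | nKd] := boolP (d \in K).
  exact: subset_trans (root_sub_pattern Kd) sKK.
have [|b [c [Sb Sc hb bcd]]] := forced d; first by rewrite inE nKd.
have [x Xx ntx] := root_neq1 b; apply/subsetP=> z Xz.
have [y Xy <-] := X_pair bcd Xx Xz ntx.
have Px := subsetP (root_sub_pattern Sb) x Xx; have Py := subsetP (root_sub_pattern Sc) y Xy.
exact: (elimT (cfcenterP irr_chi Px) (subsetP (Zchi b Sb hb) x Xx)).
Qed.

Hypothesis hA : heisenberg setT.

Lemma heisenberg_sub S : ~: A \subset S -> heisenberg S.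
Proof.
have [hleg hsum] := hA => sAS; split=> [g /setIP[Ag Sg] | b c hb hc].
  have [|d /setDP[_ nAd] dga] := hleg g; first by rewrite !inE Ag.
  by exists d; rewrite // inE nAd (subsetP sAS) // inE.
have sub x : x \in (A :&: S) :|: leg_in S -> x \in (A :&: setT) :|: leg_in setT.
  rewrite !in_setU setIT in_setI !mem_leg_in in_setT => /orP[/andP[->] // | ].
  case/andP=> _ /exists_inP[y /setIP[Ay _] xya]; apply/orP; right.
  by apply/exists_inP; exists y; rewrite ?setIT.
by apply: hsum; apply: sub.
Qed.

(** The state of the reduction after some arms have been removed and the kernel has
    grown from K0 to K. *)
Definition reduced b S K K0 : Prop :=
  [/\ ~: A \subset S, central_mod S K &
      one_to_one (over_root b S K) (over_root b setT K0)
        ('Ind[pattern setT] : 'CF(pattern S) -> 'CF(pattern setT))].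

Lemma reduced0 b K0 : central_mod setT K0 -> reduced b setT K0 K0.
Proof.
move=> cK0; split=> //.
split=> [chi | chi chi' _ _ | chi Fchi]; rewrite ?cfInd_id //.
by exists chi; rewrite ?cfInd_id.
Qed.

Lemma reduced_arm b S K K0 gamma delta :
    reduced b S K K0 -> gamma \in A :&: S -> delta \in S ->
    sum delta gamma alpha -> ideal (S :\ gamma) (S :\ gamma) ->
    (forall eta eps, eta \in S -> sum delta eta eps -> eps \in alpha |: K) ->
  reduced b (S :\ gamma) (delta |: K) K0.
Proof.
move=> [sAS cSK [im inj surj]] /setIP[Ag Sg] Sd dga clS' dS.
have [cSK' [im' inj' surj']] := remove_arm b cSK Ag Sg Sd dga clS' dS.
have Ind2 (psi : 'CF(pattern (S :\ gamma))) : 'Ind[pattern setT] ('Ind[pattern S] psi) = 'Ind[pattern setT] psi.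
  by rewrite cfIndInd ?pattern_sub ?subsetDl ?subsetT.
split=> //.
  apply/subsetP=> x nAx; rewrite !inE (subsetP sAS) // andbT.
  by apply: contraTneq nAx => ->; rewrite inE Ag.
split=> [psi Fpsi | psi psi' Fpsi Fpsi' | chi Fchi].
- by rewrite -Ind2 im ?im'.
- by rewrite -!Ind2 => /inj/inj'; apply; rewrite ?im'.
have [chi' /surj'[psi Fpsi <-] <-] := surj chi Fchi.
by exists psi; rewrite ?Ind2.
Qed.

Lemma reduced_kernel S K K' K0 : reduced true S K K0 ->
    ideal K' S -> alpha \notin K' -> K \subset K' ->
    {in K' :\: K, forall delta, exists beta gamma, [/\ beta \in S, gamma \in S,
       {in (A :&: S) :|: leg_in S, forall eta eps,
          sum beta eta eps -> eps \in K} &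
       sum beta gamma delta]} ->
  reduced true S K' K0.
Proof.
move=> [sAS cSK bij] idK' nK'a sKK' forced.
have [cSK' E] := enlarge_kernel cSK (heisenberg_sub sAS) idK' nK'a sKK' forced.
by split; rewrite ?E.
Qed.

End Reduction.

End PatternGroups.

(** * The root lattice *)

Lemma size8P (v : seq int) : size v = 8 -> exists a1 a2 a3 a4 a5 a6 a7 a8,
  v = [:: a1; a2; a3; a4; a5; a6; a7; a8].
Proof.
by case: v => [|a1[|a2[|a3[|a4[|a5[|a6[|a7[|a8[]]]]]]]]] //; do 8!eexists.
Qed.

Lemma form_explicit a1 a2 a3 a4 a5 a6 a7 a8 b1 b2 b3 b4 b5 b6 b7 b8 :
  form [:: a1; a2; a3; a4; a5; a6; a7; a8] [:: b1; b2; b3; b4; b5; b6; b7; b8] =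
  2 * (a1 * b1 + a2 * b2 + a3 * b3 + a4 * b4 + a5 * b5 + a6 * b6 + a7 * b7 + a8 * b8)
  - (a1 * b3 + a3 * b1 + a3 * b4 + a4 * b3 + a4 * b5 + a5 * b4 + a5 * b6 + a6 * b5
     + a6 * b7 + a7 * b6 + a7 * b8 + a8 * b7 + a2 * b4 + a4 * b2).
Proof.
by rewrite /form /cartan /=; ring.
Qed.

(** A locked copy of the form, so that no conversion test unfolds its 64 terms. *)
Definition dot : seq int -> seq int -> int := locked form.

Lemma dotE u v : form u v = dot u v.
Proof. by rewrite /dot -(lock form). Qed.

Ltac vec8 v := move: v => /size8P[? [? [? [? [? [? [? [? ->]]]]]]]].

Lemma dot_explicit a1 a2 a3 a4 a5 a6 a7 a8 b1 b2 b3 b4 b5 b6 b7 b8 :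
  dot [:: a1; a2; a3; a4; a5; a6; a7; a8] [:: b1; b2; b3; b4; b5; b6; b7; b8] =
  2 * (a1 * b1 + a2 * b2 + a3 * b3 + a4 * b4 + a5 * b5 + a6 * b6 + a7 * b7 + a8 * b8)
  - (a1 * b3 + a3 * b1 + a3 * b4 + a4 * b3 + a4 * b5 + a5 * b4 + a5 * b6 + a6 * b5
     + a6 * b7 + a7 * b6 + a7 * b8 + a8 * b7 + a2 * b4 + a4 * b2).
Proof. by rewrite -dotE form_explicit. Qed.

Lemma size_addv u v : size (addv u v) = 8.
Proof. by rewrite size_map. Qed.

Lemma size_scalev c v : size (scalev c v) = 8.
Proof. by rewrite size_map. Qed.

Lemma vaddC u v : addv u v = addv v u.
Proof. by apply: eq_map => j; rewrite addrC. Qed.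

Lemma vaddA u v w : addv u (addv v w) = addv (addv u v) w.
Proof. by rewrite /addv /coord /= !addrA. Qed.

Lemma vadd0 v : size v = 8 -> addv v zerov = v.
Proof. by move=> sv; vec8 sv; rewrite /addv /coord /= !addr0. Qed.

Lemma vaddI u v w : size v = 8 -> size w = 8 -> addv u v = addv u w -> v = w.
Proof. by move=> sv sw; vec8 sv; vec8 sw; rewrite /addv /coord /= => -[]; do 8!move=> /addrI->. Qed.

Definition oppv v := scalev (-1) v.

Lemma vaddN v : addv v (oppv v) = zerov.
Proof. by rewrite /addv /coord /= /coord !mulN1r !addrN. Qed.

Lemma dotDl u v w : size u = 8 -> size v = 8 -> size w = 8 ->
  dot (addv u v) w = dot u w + dot v w.
Proof.
move=> su sv sw; vec8 su; vec8 sv; vec8 sw.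
by rewrite /addv /coord /= !dot_explicit; ring.
Qed.

Lemma dotZl c v w : size v = 8 -> size w = 8 -> dot (scalev c v) w = c * dot v w.
Proof.
by move=> sv sw; vec8 sv; vec8 sw; rewrite /scalev /coord /= !dot_explicit; ring.
Qed.

Lemma dotC u v : size u = 8 -> size v = 8 -> dot u v = dot v u.
Proof. by move=> su sv; vec8 su; vec8 sv; rewrite !dot_explicit; ring. Qed.

(** The diagonalisation of the form, which shows that it is positive definite. *)
Lemma dot_sum_squares a1 a2 a3 a4 a5 a6 a7 a8 :
  60 * dot [:: a1; a2; a3; a4; a5; a6; a7; a8] [:: a1; a2; a3; a4; a5; a6; a7; a8] =
    30 * (2 * a1 - a3) ^+ 2 + 10 * (3 * a3 - 2 * a4) ^+ 2
    + 30 * (2 * a2 - a4) ^+ 2 + 30 * (2 * a8 - a7) ^+ 2 + 10 * (3 * a7 - 2 * a6) ^+ 2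
    + 5 * (4 * a6 - 3 * a5) ^+ 2 + 3 * (5 * a5 - 4 * a4) ^+ 2 + 2 * a4 ^+ 2.
Proof. by rewrite dot_explicit; ring. Qed.

Lemma dot_ge0 v : size v = 8 -> 0 <= dot v v.
Proof.
move=> sv; vec8 sv; rewrite -(pmulr_rge0 _ (isT : 0 < 60 :> int)) dot_sum_squares.
by rewrite !addr_ge0 // mulr_ge0 // sqr_ge0.
Qed.

Lemma dot_eq0 v : size v = 8 -> dot v v = 0 -> v = zerov.
Proof.
case/size8P=> [a1 [a2 [a3 [a4 [a5 [a6 [a7 [a8 ->]]]]]]]] f0.
have /esym/eqP := dot_sum_squares a1 a2 a3 a4 a5 a6 a7 a8; rewrite f0 mulr0.
have ge0 (n : nat) (x : int) : 0 <= n%:R * x ^+ 2 by rewrite mulr_ge0 ?sqr_ge0.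
have z (n : nat) (x : int) : (n.+1%:R * x ^+ 2 == 0) = (x == 0).
  by rewrite mulf_eq0 sqrf_eq0 pnatr_eq0.
rewrite !paddr_eq0 ?addr_ge0 ?ge0 // !z -!andbA.
do 7![case/andP=> /eqP ?]; move=> /eqP ?; clear ge0 z f0.
by rewrite /zerov /=; do !congr (_ :: _); lia.
Qed.

Lemma dotDr u v w : size u = 8 -> size v = 8 -> size w = 8 ->
  dot u (addv v w) = dot u v + dot u w.
Proof.
move=> su sv sw; rewrite dotC ?size_addv // dotDl //.
by rewrite [dot v u]dotC // [dot w u]dotC.
Qed.

Lemma dotZr c u v : size u = 8 -> size v = 8 -> dot u (scalev c v) = c * dot u v.
Proof. by move=> su sv; rewrite dotC ?size_scalev // dotZl // dotC. Qed.

(** * Roots *)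

Definition refl u v := addv v (scalev (- dot v u) u).

Lemma reflect_simpleE j v : reflect_simple j v = refl (simple j) v.
Proof. by rewrite /refl -dotE. Qed.

Lemma size_refl u v : size (refl u v) = 8.
Proof. exact: size_addv. Qed.

Lemma dot_refl u v w : size u = 8 -> size v = 8 -> size w = 8 -> dot u u = 2 ->
  dot (refl u v) (refl u w) = dot v w.
Proof.
move=> su sv sw Nu; rewrite /refl !(dotDl, dotDr, dotZl, dotZr) ?size_addv ?size_scalev //.
by rewrite Nu [dot u w]dotC //; ring.
Qed.

Lemma dot_refll u v : size u = 8 -> size v = 8 -> dot u u = 2 ->
  dot (refl u v) u = - dot v u.
Proof.
by move=> su sv Nu; rewrite dotDl ?size_scalev // dotZl // Nu; ring.
Qed.

Lemma reflK u v : size u = 8 -> size v = 8 -> dot u u = 2 -> refl u (refl u v) = v.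
Proof.
move=> su sv Nu; rewrite {1}/refl dot_refll // /refl opprK.
move: (dot v u) => c; vec8 su; vec8 sv; rewrite /addv /scalev /coord /=.
by do !congr (_ :: _); ring.
Qed.

(** A reflection conjugates the reflection in u to that in the image of u. *)
Lemma refl_conj s u v : size s = 8 -> size u = 8 -> size v = 8 -> dot s s = 2 ->
  refl (refl s u) v = refl s (refl u (refl s v)).
Proof.
move=> ss su sv Ns; have E : dot (refl s v) u = dot v (refl s u).
  by rewrite -(dot_refl ss (size_refl s v) su Ns) reflK.
rewrite [refl u _]/refl E [in LHS]/refl; move: (dot v (refl s u)) => c.
rewrite [refl s (addv _ _)]/refl dotDl ?size_refl ?size_scalev // dotZl // dot_refll //.
rewrite /refl; move: (dot v s) (dot u s) => d e.
vec8 ss; vec8 su; vec8 sv; rewrite /addv /scalev /coord /=.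
by do !congr (_ :: _); ring.
Qed.

(** A locked copy, so that no conversion test runs through the reflections. *)
Definition rootset : nat -> seq (seq int) := locked Phi.

Lemma rootsetE k : Phi k = rootset k.
Proof. by rewrite /rootset -(lock Phi). Qed.

Section PhiTheory.

Variable i : nat.

Lemma reflection_closure_ind (Q : seq int -> Prop) n s front :
  (forall j v, j \in nodes i -> Q v -> Q (reflect_simple j v)) ->
  (forall v, v \in s -> Q v) -> (forall v, v \in front -> Q v) ->
  forall v, v \in reflection_closure i n s front -> Q v.
Proof.
move=> Qrefl; elim: n s front => //= n IHn s front Qs Qf; apply: IHn => v.
  rewrite mem_cat mem_undup mem_filter => /orP[/Qs // | /andP[_]].
  by case/allpairsP=> [[j w] [/= ji /Qf Qw ->]]; apply: Qrefl.
rewrite mem_undup mem_filter => /andP[_].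
by case/allpairsP=> [[j w] [/= ji /Qf Qw ->]]; apply: Qrefl.
Qed.

Lemma Phi_orbit_ind (Q : seq int -> Prop) :
  (forall j, j \in nodes i -> Q (simple j)) ->
  (forall j v, j \in nodes i -> Q v -> Q (reflect_simple j v)) ->
  forall v, v \in Phi i -> Q v.
Proof.
move=> Qs Qrefl; apply: reflection_closure_ind => // v /mapP[j ji ->]; exact: Qs.
Qed.

Lemma size_Phi_elt v : v \in Phi i -> size v = 8.
Proof. by move: v; apply: Phi_orbit_ind => [j _ | j v _ _]; rewrite size_map. Qed.

Lemma sub_reflection_closure n s front : {subset s <= reflection_closure i n s front}.
Proof.
elim: n s front => [|n IHn] s front v sv //=.
by apply: IHn; rewrite mem_cat sv.
Qed.

Lemma simple_Phi j : j \in nodes i -> simple j \in Phi i.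
Proof. by move=> ji; apply: sub_reflection_closure; apply: map_f. Qed.

Lemma uniq_reflection_closure n s front : uniq s -> uniq (reflection_closure i n s front).
Proof.
elim: n s front => //= n IHn s front Us; apply: IHn.
rewrite cat_uniq Us undup_uniq andbT; apply/hasPn=> v.
by rewrite mem_undup mem_filter => /andP[].
Qed.

Lemma uniq_Phi : uniq [seq simple j | j <- nodes i] -> uniq (Phi i).
Proof. exact: uniq_reflection_closure. Qed.

Lemma simple_rootset j : j \in nodes i -> simple j \in rootset i.
Proof. by rewrite -rootsetE; apply: simple_Phi. Qed.

Lemma size_rootset v : v \in rootset i -> size v = 8.
Proof. by rewrite -rootsetE; apply: size_Phi_elt. Qed.

Lemma coord_addv u v j : j \in nodes 8 -> coord (addv u v) j = coord u j + coord v j.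
Proof. by rewrite mem_iota; case: j => [|[|[|[|[|[|[|[|[]]]]]]]]]. Qed.

Lemma coord_scalev c v j : j \in nodes 8 -> coord (scalev c v) j = c * coord v j.
Proof. by rewrite mem_iota; case: j => [|[|[|[|[|[|[|[|[]]]]]]]]]. Qed.

Lemma coord_simple j k : k \in nodes 8 -> coord (simple j) k = (k == j)%:Z.
Proof. by rewrite mem_iota; case: k => [|[|[|[|[|[|[|[|[]]]]]]]]]. Qed.

Lemma Phi_outside v j : v \in rootset i -> j \in nodes 8 -> (i < j)%N -> coord v j = 0.
Proof.
rewrite -rootsetE => Phiv j8 lt_ij.
move: v Phiv; apply: Phi_orbit_ind => [k | k v]; rewrite mem_iota add1n ltnS => /andP[_ le_k].
  by rewrite coord_simple // gtn_eqF // (leq_ltn_trans le_k).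
rewrite coord_addv // coord_scalev // coord_simple // => ->.
by rewrite gtn_eqF ?mulr0 // (leq_ltn_trans le_k).
Qed.

Hypothesis hi : i \in [:: 6; 7; 8].

Lemma nodes_sub j : j \in nodes i -> j \in nodes 8.
Proof.
rewrite !mem_iota => /andP[-> lt_j] /=; apply: leq_trans lt_j _.
by move: hi; rewrite !inE => /or3P[] /eqP->.
Qed.

Lemma dot_simple j : j \in nodes 8 -> dot (simple j) (simple j) = 2.
Proof.
by rewrite mem_iota; case: j => [|[|[|[|[|[|[|[|[]]]]]]]]] //= _; rewrite dot_explicit.
Qed.

(** Every root is the image of a simple root under simple reflections, which
    preserve the form and the root system: so its square is 2 and its own
    reflection, conjugate to a simple one, preserves the root system too. *)
Lemma Phi_root u : u \in rootset i ->
  dot u u = 2 /\ (forall v, v \in rootset i -> refl u v \in rootset i).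
Proof.
suff: u \in rootset i -> [/\ size u = 8, dot u u = 2 &
    forall v, v \in rootset i -> refl u v \in rootset i].
  by move=> H /H[].
move: u; have closed j v : j \in nodes i -> v \in rootset i -> refl (simple j) v \in rootset i.
  move=> ji Phiv; rewrite -reflect_simpleE -rootsetE in Phiv *.
  exact: (allP (allP (allP Phi_closed i hi) v Phiv) j ji).
rewrite -{1}rootsetE; apply: Phi_orbit_ind => [j ji | j u ji [su Nu closed_u]].
  split.
  - by rewrite size_map.
  - by rewrite dot_simple ?nodes_sub.
  - by move=> v; apply: (closed j v ji).
have Nj := dot_simple (nodes_sub ji); have sj : size (simple j) = 8 by rewrite size_map.
rewrite reflect_simpleE.
split=> [||v Phiv]; [exact: size_refl | by rewrite dot_refl | ].
rewrite (refl_conj sj su (size_rootset Phiv) Nj); apply: (closed j _ ji); apply: closed_u.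
exact: (closed j v ji).
Qed.

Lemma dot_Phi u : u \in rootset i -> dot u u = 2.
Proof. by case/Phi_root. Qed.

Lemma size_oppv v : size (oppv v) = 8.
Proof. exact: size_scalev. Qed.

Lemma oppv_Phi u : u \in rootset i -> oppv u \in rootset i.
Proof.
move=> Pu; have [Nu /(_ u Pu)] := Phi_root Pu; rewrite /refl Nu.
have su := size_rootset Pu; suff -> : addv u (scalev (- 2) u) = oppv u by [].
by vec8 su; rewrite /addv /oppv /scalev /coord /=; do !congr (_ :: _); ring.
Qed.

Lemma dot_opp u v : size u = 8 -> size v = 8 -> dot u (oppv v) = - dot u v.
Proof. by move=> su sv; rewrite dotZr // mulN1r. Qed.

Lemma dot_addv u v : u \in rootset i -> v \in rootset i ->
  dot (addv u v) (addv u v) = 4 + 2 * dot u v.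
Proof.
move=> Pu Pv; have [su sv] := (size_rootset Pu, size_rootset Pv).
rewrite dotDl ?size_addv // !dotDr //.
rewrite (dot_Phi Pu) (dot_Phi Pv) (dotC sv su).
move: (dot u v) => f. ring.
Qed.

Lemma dot_eqN2 u v : u \in rootset i -> v \in rootset i ->
  -2 <= dot u v /\ (dot u v = -2 -> addv u v = zerov).
Proof.
move=> Pu Pv; have := dot_ge0 (size_addv u v); rewrite dot_addv // => ge0.
split=> [|f]; first by move: ge0; move: (dot u v); clear; lia.
by apply: dot_eq0; rewrite ?size_addv // dot_addv // f.
Qed.

Lemma vadd_eq0 u v : size u = 8 -> size v = 8 -> addv u v = zerov -> u = oppv v.
Proof.
move=> su sv E; apply: (@vaddI v); rewrite ?size_oppv //.
by rewrite vaddN vaddC.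
Qed.

Lemma oppvK v : size v = 8 -> oppv (oppv v) = v.
Proof. by move=> sv; vec8 sv; rewrite /oppv /scalev /coord /= !mulN1r !opprK. Qed.

Lemma dot_eq2 u v : u \in rootset i -> v \in rootset i ->
  dot u v <= 2 /\ (dot u v = 2 -> u = v).
Proof.
move=> Pu Pv; have [su sv] := (size_rootset Pu, size_rootset Pv).
have [le eq] := dot_eqN2 Pu (oppv_Phi Pv); rewrite dot_opp // in le eq.
split=> [|f]; first by move: le; move: (dot u v); clear; lia.
have := eq; rewrite f => /(_ erefl) E.
by rewrite (vadd_eq0 _ _ E) ?size_oppv // oppvK.
Qed.

Lemma zerov_Phi : zerov \notin rootset i.
Proof. by apply/negP=> /dot_Phi; rewrite dot_explicit. Qed.

(** The square of the sum is 4 + 2 (u, v), which is 2 only if the product is -1;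
    conversely the sum is then the reflection of v in u. *)
Lemma vadd_Phi u v : u \in rootset i -> v \in rootset i ->
  (addv u v \in rootset i) = (dot u v == -1).
Proof.
move=> Pu Pv; have [su sv] := (size_rootset Pu, size_rootset Pv).
apply/idP/eqP => [/dot_Phi | f].
  by rewrite dot_addv //; move: (dot u v); clear; lia.
have [_ /(_ v Pv)] := Phi_root Pu; rewrite /refl dotC // f opprK vaddC.
suff -> : scalev 1 u = u by [].
by vec8 su; rewrite /scalev /coord /= !mul1r.
Qed.

End PhiTheory.

(** * The sign cocycle *)

Section Cocycle.

Implicit Types u v w : seq int.

Lemma signD (m n : int) : (-1 : int) ^ (m + n) = (-1) ^ m * (-1) ^ n.
Proof. by rewrite exprzDr ?unitrN1. Qed.

Lemma sign_even (n : int) : (-1 : int) ^ (2 * n) = 1.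
Proof. by rewrite -exprz_exp exp1rz. Qed.

Lemma sign_eq (m n k : int) : m = n + 2 * k -> (-1 : int) ^ m = (-1) ^ n.
Proof. by move->; rewrite signD sign_even mulr1. Qed.

Lemma eps_explicit a1 a2 a3 a4 a5 a6 a7 a8 b1 b2 b3 b4 b5 b6 b7 b8 :
  eps [:: a1; a2; a3; a4; a5; a6; a7; a8] [:: b1; b2; b3; b4; b5; b6; b7; b8] =
  (-1) ^ (a1 * b1 + a2 * b2 + a3 * b3 + a4 * b4 + a5 * b5 + a6 * b6 + a7 * b7 + a8 * b8
     + a1 * b3 + a3 * b4 + a4 * b5 + a5 * b6 + a6 * b7 + a7 * b8 + a2 * b4).
Proof. by rewrite /eps /=; congr (_ ^ _); ring. Qed.

Definition cocycle : seq int -> seq int -> int := locked eps.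

Lemma cocycleE u v : eps u v = cocycle u v.
Proof. by rewrite /cocycle -(lock eps). Qed.

Lemma cocycleDl u v w : size u = 8 -> size v = 8 -> size w = 8 ->
  cocycle (addv u v) w = cocycle u w * cocycle v w.
Proof.
move=> su sv sw; vec8 su; vec8 sv; vec8 sw; rewrite /addv /coord /= -!cocycleE.
by rewrite !eps_explicit -signD; congr (_ ^ _); ring.
Qed.

Lemma cocycleDr u v w : size u = 8 -> size v = 8 -> size w = 8 ->
  cocycle u (addv v w) = cocycle u v * cocycle u w.
Proof.
move=> su sv sw; vec8 su; vec8 sv; vec8 sw; rewrite /addv /coord /= -!cocycleE.
by rewrite !eps_explicit -signD; congr (_ ^ _); ring.
Qed.

Lemma cocycle_sqr u v : cocycle u v * cocycle u v = 1.
Proof. by rewrite -cocycleE /eps -signD -mulr2n -mulr_natl sign_even. Qed.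

Lemma cocycleC u v : size u = 8 -> size v = 8 ->
  cocycle v u = (-1) ^ dot u v * cocycle u v.
Proof.
case/size8P=> [a1 [a2 [a3 [a4 [a5 [a6 [a7 [a8 ->]]]]]]]].
case/size8P=> [b1 [b2 [b3 [b4 [b5 [b6 [b7 [b8 ->]]]]]]]].
rewrite -!cocycleE dot_explicit !eps_explicit -signD.
apply: (@sign_eq _ _ (b1 * a3 + b3 * a4 + b4 * a5 + b5 * a6 + b6 * a7 + b7 * a8 + b2 * a4
  - (a1 * b1 + a2 * b2 + a3 * b3 + a4 * b4 + a5 * b5 + a6 * b6 + a7 * b7 + a8 * b8))).
ring.
Qed.

Lemma cocycle_self u : size u = 8 -> dot u u = 2 -> cocycle u u = -1.
Proof.
case/size8P=> [a1 [a2 [a3 [a4 [a5 [a6 [a7 [a8 ->]]]]]]]].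
rewrite -cocycleE dot_explicit eps_explicit; set f := (X in X = 2 -> _) => E.
pose k := a1 * a3 + a3 * a4 + a4 * a5 + a5 * a6 + a6 * a7 + a7 * a8 + a2 * a4.
rewrite (@sign_eq _ 1 k) //; apply: (@mulfI _ 2) => //.
by transitivity (f + 4 * k); [rewrite /f /k | rewrite E]; ring.
Qed.

Lemma cocycle0r u : size u = 8 -> cocycle u zerov = 1.
Proof.
case/size8P=> [a1 [a2 [a3 [a4 [a5 [a6 [a7 [a8 ->]]]]]]]].
by rewrite -cocycleE eps_explicit !mulr0 !addr0.
Qed.

Lemma cocycleNr u v : size u = 8 -> size v = 8 -> cocycle u (oppv v) = cocycle u v.
Proof.
move=> su sv; rewrite -[LHS]mulr1 -(cocycle_sqr u v) mulrA -cocycleDr ?size_oppv //.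
by rewrite [addv _ v]vaddC vaddN cocycle0r ?mul1r.
Qed.

End Cocycle.

(** * The adjoint representation *)

Lemma sum_if_eq (T : eqType) (s : seq T) (x : T) (F : T -> int) : uniq s ->
  \sum_(y <- s) (if y == x then F y else 0) = if x \in s then F x else 0.
Proof.
move=> Us; have [sx | nsx] := boolP (x \in s).
  rewrite (bigD1_seq x) //= eqxx big1 ?addr0 // => y /negPf->; exact: erefl.
rewrite big_seq big1 // => y sy; case: eqP => // Ey.
by rewrite Ey (negPf nsx) in sy.
Qed.

Section LieAlgebra.

Variable i : nat.
Hypothesis hi : i \in [:: 6; 7; 8]%N.
Implicit Types (b c d e : seq int) (x y z : nat + seq int).

Lemma uniq_rootset : uniq (rootset i).
Proof.
rewrite -rootsetE; apply: uniq_Phi.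
by move: hi; rewrite !inE => /or3P[] /eqP->.
Qed.

Definition basis : seq (nat + seq int) :=
  [seq inl j | j <- nodes i] ++ [seq inr delta | delta <- rootset i].

Lemma lie_basisE : lie_basis i = basis.
Proof. by rewrite /lie_basis rootsetE. Qed.

Lemma mem_basis_inl j : (inl j \in basis) = (j \in nodes i).
Proof.
rewrite mem_cat mem_map => [|x y []//]; rewrite orbC; case: mapP => // [[d _]] //.
Qed.

Lemma mem_basis_inr d : (inr d \in basis) = (d \in rootset i).
Proof.
rewrite mem_cat [X in _ || X]mem_map => [|x y []//]; case: mapP => // [[j _]] //.
Qed.

Lemma bracket_inr_inl c d j :
  bracket c (inr d) (inl j) = if d == c then - dot c (simple j) else 0.
Proof. by rewrite -dotE. Qed.

Lemma bracket_inr_inr c d d' :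
  bracket c (inr d') (inr d) = if d' == addv c d then cocycle c d else 0.
Proof. by rewrite -cocycleE. Qed.

(** The coefficient of x in the image of y under two successive brackets. *)
Definition nested b c x y : int :=
  \sum_(z <- basis) bracket b x z * bracket c z y.

Lemma dot_nodes b c : b \in rootset i -> c \in rootset i ->
  \sum_(j <- nodes i) dot b (simple j) * coord c j = dot b c.
Proof.
move=> Pb Pc; have z j := Phi_outside Pc (j := j).
have [sb sc] := (size_rootset Pb, size_rootset Pc).
transitivity (\sum_(j <- nodes 8) dot b (simple j) * coord c j).
  have -> : nodes 8 = nodes i ++ iota i.+1 (8 - i).
    by move: hi; rewrite !inE => /or3P[] /eqP->.
  rewrite big_cat /= [X in _ + X]big_seq [X in _ + X]big1 ?addr0 // => j.
  rewrite mem_iota => /andP[lt_ij lt_j]; rewrite z ?mulr0 // mem_iota.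
  rewrite (leq_trans _ lt_ij) //=; apply: leq_trans lt_j _.
  by move: hi; rewrite !inE => /or3P[] /eqP->.
vec8 sb; vec8 sc; rewrite !big_cons big_nil /simple /coord /= !dot_explicit; ring.
Qed.

Lemma nested_inl b c x j : c \in rootset i ->
  nested b c x (inl j) = - dot c (simple j) * bracket b x (inr c).
Proof.
move=> Pc; rewrite /nested big_cat !big_map /= big1 ?add0r => [|k _]; last by rewrite mulr0.
transitivity (\sum_(d <- rootset i) if d == c then - dot c (simple j) * bracket b x (inr d) else 0).
  by apply: eq_bigr => d _; rewrite -dotE; case: eqP => _; rewrite ?mulr0 // mulrC.
by rewrite sum_if_eq ?uniq_rootset // Pc.
Qed.

Lemma nested_inr b c x d : b \in rootset i -> c \in rootset i -> d \in rootset i ->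
  nested b c x (inr d) =
    (if (addv c d == zerov) && (x == inr b) then dot b c else 0) +
    (if addv c d \in rootset i then cocycle c d * bracket b x (inr (addv c d)) else 0).
Proof.
move=> Pb Pc Pd; rewrite /nested big_cat !big_map; congr (_ + _); last first.
  transitivity (\sum_(e <- rootset i)
      if e == addv c d then cocycle c d * bracket b x (inr e) else 0).
    by apply: eq_bigr => e _; rewrite bracket_inr_inr; case: eqP => _; rewrite ?mulr0 // mulrC.
  by rewrite sum_if_eq ?uniq_rootset.
rewrite /=; case: (addv c d == zerov); last by rewrite big1 // => j _; rewrite mulr0.
case: x => [k | e] /=; first by rewrite big1 // => j _; rewrite mul0r.
rewrite -[inr e == inr b]/(e == b); case: eqP => _; last by rewrite big1 // => j _; rewrite mul0r.
rewrite -(dot_nodes Pb Pc); apply: eq_bigr => j _.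
by rewrite dotE mulrN mulNr opprK.
Qed.

Lemma dot_range b c : b \in rootset i -> c \in rootset i -> b != c -> addv b c != zerov ->
  [\/ dot b c = -1, dot b c = 0 | dot b c = 1].
Proof.
move=> Pb Pc nbc nbc0; have [le2 eq2] := dot_eq2 hi Pb Pc.
have [leN2 eqN2] := dot_eqN2 hi Pb Pc.
have n2 : dot b c <> 2 by move/eq2 => E; rewrite E eqxx in nbc.
have nN2 : dot b c <> -2 by move/eqN2 => E; rewrite E eqxx in nbc0.
have [E | [E | E]] : dot b c = -1 \/ dot b c = 0 \/ dot b c = 1.
- by move: le2 leN2 n2 nN2; move: (dot b c); clear; lia.
- exact: Or31.
- exact: Or32.
exact: Or33.
Qed.

Lemma vaddCA u v w : addv u (addv v w) = addv v (addv u w).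
Proof. by rewrite !vaddA [addv u v]vaddC. Qed.

Lemma vaddNK u v : size v = 8%N -> addv u (addv v (oppv u)) = v.
Proof. by move=> sv; rewrite vaddCA vaddN vadd0. Qed.

Lemma nested_comm_opp b c e : b \in rootset i -> c \in rootset i -> b != c ->
    addv b c != zerov ->
  nested b c (inr e) (inr (oppv c)) - nested c b (inr e) (inr (oppv c)) =
  if dot b c == -1 then cocycle b c * bracket (addv b c) (inr e) (inr (oppv c)) else 0.
Proof.
move=> Pb Pc nbc nbc0; have [sb sc] := (size_rootset Pb, size_rootset Pc).
have PNc := oppv_Phi hi Pc.
have nbNc : addv b (oppv c) != zerov.
  by apply: contra nbc => /eqP/vadd_eq0->; rewrite ?size_oppv // oppvK.
rewrite !nested_inr // vaddN eqxx (negPf (zerov_Phi hi)) (negPf nbNc) andTb andFb addr0 add0r.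
rewrite !bracket_inr_inr vadd_Phi // dot_opp // vaddNK // [addv (addv b c) _]vaddC.
rewrite vaddCA [addv (oppv c) c]vaddC vaddN vadd0 // -[inr e == inr b]/(e == b).
case: eqP => _; last by rewrite !mulr0 !if_same subr0.
have Ncc := cocycle_self sc (dot_Phi hi Pc).
rewrite cocycleDr ?size_oppv // cocycleDl ?size_oppv // !cocycleNr // Ncc.
rewrite [cocycle c b]cocycleC //; have sq := cocycle_sqr b c.
case: (dot_range Pb Pc nbc nbc0) => -> /=.
- by rewrite subr0 mulrN1 mulrN sq.
- by rewrite subr0.
by rewrite expr1z mulN1r mulrNN mulr1 sq subrr.
Qed.

Lemma nested_comm_inr b c e d : b \in rootset i -> c \in rootset i -> b != c ->
    addv b c != zerov -> d \in rootset i -> e \in rootset i ->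
  nested b c (inr e) (inr d) - nested c b (inr e) (inr d) =
  if dot b c == -1 then cocycle b c * bracket (addv b c) (inr e) (inr d) else 0.
Proof.
move=> Pb Pc nbc nbc0 Pd Pe.
have [sb sc sd] := And3 (size_rootset Pb) (size_rootset Pc) (size_rootset Pd).
have [E | ncd] := eqVneq (addv c d) zerov.
  have -> : d = oppv c by apply: vadd_eq0; rewrite // vaddC.
  exact: nested_comm_opp.
have [E | nbd] := eqVneq (addv b d) zerov.
  have -> : d = oppv b by apply: vadd_eq0; rewrite // vaddC.
  have ncb : c != b by rewrite eq_sym.
  have ncb0 : addv c b != zerov by rewrite vaddC.
  rewrite -opprB (nested_comm_opp e Pc Pb ncb ncb0) [dot c b]dotC //.
  case: eqP => [Ebc | _]; last by rewrite oppr0.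
  by rewrite cocycleC // Ebc exprN1 invrN1 mulN1r mulNr opprK vaddC.
rewrite !nested_inr // (negPf ncd) (negPf nbd) !add0r !vadd_Phi // !bracket_inr_inr.
have Es : addv (addv b c) d = addv b (addv c d) by rewrite vaddA.
rewrite (vaddCA c b d) Es; case: (eqVneq e) => [Ee | _]; last by rewrite !mulr0 !if_same subr0.
have Ne := dot_Phi hi Pe; rewrite Ee in Ne.
have {}Ne : dot b c + dot b d + dot c d = -2.
  move: Ne; rewrite !(dotDl, dotDr) ?size_addv // !(dot_Phi hi) // [dot d b]dotC // [dot c b]dotC //.
  rewrite [dot d c]dotC //; move: (dot b c) (dot b d) (dot c d); clear; lia.
have [le_cd cd0] := dot_eqN2 hi Pc Pd; have [le_bd bd0] := dot_eqN2 hi Pb Pd.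
have {}cd0 : dot c d <> -2 by move/cd0 => E; rewrite E eqxx in ncd.
have {}bd0 : dot b d <> -2 by move/bd0 => E; rewrite E eqxx in nbd.
rewrite !cocycleDr // cocycleDl // [cocycle c b]cocycleC //.
set s := cocycle b c; set t := cocycle b d; set u := cocycle c d.
move: Ne le_cd le_bd cd0 bd0.
case: (dot_range Pb Pc nbc nbc0) => -> Ne le_cd le_bd cd0 bd0.
- have [[-> ->] | [-> ->]] : dot c d = -1 /\ dot b d = 0 \/ dot c d = 0 /\ dot b d = -1.
    by move: Ne le_cd le_bd cd0 bd0; move: (dot c d) (dot b d); clear; lia.
    by rewrite /= subr0; ring.
  by rewrite /= exprN1 invrN1; ring.
- have [-> ->] : dot c d = -1 /\ dot b d = -1.
    by move: Ne le_cd le_bd cd0 bd0; move: (dot c d) (dot b d); clear; lia.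
  by rewrite /= expr0z; ring.
by exfalso; move: Ne le_cd le_bd cd0 bd0; move: (dot c d) (dot b d); clear; lia.
Qed.

Lemma nested_comm_inl b c k d : b \in rootset i -> c \in rootset i ->
    addv b c != zerov -> d \in rootset i -> k \in nodes 8 ->
  nested b c (inl k) (inr d) - nested c b (inl k) (inr d) =
  if dot b c == -1 then cocycle b c * bracket (addv b c) (inl k) (inr d) else 0.
Proof.
move=> Pb Pc nbc0 Pd k8.
have [sb sc sd] := And3 (size_rootset Pb) (size_rootset Pc) (size_rootset Pd).
have nl v : (inl k == inr v :> nat + seq int) = false by [].
rewrite !nested_inr // !nl !andbF !add0r /bracket.
have Es : addv (addv b c) d = addv b (addv c d) by rewrite vaddA.
rewrite (vaddCA c b d) Es; case: eqP => [E0 | _]; last by rewrite !mulr0 !if_same subr0.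
have Dd : d = oppv (addv b c) by apply: vadd_eq0; rewrite ?size_addv // vaddC Es.
have Pbc : addv b c \in rootset i by rewrite -[addv b c]oppvK ?size_addv // -Dd oppv_Phi.
have Ebc : dot b c = -1 by apply/eqP; rewrite -(vadd_Phi hi).
have Ecd : addv c d = oppv b.
  by apply: vadd_eq0; rewrite ?size_addv // vaddC.
have Ebd : addv b d = oppv c.
  by apply: vadd_eq0; rewrite ?size_addv // vaddC vaddCA E0.
rewrite Ecd Ebd !oppv_Phi // Ebc eqxx Dd !cocycleNr ?size_addv // !cocycleDr //.
rewrite !cocycle_self ?(dot_Phi hi) // [cocycle c b]cocycleC // Ebc coord_addv // exprN1 invrN1.
ring.
Qed.

(** The Jacobi identity in the form [ad b, ad c] = cocycle(b, c) ad (b + c). On a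
    root vector d the two nested brackets are signs times e_(b+c+d), and since
    b + c + d has square 2, the inner products of b, c, d leave few cases, in
    each of which the signs agree by bimultiplicativity. *)
Lemma nested_comm b c x y : b \in rootset i -> c \in rootset i -> b != c ->
    addv b c != zerov -> x \in basis -> y \in basis ->
  nested b c x y - nested c b x y =
  if dot b c == -1 then cocycle b c * bracket (addv b c) x y else 0.
Proof.
move=> Pb Pc nbc nbc0; case: y => [j | d]; case: x => [k | e]; last 2 first.
- rewrite mem_basis_inl mem_basis_inr => /nodes_sub k8 Pd; exact: nested_comm_inl (k8 hi).
- by rewrite !mem_basis_inr => Pe Pd; apply: nested_comm_inr.
- rewrite !mem_basis_inl => ki ji; rewrite !nested_inl //= [addv c b]vaddC (negPf nbc0).
  by rewrite !mulr0 subrr; case: ifP => _; rewrite ?mulr0.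
rewrite mem_basis_inr mem_basis_inl => Pe ji; rewrite !nested_inl //.
rewrite bracket_inr_inl !bracket_inr_inr [addv c b]vaddC.
case: eqP => [Ee | _]; last by rewrite !mulr0 subrr if_same.
have [sb sc] := (size_rootset Pb, size_rootset Pc).
have Ebc : dot b c = -1 by apply/eqP; rewrite -(vadd_Phi hi) // -Ee.
rewrite Ebc eqxx [cocycle c b]cocycleC // Ebc exprN1 invrN1 dotDl ?size_map //.
ring.
Qed.

(** A string of roots in direction c has at most two members, unless it runs from
    -c through the coroots to c: so the square of ad c has a single nonzero
    entry. *)
Lemma nested_square c x y : c \in rootset i -> x \in basis -> y \in basis ->
  nested c c x y = if (x == inr c) && (y == inr (oppv c)) then 2 else 0.
Proof.
move=> Pc; have sc := size_rootset Pc; have Nc := dot_Phi hi Pc.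
have ncc : addv c c \notin rootset i by rewrite vadd_Phi // Nc.
have ncc0 : addv c c != zerov.
  apply/eqP=> /(congr1 (fun v => dot v v)); rewrite !(dotDl, dotDr) ?size_addv // Nc.
  by rewrite dot_explicit.
case: y => [j | d] xB.
  move=> _; rewrite nested_inl // andbF; case: x xB => [k | e] /=; first by rewrite (negPf ncc0) mulr0.
  by rewrite mem_basis_inr => Pe; case: eqP => [Ee | _]; [rewrite Ee (negPf ncc) in Pe | rewrite mulr0].
rewrite mem_basis_inr => Pd; have sd := size_rootset Pd.
rewrite nested_inr // Nc -[inr d == inr _]/(d == oppv c).
have -> : (addv c d == zerov) = (d == oppv c).
  apply/eqP/eqP => [E | ->]; last exact: vaddN.
  by apply: vadd_eq0; rewrite // vaddC.
rewrite andbC; case: ifP => [/andP[_ /eqP->] | _].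
  by rewrite vaddN (negPf (zerov_Phi hi)) addr0.
rewrite add0r vadd_Phi //; case: eqP => [Ecd | //].
case: x xB => [k | e] /=.
  move=> _; case: eqP => [E | _]; last by rewrite mulr0.
  exfalso; have := congr1 (dot c) E; rewrite !dotDr ?size_addv // Nc Ecd.
  by move: sc; clear; case/size8P=> [a1 [a2 [a3 [a4 [a5 [a6 [a7 [a8 ->]]]]]]]]; rewrite dot_explicit !mulr0.
rewrite mem_basis_inr => Pe; case: eqP => [Ee | _]; last by rewrite mulr0.
exfalso; have := dot_Phi hi Pe; rewrite Ee !(dotDl, dotDr) ?size_addv //.
by rewrite Nc (dot_Phi hi Pd) [dot d c]dotC // Ecd.
Qed.

End LieAlgebra.

(** * Exponentials and divided squares *)

Section DividedPowers.

Variables (R : comNzRingType) (n : nat).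
Implicit Types A B C : 'M[R]_n.+1.

(** The exponential of t A when the third power of A vanishes and D is the
    divided square of A. *)
Definition exp2 A D (t : R) : 'M[R]_n.+1 := 1 + t *: A + t ^+ 2 *: D.

Lemma exp2D A D s t : A * A = D *+ 2 -> A * D = 0 -> D * A = 0 -> D * D = 0 ->
  exp2 A D (s + t) = exp2 A D s * exp2 A D t.
Proof.
move=> AA AD DA DD; rewrite /exp2 !(mulrDl, mulrDr) !(mul1r, mulr1).
rewrite -!(scalerAl, scalerAr) !scalerA AA AD DA DD !scaler0 !addr0.
by apply/matrixP=> a b; rewrite !mxE; ring.
Qed.

(** What the Heisenberg relation [A, B] = e C with central C implies for the
    divided powers. *)
Definition heisenberg_relations A B C DA DB DC (e : R) : Prop :=
  [/\ [/\ A * B = B * A + e *: C, DA * B = B * DA + e *: (A * C),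
          A * DB = DB * A + e *: (B * C) &
          DA * DB = DB * DA + e *: (B * A * C) + DC],
      [/\ A * C = C * A, DA * C = 0 & DB * C = 0],
      [/\ A * DC = 0, B * DC = 0, DA * DC = 0 & DB * DC = 0] & e * e = 1].

Lemma exp2_commutator A B C DA DB DC e s t :
    heisenberg_relations A B C DA DB DC e ->
  exp2 A DA s * exp2 B DB t = exp2 B DB t * exp2 A DA s * exp2 C DC (e * s * t).
Proof.
case=> [[r1 r2 r3 r4] [AC DAC DBC] [ADC BDC DADC DBDC] ee].
have EM : exp2 B DB t * exp2 A DA s = 1 + s *: A + s ^+ 2 *: DA + t *: B + (t * s) *: (B * A)
    + (t * s ^+ 2) *: (B * DA) + t ^+ 2 *: DB + (t ^+ 2 * s) *: (DB * A)
    + (t ^+ 2 * s ^+ 2) *: (DB * DA).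
  rewrite /exp2 !(mulrDl, mulrDr) !(mul1r, mulr1) -!(scalerAl, scalerAr) !scalerA.
  by apply/matrixP=> a b; rewrite !mxE; ring.
have EC : exp2 B DB t * exp2 A DA s * C = C + s *: (A * C) + t *: (B * C) + (t * s) *: (B * A * C).
  rewrite EM !mulrDl mul1r -!scalerAl -[B * DA * C]mulrA -[DB * A * C]mulrA -[DB * DA * C]mulrA.
  by rewrite AC DAC mulrA !DBC !(mul0r, mulr0, scaler0) !addr0.
have ED : exp2 B DB t * exp2 A DA s * DC = DC.
  rewrite EM !mulrDl mul1r -!scalerAl -[B * A * DC]mulrA -[B * DA * DC]mulrA.
  by rewrite -[DB * A * DC]mulrA -[DB * DA * DC]mulrA ADC BDC DADC DBDC !(mulr0, scaler0) !addr0.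
move: EM EC ED; move: (exp2 B DB t * exp2 A DA s) => M EM EC ED.
rewrite [exp2 C _ _]/exp2 !mulrDr mulr1 -!scalerAr EC ED EM /exp2.
rewrite !(mulrDl, mulrDr, mul1r, mulr1) -!(scalerAl, scalerAr) r1 r2 r3 r4.
have e2 : e ^+ 2 = 1 by rewrite expr2.
rewrite !exprMn e2 mul1r.
by apply/matrixP=> a b; rewrite !mxE; ring.
Qed.

End DividedPowers.

Section IntegralRelations.

Variable n : nat.
Implicit Types A B C : 'M[int]_n.+1.

Lemma mulr2n_injM A B : A *+ 2 = B *+ 2 -> A = B.
Proof.
move=> E; apply/matrixP=> a b; move/matrixP/(_ a b): E; rewrite !mulmxnE.
by move: (A a b) (B a b) => x y; rewrite !mulr2n; clear; lia.
Qed.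

Lemma mulr3n_eq0M A : A *+ 3 = 0 -> A = 0.
Proof.
move=> E; apply/matrixP=> a b; move/matrixP/(_ a b): E; rewrite mulmxnE !mxE.
by move: (A a b) => x; rewrite !mulrS mulr0n; clear; lia.
Qed.

Lemma divided_square A D : A * A = D *+ 2 -> A * D = 0 -> D * A = 0 /\ D * D = 0.
Proof.
move=> AA AD; have DA : D * A = 0.
  by apply: mulr2n_injM; rewrite mul0rn -mulrnAl -AA -mulrA AA mulrnAr AD mul0rn.
by split=> //; apply: mulr2n_injM; rewrite mul0rn -mulrnAl -AA -mulrA AD mulr0.
Qed.

(** Over the integers the relations among the divided squares follow from those
    among the elements by cancelling 2 and 3; from there they hold over every
    ring, also in characteristic 2 and 3. *)
Lemma heisenberg_int A B C DA DB DC (e : int) :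
    A * A = DA *+ 2 -> A * DA = 0 -> B * B = DB *+ 2 -> B * DB = 0 ->
    C * C = DC *+ 2 -> A * B = B * A + e *: C -> A * C = C * A -> B * C = C * B ->
    e * e = 1 ->
  heisenberg_relations A B C DA DB DC e.
Proof.
move=> AA ADA BB BDB CC AB AC BC ee.
have r2 : DA * B = B * DA + e *: (A * C).
  apply: mulr2n_injM; rewrite -mulrnAl -AA -mulrA AB mulrDr mulrA AB mulrDl.
  rewrite -scalerAr -scalerAl -mulrA AA -AC mulrnAr -addrA mulrnDl.
  by congr (_ + _).
have r3 : A * DB = DB * A + e *: (B * C).
  apply: mulr2n_injM; rewrite -mulrnAr -BB mulrA AB mulrDl -mulrA AB mulrDr.
  rewrite -scalerAr -scalerAl mulrA BB -BC mulrnAl -addrA mulrnDl.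
  by congr (_ + _).
have CDA : C * DA = DA * C.
  apply: mulr2n_injM; rewrite -mulrnAr -mulrnAl -AA mulrA -AC -mulrA -AC mulrA.
  by [].
have nz : e != 0 by apply: contraTneq (ltr01 : (0 : int) < 1) => e0; rewrite -ee e0 mulr0 ltxx.
have scale0 (M : 'M[int]_n.+1) : e *: M = 0 -> M = 0.
  by move=> /(congr1 (GRing.scale e)); rewrite scalerA ee scale1r scaler0.
have DAC : DA * C = 0.
  apply: mulr3n_eq0M; apply: scale0.
  have : A * (DA * B) = 0 by rewrite mulrA ADA mul0r.
  rewrite r2 mulrDr mulrA AB mulrDl -[B * A * DA]mulrA ADA mulr0 add0r.
  rewrite -scalerAl CDA -scalerAr mulrA AA mulrnAl => <-.
  by rewrite -scalerDr mulrS.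
have CDB : C * DB = DB * C.
  apply: mulr2n_injM; rewrite -mulrnAr -mulrnAl -BB mulrA -BC -mulrA -BC mulrA.
  by [].
have [DBB _] := divided_square BB BDB.
have DBC : DB * C = 0.
  apply: mulr3n_eq0M; apply: scale0.
  have : A * DB * B = 0 by rewrite -mulrA DBB mulr0.
  rewrite r3 mulrDl -mulrA AB mulrDr mulrA DBB mul0r add0r.
  rewrite -scalerAr -scalerAl -[B * C * B]mulrA -BC mulrA BB mulrnAl => <-.
  by rewrite -scalerDr mulrS.
have ADC : A * DC = 0.
  apply: mulr2n_injM; rewrite mul0rn -mulrnAr -CC; apply: scale0.
  have : DA * C * B = 0 by rewrite DAC mul0r.
  rewrite -mulrA -BC mulrA r2 mulrDl -mulrA DAC mulr0 add0r -scalerAl => <-.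
  by rewrite mulrA.
have BDC : B * DC = 0.
  apply: mulr2n_injM; rewrite mul0rn -mulrnAr -CC; apply: scale0.
  have : A * DB * C = 0 by rewrite -mulrA DBC mulr0.
  rewrite r3 mulrDl -mulrA AC mulrA DBC mul0r add0r -scalerAl => <-.
  by rewrite mulrA.
have r4 : DA * DB = DB * DA + e *: (B * A * C) + DC.
  apply: mulr2n_injM; rewrite -mulrnAl -AA -mulrA r3 mulrDr mulrA r3 mulrDl.
  rewrite -mulrA AA -!scalerAr -!scalerAl mulrnAr mulrA AB mulrDl -scalerAl CC.
  rewrite scalerDr scalerA ee scale1r -[B * C * A]mulrA -AC mulrA.
  by rewrite !mulrnDl [(e *: _) *+ 2]mulr2n !addrA.
split=> //; split=> //; apply: mulr2n_injM; rewrite mul0rn -mulrnAr -CC mulrA.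
  by rewrite DAC mul0r.
by rewrite DBC mul0r.
Qed.

Lemma map_heisenberg (R : comNzRingType) A B C DA DB DC e
    (f := fun M : 'M[int]_n.+1 => map_mx intr M : 'M[R]_n.+1) :
  heisenberg_relations A B C DA DB DC e ->
  heisenberg_relations (f A) (f B) (f C) (f DA) (f DB) (f DC) e%:~R.
Proof.
have fM M N : f (M * N) = f M * f N by apply: map_mxM.
have fD M N : f (M + N) = f M + f N by apply: map_mxD.
have fZ c M : f (c *: M) = c%:~R *: f M by apply: map_mxZ.
have f0 : f 0 = 0 by apply: map_mx0.
case=> [[r1 r2 r3 r4] [AC DAC DBC] [ADC BDC DADC DBDC] ee].
split; last by rewrite -intrM ee.
- by rewrite -!fM r1 r2 r3 r4 !fD !fZ !fM.
- by rewrite -!fM AC DAC DBC f0.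
by rewrite -!fM ADC BDC DADC DBDC f0.
Qed.

End IntegralRelations.

(** * Root elements *)

Section AdjointMatrices.

Variable i : nat.
Hypothesis hi : i \in [:: 6; 7; 8]%N.
Implicit Types (b c : seq int) (a : 'I_(lie_dim i).+1).

Local Notation n := (lie_dim i).

Definition basis_elt (a : 'I_n.+1) : nat + seq int := nth (inl 0%N) (basis i) a.

Lemma size_basis : size (basis i) = n.+1.
Proof.
rewrite /lie_dim lie_basisE prednK // size_cat size_map size_iota.
by move: hi; rewrite !inE => /or3P[] /eqP->.
Qed.

Lemma basis_elt_mem a : basis_elt a \in basis i.
Proof. by apply: mem_nth; rewrite size_basis. Qed.

Lemma basis_eltP x : x \in basis i -> exists a, basis_elt a = x.
Proof.
move=> xB; have lt_x : (index x (basis i) < n.+1)%N by rewrite -size_basis index_mem.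
by exists (Ordinal lt_x); rewrite /basis_elt nth_index.
Qed.

Lemma sum_basis (R : nmodType) (f : nat + seq int -> R) :
  \sum_a f (basis_elt a) = \sum_(x <- basis i) f x.
Proof. by rewrite (big_nth (inl 0%N)) size_basis big_mkord. Qed.

Lemma adE c a a' : ad i c a a' = bracket c (basis_elt a) (basis_elt a').
Proof. by rewrite mxE lie_basisE. Qed.

Lemma ad_mul b c a a' :
  (ad i b * ad i c) a a' = nested i b c (basis_elt a) (basis_elt a').
Proof.
rewrite mxE /nested -(sum_basis (fun x => bracket b (basis_elt a) x * bracket c x (basis_elt a'))).
by apply: eq_bigr => k _; rewrite !adE.
Qed.

(** Half of the square of ad c, see nested_square. *)
Definition ad_square c : 'M[int]_n.+1 :=
  \matrix_(a, a') ((basis_elt a == inr c) && (basis_elt a' == inr (oppv c)))%:Z.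

Lemma ad_sqr c : c \in rootset i -> ad i c * ad i c = ad_square c *+ 2.
Proof.
move=> Pc; apply/matrixP=> a a'; rewrite ad_mul nested_square ?basis_elt_mem //.
by rewrite mulmxnE mxE; case: ifP.
Qed.

Lemma ad_cube c : c \in rootset i -> ad i c * ad_square c = 0.
Proof.
move=> Pc; have Nc := dot_Phi hi Pc; have sc := size_rootset Pc.
apply/matrixP=> a a'; rewrite mxE [RHS]mxE big1 // => k _; rewrite adE mxE.
case: eqP => [-> | _]; last by rewrite mulr0.
case Ea: (basis_elt a) => [j | d].
  rewrite /= -[X in X == _]/(addv c c); case: eqP => [E | _]; last by rewrite mul0r.
  by have := dot_addv hi Pc Pc; rewrite E Nc dot_explicit.
rewrite bracket_inr_inr; case: eqP => [Ed | _]; last by rewrite mul0r.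
have := basis_elt_mem a; rewrite Ea mem_basis_inr Ed vadd_Phi // Nc //.
Qed.

Lemma ad_comm b c : b \in rootset i -> c \in rootset i -> dot b c \in [:: -1; 0; 1] ->
  ad i b * ad i c = ad i c * ad i b +
    (if dot b c == -1 then cocycle b c *: ad i (addv b c) else 0).
Proof.
move=> Pb Pc range; have [sb sc] := (size_rootset Pb, size_rootset Pc).
have nbc : b != c by apply: contraTneq range => ->; rewrite (dot_Phi hi).
have nbc0 : addv b c != zerov.
  by apply: contraTneq range => /vadd_eq0->; rewrite // dotC ?size_oppv // dot_opp // (dot_Phi hi).
apply/matrixP=> a a'; have := nested_comm hi Pb Pc nbc nbc0 (basis_elt_mem a) (basis_elt_mem a').
rewrite ad_mul => /(canRL (subrK _)) ->; rewrite addrC mxE ad_mul; congr (_ + _).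
by case: ifP => _; rewrite !mxE // lie_basisE.
Qed.

Lemma ad_commute b c : b \in rootset i -> c \in rootset i -> dot b c \in [:: 0; 1] ->
  ad i b * ad i c = ad i c * ad i b.
Proof.
move=> Pb Pc range; rewrite ad_comm // ?inE; last by move: range; rewrite !inE => ->; rewrite orbT.
by move: range; rewrite !inE => /orP[] /eqP->; rewrite addr0.
Qed.

Lemma ad_heisenberg b c : b \in rootset i -> c \in rootset i -> dot b c = -1 ->
  heisenberg_relations (ad i b) (ad i c) (ad i (addv b c)) (ad_square b) (ad_square c)
    (ad_square (addv b c)) (cocycle b c).
Proof.
move=> Pb Pc Ebc; have [sb sc] := (size_rootset Pb, size_rootset Pc).
have Pbc : addv b c \in rootset i by rewrite vadd_Phi // Ebc.
apply: heisenberg_int; rewrite ?ad_sqr ?ad_cube ?cocycle_sqr //.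
- by rewrite ad_comm // Ebc // eqxx.
- by apply: ad_commute; rewrite // dotDr // (dot_Phi hi) // Ebc.
by apply: ad_commute; rewrite // dotDr // [dot c b]dotC // (dot_Phi hi) // Ebc.
Qed.

Lemma ad_heisenberg0 b c : b \in rootset i -> c \in rootset i -> dot b c \in [:: 0; 1] ->
  heisenberg_relations (ad i b) (ad i c) 0 (ad_square b) (ad_square c) 0 1.
Proof.
move=> Pb Pc range; apply: heisenberg_int; rewrite ?ad_sqr ?ad_cube ?mul0r ?mulr0 ?mul0rn //.
by rewrite scaler0 addr0 ad_commute.
Qed.

Variable F : finFieldType.

Definition root_mx c (t : F) : 'M[F]_n.+1 :=
  exp2 (map_mx intr (ad i c)) (map_mx intr (ad_square c)) t.

Lemma root_eltE (gamma : posroot i) (t : F) : vec gamma \in rootset i ->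
  root_elt gamma t = root_mx (vec gamma) t.
Proof.
move=> Pg; rewrite /root_elt !big_ord_recr big_ord0 /= add0r /root_mx /exp2.
rewrite !expr0 !expr1 [ad i _ ^+ 2]expr2 ad_sqr // scale1r; congr (_ + _ *: _ + _ *: _).
- by apply/matrixP=> a b; rewrite !mxE divz1; case: (a == b).
- by apply/matrixP=> a b; rewrite !mxE divz1.
apply/matrixP=> a b; rewrite mxE mulmxnE !mxE; congr (_%:~R).
by case: (_ && _).
Qed.

Lemma root_mxD c s t : c \in rootset i -> root_mx c (s + t) = root_mx c s * root_mx c t.
Proof.
move=> Pc; have AA := ad_sqr Pc; have AD := ad_cube Pc.
have [DA DD] := divided_square AA AD.
have fM (M N : 'M[int]_n.+1) : map_mx intr M * map_mx intr N = map_mx intr (M * N) :> 'M[F]_n.+1.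
  by symmetry; apply: map_mxM.
by apply: exp2D; rewrite fM ?AA ?AD ?DA ?DD ?map_mx0 // mulr2n map_mxD mulr2n.
Qed.

Lemma root_mx0 c : root_mx c 0 = 1.
Proof. by rewrite /root_mx /exp2 expr0n !scale0r !addr0. Qed.

Lemma root_mx_comm b c s t : b \in rootset i -> c \in rootset i -> dot b c = -1 ->
  root_mx b s * root_mx c t =
  root_mx c t * root_mx b s * root_mx (addv b c) ((cocycle b c)%:~R * s * t).
Proof.
move=> Pb Pc Ebc; apply: exp2_commutator; apply: map_heisenberg.
exact: ad_heisenberg.
Qed.

Lemma root_mx_commute b c s t : b \in rootset i -> c \in rootset i ->
  dot b c \in [:: 0; 1] -> root_mx b s * root_mx c t = root_mx c t * root_mx b s.
Proof.
move=> Pb Pc range.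
have := exp2_commutator s t (map_heisenberg F (ad_heisenberg0 Pb Pc range)).
have -> u : exp2 (map_mx intr (0 : 'M[int]_n.+1)) (map_mx intr (0 : 'M[int]_n.+1)) u = 1 :> 'M[F]_n.+1.
  by rewrite /exp2 map_mx0 !scaler0 !addr0.
by rewrite mulr1.
Qed.

Lemma root_mx_entry b s a a' : root_mx b s a a' =
  (a == a')%:R + s * (bracket b (basis_elt a) (basis_elt a'))%:~R
  + s ^+ 2 * ((basis_elt a == inr b) && (basis_elt a' == inr (oppv b)))%:R.
Proof.
by rewrite /root_mx /exp2 !mxE lie_basisE; case: (_ && _); case: (a == a').
Qed.

End AdjointMatrices.

(** * The table of positive roots *)

Definition table : seq (seq int) := Eval vm_compute in Phi8_pos.

(** The marks of the roots of E6, E7 and E8 among the positive roots of E8. *)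
Definition levels : seq (seq bool) :=
  Eval vm_compute in [seq (let s := Phi k in [seq v \in s | v <- table]) | k <- [:: 6; 7; 8]%N].

Lemma Phi8_posE : Phi8_pos = table.
Proof. by vm_cast_no_check (erefl table). Qed.

Lemma levelsE :
  [seq (let s := Phi k in [seq v \in s | v <- table]) | k <- [:: 6; 7; 8]%N] = levels.
Proof. by vm_cast_no_check (erefl levels). Qed.

(** The coordinates of a positive root are the digits in base 16 of its code, so
    that the addition of roots is an addition of binary numbers. *)
Definition code (v : seq int) : BinNums.N :=
  foldr (fun (c : int) (m : BinNums.N) => BinNat.N.add (bin_of_nat `|c|) (BinNat.N.mul (bin_of_nat 16) m)) BinNums.N0 v.

Definition codes : seq BinNums.N := Eval vm_compute in [seq code v | v <- table].

(** Roots are numbered from 0 here. The row of number a contains the pairs (b, c)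
    such that the root c is the sum of the roots a and b. *)
Definition rows : seq (seq (nat * nat)) := Eval vm_compute in
  [seq [seq p <- [seq (b, index (BinNat.N.add ca (nth BinNums.N0 codes b)) codes) | b <- iota 0 120]
       | (p.2 < 120)%N] | ca <- codes].

Definition sums_from (a : nat) : seq (nat * nat) := nth [::] rows a.

(** The same triples, sorted by the sum. *)
Definition splits : seq (seq (nat * nat)) := Eval vm_compute in
  [seq flatten [seq [seq (a, p.1) | p <- sums_from a & p.2 == c] | a <- iota 0 120] | c <- iota 0 120].

Definition sums_to (c : nat) : seq (nat * nat) := nth [::] splits c.

Lemma codesE : codes = [seq code v | v <- table] /\ uniq codes.
Proof. by split; [vm_cast_no_check (erefl codes) | vm_cast_no_check (erefl true)]. Qed.

Lemma rowsE : rows =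
  [seq [seq p <- [seq (b, index (BinNat.N.add ca (nth BinNums.N0 codes b)) codes) | b <- iota 0 120]
       | (p.2 < 120)%N] | ca <- codes].
Proof. by vm_cast_no_check (erefl rows). Qed.

Lemma splitsE : splits =
  [seq flatten [seq [seq (a, p.1) | p <- sums_from a & p.2 == c] | a <- iota 0 120] | c <- iota 0 120].
Proof. by vm_cast_no_check (erefl splits). Qed.

Lemma rows_sound :
  all (fun a => all (fun p =>
    [&& nth [::] table p.2 == addv (nth [::] table a) (nth [::] table p.1), (a < p.2)%N & (p.1 < 120)%N])
    (sums_from a)) (iota 0 120).
Proof. by vm_cast_no_check (erefl true). Qed.

Lemma table_ge0 : all (all (fun c => 0 <= c)) table.
Proof. by vm_cast_no_check (erefl true). Qed.

Lemma uniq_table : uniq table.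
Proof. by have [E U] := codesE; apply: (@map_uniq _ _ code); rewrite -E. Qed.

Lemma size_table : size table = 120%N.
Proof. by []. Qed.

Definition level (k n : nat) : bool := nth false (nth [::] levels (k - 6)) n.

Lemma Phi8_pos_def :
  Phi8_pos = sort root_order [seq v <- rootset 8 | all (fun c => 0 <= c) v].
Proof. rewrite -rootsetE; reflexivity. Qed.

Lemma Phi_pos_def k : Phi_pos k = [seq v <- Phi8_pos | v \in rootset k].
Proof. rewrite -rootsetE; reflexivity. Qed.

Opaque Phi Phi8_pos Phi_pos.

Lemma levelE k : k \in [:: 6; 7; 8]%N ->
  nth [::] levels (k - 6) = [seq v \in rootset k | v <- table].
Proof.
move=> hk; rewrite -levelsE -rootsetE.
by move: hk; rewrite !inE => /or3P[] /eqP->.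
Qed.

Lemma mem_table v : (v \in table) = all (fun c => 0 <= c) v && (v \in rootset 8).
Proof. by rewrite -Phi8_posE Phi8_pos_def mem_sort mem_filter. Qed.

Lemma table_rootset8 v : v \in table -> v \in rootset 8.
Proof. by rewrite mem_table => /andP[]. Qed.

Lemma coord_ge0 v j : v \in table -> 0 <= coord v j.
Proof.
move=> /(allP table_ge0) /allP ge0; rewrite /coord.
have [lt_j | le_j] := ltnP j.-1 (size v); last by rewrite nth_default.
exact/ge0/mem_nth.
Qed.

Lemma table_sum_neq0 u v : u \in table -> v \in table -> addv u v != zerov.
Proof.
move=> Tu Tv; have h8 : 8%N \in [:: 6; 7; 8]%N by [].
apply/eqP=> E; have Pu := table_rootset8 Tu; have su := size_rootset Pu.
suff z : u = zerov by have := zerov_Phi h8; rewrite -z Pu.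
apply: (@eq_from_nth _ 0); rewrite su // => j lt_j.
have := congr1 (fun w => coord w j.+1) E; rewrite coord_addv ?mem_iota //= => E0.
have := coord_ge0 j.+1 Tu; have := coord_ge0 j.+1 Tv; move: E0.
have -> : coord zerov j.+1 = 0 by rewrite /coord nth_nseq if_same.
have -> : nth 0 zerov j = 0 by rewrite nth_nseq if_same.
rewrite /coord /=; move: (nth 0 u j) (nth 0 v j); clear; lia.
Qed.

Lemma bin_of_natD m n : bin_of_nat (m + n) = BinNat.N.add (bin_of_nat m) (bin_of_nat n).
Proof.
have addE x y : nat_of_bin (BinNat.N.add x y) = (nat_of_bin x + nat_of_bin y)%N.
  by case: x y => [|p] [|p'] //=; rewrite ?addn0 // nat_of_add_pos.
by apply: (can_inj nat_of_binK); rewrite addE !bin_of_natK.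
Qed.

Lemma code_cons_addv (x y : int) m n : 0 <= x -> 0 <= y ->
  BinNat.N.add (bin_of_nat `|x + y|) (BinNat.N.mul (bin_of_nat 16) (BinNat.N.add m n)) =
  BinNat.N.add (BinNat.N.add (bin_of_nat `|x|) (BinNat.N.mul (bin_of_nat 16) m))
               (BinNat.N.add (bin_of_nat `|y|) (BinNat.N.mul (bin_of_nat 16) n)).
Proof.
case: x y => [x | //] [y | //] _ _; rewrite -PoszD !absz_nat bin_of_natD.
by rewrite BinNat.N.mul_add_distr_l BinNat.N.add_shuffle1.
Qed.

Lemma code_addv u v : u \in table -> v \in table ->
  code (addv u v) = BinNat.N.add (code u) (code v).
Proof.
move=> Tu Tv; have [gu gv] := (allP table_ge0 _ Tu, allP table_ge0 _ Tv).
move: gu gv (size_rootset (table_rootset8 Tu)) (size_rootset (table_rootset8 Tv)).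
move=> gu gv /size8P[a1 [a2 [a3 [a4 [a5 [a6 [a7 [a8 Eu]]]]]]]].
case/size8P=> [b1 [b2 [b3 [b4 [b5 [b6 [b7 [b8 Ev]]]]]]]].
rewrite Eu Ev in gu gv *; do 8![case/andP: gu => ? gu]; do 8![case/andP: gv => ? gv].
rewrite -[addv _ _]/[:: a1 + b1; a2 + b2; a3 + b3; a4 + b4; a5 + b5; a6 + b6; a7 + b7; a8 + b8].
have code_cons (c : int) w :
    code (c :: w) = BinNat.N.add (bin_of_nat `|c|) (BinNat.N.mul (bin_of_nat 16) (code w)).
  by [].
by rewrite !code_cons -!code_cons_addv.
Qed.

Opaque table codes rows splits levels.

Section Posroots.

Variable i : nat.
Hypothesis hi : i \in [:: 6; 7; 8]%N.
Implicit Types alpha beta gamma delta : posroot i.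

Definition idx gamma : nat := index (vec gamma) table.

Lemma vec_table gamma : vec gamma \in table.
Proof.
have : vec gamma \in Phi_pos i := ssvalP gamma.
by rewrite Phi_pos_def Phi8_posE mem_filter => /andP[].
Qed.

Lemma vec_rootset gamma : vec gamma \in rootset i.
Proof.
have : vec gamma \in Phi_pos i := ssvalP gamma.
by rewrite Phi_pos_def Phi8_posE mem_filter => /andP[].
Qed.

Lemma vec_inj : injective (@vec i).
Proof. exact: val_inj. Qed.

Lemma posroot_of v : v \in table -> v \in rootset i -> exists gamma, vec gamma = v.
Proof.
move=> Tv Pv; have sv : v \in Phi_pos i by rewrite Phi_pos_def Phi8_posE mem_filter Pv.
by exists (SeqSub sv).
Qed.

Lemma labelE gamma : label gamma = (idx gamma).+1.
Proof. by rewrite /label Phi8_posE. Qed.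

Lemma idx_lt gamma : (idx gamma < 120)%N.
Proof. by rewrite -size_table index_mem vec_table. Qed.

Lemma nth_idx gamma : nth [::] table (idx gamma) = vec gamma.
Proof. by rewrite nth_index ?vec_table. Qed.

Lemma idx_inj : injective idx.
Proof. by move=> b c E; apply: vec_inj; rewrite -!nth_idx E. Qed.

Lemma label_inj : injective (@label i).
Proof. by move=> b c; rewrite !labelE => -[/idx_inj]. Qed.

Lemma level_idx gamma : level i (idx gamma).
Proof.
by rewrite /level levelE // (nth_map [::]) ?size_table ?idx_lt // nth_idx vec_rootset.
Qed.

Lemma idx_of n : (n < 120)%N -> level i n -> exists gamma, idx gamma = n.
Proof.
move=> lt_n; rewrite /level levelE // (nth_map [::]) ?size_table // => Pn.
have Tn : nth [::] table n \in table by rewrite mem_nth ?size_table.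
have [g Eg] := posroot_of Tn Pn; exists g.
by rewrite /idx Eg index_uniq ?size_table ?uniq_table.
Qed.

Lemma is_sumP beta gamma delta :
  is_sum beta gamma delta <-> vec delta = addv (vec beta) (vec gamma).
Proof. by split=> /eqP. Qed.

Lemma is_sumE beta gamma delta :
  is_sum beta gamma delta = ((idx gamma, idx delta) \in sums_from (idx beta)).
Proof.
apply/idP/idP => [/is_sumP E | s].
  rewrite /sums_from rowsE (nth_map BinNums.N0) ?idx_lt //.
  rewrite mem_filter; apply/andP; split; first exact: idx_lt.
  apply/mapP; exists (idx gamma); first by rewrite mem_iota idx_lt.
  congr (_, _); have [Ec Uc] := codesE.
  have cE g : nth BinNums.N0 codes (idx g) = code (vec g).
    by rewrite Ec (nth_map [::]) ?size_table ?idx_lt // nth_idx.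
  rewrite !cE -code_addv ?vec_table // -E -cE index_uniq // Ec size_map size_table idx_lt //.
have /allP/(_ (idx beta)) := rows_sound; rewrite mem_iota idx_lt => /(_ isT)/allP/(_ _ s).
by rewrite !nth_idx => /and3P[/eqP E _ _]; apply/is_sumP.
Qed.

(** The number of a root as a locked function, hidden from conversion tests. *)
Definition root_rank : posroot i -> nat := locked idx.

Lemma root_rankE gamma : root_rank gamma = idx gamma.
Proof. by rewrite /root_rank -lock. Qed.

Lemma root_rank_inj : injective root_rank.
Proof. by move=> b c; rewrite !root_rankE; apply: idx_inj. Qed.

Lemma sum_rank beta gamma delta : is_sum beta gamma delta -> (root_rank beta < root_rank delta)%N.
Proof.
rewrite is_sumE => s; have /allP/(_ (idx beta)) := rows_sound.
by rewrite mem_iota idx_lt => /(_ isT)/allP/(_ _ s) /and3P[_ lt _]; rewrite !root_rankE.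
Qed.

End Posroots.

(** * Root subgroups *)

Section RootSubgroups.

Variables (i : nat) (F : finFieldType).
Hypothesis hi : i \in [:: 6; 7; 8]%N.
Implicit Types (beta gamma delta : posroot i) (s t : F).

Local Notation n := (lie_dim i).
Local Notation gT := {'GL_n.+1[F]}.

Lemma posroot_sumP beta gamma : dot (vec beta) (vec gamma) = -1 ->
  exists delta, is_sum beta gamma delta.
Proof.
have h8 : 8%N \in [:: 6; 7; 8]%N by [].
move=> Ebg; have [Tb Tg] := (vec_table beta, vec_table gamma).
have [Pb Pg] := (vec_rootset beta, vec_rootset gamma).
have P8 : addv (vec beta) (vec gamma) \in rootset 8.
  by rewrite (vadd_Phi h8) ?table_rootset8 // Ebg.
have Pi : addv (vec beta) (vec gamma) \in rootset i by rewrite (vadd_Phi hi) // Ebg.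
have Ts : addv (vec beta) (vec gamma) \in table.
  rewrite mem_table P8 andbT; apply/(all_nthP 0) => j.
  rewrite size_addv => lt_j; have j8 : j.+1 \in nodes 8 by rewrite mem_iota.
  have := coord_addv (vec beta) (vec gamma) j8; rewrite /coord /= => ->.
  exact: addr_ge0 (coord_ge0 j.+1 Tb) (coord_ge0 j.+1 Tg).
have [d Ed] := posroot_of Ts Pi; exists d; exact/is_sumP.
Qed.

Lemma is_sum_dot beta gamma delta : is_sum beta gamma delta ->
  dot (vec beta) (vec gamma) = -1.
Proof.
move/is_sumP=> E; apply/eqP; rewrite -(vadd_Phi hi) ?vec_rootset // -E.
exact: vec_rootset.
Qed.

Lemma posroot_dot beta gamma : beta != gamma -> (forall delta, ~~ is_sum beta gamma delta) ->
  dot (vec beta) (vec gamma) \in [:: 0; 1].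
Proof.
move=> nbg no; have nvbg : vec beta != vec gamma by rewrite (inj_eq (@vec_inj i)).
have n0 := table_sum_neq0 (vec_table beta) (vec_table gamma).
case: (dot_range hi (vec_rootset beta) (vec_rootset gamma) nvbg n0) => E; rewrite E ?inE //.
by have [d] := posroot_sumP E; rewrite (negPf (no d)).
Qed.

Lemma root_mx_unit gamma t : root_mx i (vec gamma) t \is a GRing.unit.
Proof.
apply/unitrP; exists (root_mx i (vec gamma) (- t)).
by rewrite -!(root_mxD hi) ?vec_rootset // addNr subrr root_mx0.
Qed.

Definition root_unit gamma t : gT := FinRing.unit _ (root_mx_unit gamma t).

Lemma GLval_root_unit gamma t : GLval (root_unit gamma t) = root_mx i (vec gamma) t.
Proof. by []. Qed.

Lemma GLval_inj (g h : gT) : GLval g = GLval h -> g = h.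
Proof. exact: val_inj. Qed.

Lemma root_subgroupE gamma : root_subgroup F gamma = [set root_unit gamma t | t : F].
Proof.
apply/setP=> g; rewrite inE; apply/existsP/imsetP => [[t /eqP E] | [t _ ->]]; exists t => //.
  by apply: GLval_inj; apply: etrans E _; apply: (root_eltE hi); apply: vec_rootset.
by apply/eqP; symmetry; apply: (root_eltE hi); apply: vec_rootset.
Qed.

Lemma root_unitD gamma s t : root_unit gamma (s + t) = (root_unit gamma s * root_unit gamma t)%g.
Proof. by apply: GLval_inj; rewrite GL_ME !GLval_root_unit (root_mxD hi) ?vec_rootset. Qed.

Lemma root_unit0 gamma : root_unit gamma 0 = 1%g.
Proof. by apply: GLval_inj; rewrite GLval_root_unit root_mx0. Qed.

Lemma root_unit_comm beta gamma delta : is_sum beta gamma delta -> exists2 e : F, e != 0 &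
  forall s t, [~ root_unit beta s, root_unit gamma t]%g = root_unit delta (e * s * t).
Proof.
move=> bgd; have Ebg := is_sum_dot bgd; have /is_sumP Ed := bgd.
have sq := cocycle_sqr (vec beta) (vec gamma).
exists (cocycle (vec beta) (vec gamma))%:~R.
  by apply: contra_eq_neq (congr1 (fun z : int => z%:~R : F) sq) => E; rewrite intrM E mul0r eq_sym oner_eq0.
move=> s t; apply: (mulgI (root_unit gamma t * root_unit beta s)%g).
rewrite -commgC; apply: GLval_inj; rewrite !GL_ME !GLval_root_unit Ed.
by apply: (root_mx_comm hi) => //; apply: vec_rootset.
Qed.

Lemma root_unit_commute beta gamma : (forall delta, ~~ is_sum beta gamma delta) ->
  forall s t, commute (root_unit beta s) (root_unit gamma t).
Proof.
move=> no s t; have [<- | nbg] := eqVneq beta gamma.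
  by rewrite /commute -!root_unitD addrC.
apply: GLval_inj; rewrite !GL_ME !GLval_root_unit.
apply: (root_mx_commute hi); [exact: vec_rootset | exact: vec_rootset | exact: posroot_dot].
Qed.

Lemma root_subgroup_group_set gamma : group_set (root_subgroup F gamma).
Proof.
rewrite root_subgroupE; apply/group_setP; split.
  by apply/imsetP; exists 0; rewrite ?root_unit0.
move=> _ _ /imsetP[s _ ->] /imsetP[t _ ->]; rewrite -root_unitD.
exact: imset_f.
Qed.

Definition root_group gamma : {group gT} := Group (root_subgroup_group_set gamma).

Lemma mem_root_group gamma g :
  reflect (exists t, g = root_unit gamma t) (g \in root_group gamma).
Proof.
rewrite -[g \in _]/(g \in root_subgroup F gamma) root_subgroupE.
by apply: (iffP imsetP) => [[t _ ->] | [t ->]]; exists t.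
Qed.

Lemma abelian_root_group gamma : abelian (root_group gamma).
Proof.
apply/centsP=> _ /mem_root_group[s ->] _ /mem_root_group[t ->].
by rewrite /commute -!root_unitD addrC.
Qed.

Lemma root_group_sum beta gamma delta : is_sum beta gamma delta ->
  {in root_group beta & root_group gamma, forall b c, [~ b, c]%g \in root_group delta}.
Proof.
case/root_unit_comm=> e _ E _ _ /mem_root_group[s ->] /mem_root_group[t ->].
by rewrite E; apply/mem_root_group; exists (e * s * t).
Qed.

Lemma root_group_pair beta gamma delta : is_sum beta gamma delta ->
  {in root_group beta & root_group delta, forall b d, b != 1%g ->
     exists2 c, c \in root_group gamma & [~ b, c]%g = d}.
Proof.
case/root_unit_comm=> e nze E _ _ /mem_root_group[s ->] /mem_root_group[t ->] ntb.
have nzs : s != 0 by apply: contraNneq ntb => ->; rewrite root_unit0.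
exists (root_unit gamma (t / (e * s))); first by apply/mem_root_group; eexists.
by rewrite E mulrC divfK ?mulf_neq0.
Qed.

Lemma root_group_comm beta gamma : (forall delta, ~~ is_sum beta gamma delta) ->
  {in root_group beta & root_group gamma, forall b c, [~ b, c]%g = 1%g}.
Proof.
move=> no _ _ /mem_root_group[s ->] /mem_root_group[t ->].
by apply/eqP/commgP/root_unit_commute.
Qed.

(** * The order of the pattern groups *)

(** The products with the simple roots cannot all be nonpositive; if one of them is
    2 the root is simple, and then its product with a neighbour is -1. *)
Lemma simple_pairing gamma : exists2 j, j \in nodes i &
  dot (vec gamma) (simple j) \in [:: 1; -1].
Proof.
have Pg := vec_rootset gamma; have Tg := vec_table gamma.
have [/hasP[j ji pos] | /hasPn npos] := boolP (has (fun j => 0 < dot (vec gamma) (simple j)) (nodes i)).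
  have [le2 eq2] := dot_eq2 hi Pg (simple_rootset ji).
  have [E1 | E2] : dot (vec gamma) (simple j) = 1 \/ dot (vec gamma) (simple j) = 2.
    by move: pos le2; move: (dot _ _); clear; lia.
    by exists j; rewrite // E1.
  (* The witness is a neighbour of the node j. *)
  have Eg := eq2 E2; exists (if j == 1%N then 3 else if j == 2%N then 4 else if j == 3%N then 1 else j.-1)%N.
    by move: ji hi; rewrite !mem_iota !inE; case: j {pos le2 eq2 E2 Eg} => [|[|[|[|j]]]] //=; clear; lia.
  rewrite {}Eg {pos le2 eq2 E2}; have := nodes_sub hi ji; rewrite mem_iota.
  by case: j ji => [|[|[|[|[|[|[|[|[]]]]]]]]] // _ _; rewrite /simple /= dot_explicit.
have := dot_Phi hi Pg; rewrite -(dot_nodes hi Pg Pg) => E.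
have: \sum_(j <- nodes i) dot (vec gamma) (simple j) * coord (vec gamma) j <= 0.
  rewrite big_seq; apply: sumr_le0 => j ji; apply: mulr_le0_ge0; last exact: coord_ge0.
  by rewrite leNgt npos.
by rewrite E.
Qed.

Definition above gamma (x : nat + seq int) : Prop :=
  exists2 delta : posroot i, x = inr (vec delta) & (root_rank gamma < root_rank delta)%N.

(** The span of one simple coroot and the later root vectors is stable under
    the elements of the later root subgroups: a root vector is only moved to
    later ones, and the coroot is only moved by root vectors. *)
Lemma root_mx_above beta gamma s j a a' : (root_rank gamma < root_rank beta)%N ->
    basis_elt a' = inl j \/ above gamma (basis_elt a') ->
    ~ (basis_elt a = inl j \/ above gamma (basis_elt a)) ->
  root_mx i (vec beta) s a a' = 0.
Proof.
move=> lt_gb good ngood; rewrite root_mx_entry.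
have -> : (a == a') = false by apply: contra_notF ngood => /eqP->.
have sb := size_rootset (vec_rootset beta).
have nopp : (basis_elt a' == inr (oppv (vec beta))) = false.
  case: good => [-> // | [d Ed _]]; rewrite Ed; apply/eqP=> -[Eo].
  by have := table_sum_neq0 (vec_table beta) (vec_table d); rewrite Eo vaddN eqxx.
rewrite nopp andbF mulr0 addr0 add0r; suff -> : bracket (vec beta) (basis_elt a) (basis_elt a') = 0.
  by rewrite mulr0.
case: good => [Ea' | [d Ea' lt_gd]]; rewrite Ea' in nopp *.
  case Ea: (basis_elt a) => [k | e]; first exact: erefl.
  rewrite bracket_inr_inl; case: eqP => [Ee | _]; last exact: erefl.
  by case: ngood; right; exists beta; rewrite // Ea Ee.
case Ea: (basis_elt a) => [k | e].
  by rewrite /= (negPf (table_sum_neq0 (vec_table beta) (vec_table d))).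
rewrite bracket_inr_inr; case: eqP => [Ee | _]; last exact: erefl.
case: ngood; right.
have Pe : e \in rootset i by have := basis_elt_mem hi a; rewrite Ea mem_basis_inr.
rewrite Ee (vadd_Phi hi) ?vec_rootset // in Pe; have [d' sum] := posroot_sumP (eqP Pe).
exists d'; first by rewrite Ea Ee; have /is_sumP-> := sum.
by apply: ltn_trans lt_gb _; apply: sum_rank sum.
Qed.

Definition stable_mx gamma j (M : 'M[F]_n.+1) : Prop :=
  forall a a', basis_elt a' = inl j \/ above gamma (basis_elt a') ->
    ~ (basis_elt a = inl j \/ above gamma (basis_elt a)) -> M a a' = 0.

Definition stabilizer_mx gamma j : {set gT} := [set g | `[< stable_mx gamma j (GLval g) >]].

Lemma stabilizer_mx_group_set gamma j : group_set (stabilizer_mx gamma j).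
Proof.
apply/group_setP; split=> [|g h]; rewrite !inE.
  apply/asboolP=> a a' good ngood; rewrite GL_1E mxE.
  by case: eqP => // E; rewrite E in ngood.
move=> /asboolP Sg /asboolP Sh; apply/asboolP=> a a' good ngood.
rewrite GL_MxE mxE big1 // => k _.
have [goodk | ngoodk] := pselect (basis_elt k = inl j \/ above gamma (basis_elt k)).
  by rewrite Sg ?mul0r.
by rewrite Sh ?mulr0.
Qed.

(** A root element that stabilises the span of a coroot and the later root
    vectors has parameter 0, since it moves the coroot by a multiple of its own
    root vector; the coroot is chosen so that the multiple is a unit. *)
Lemma root_group_free gamma :
  root_group gamma :&: pattern root_group [set delta : posroot i | (root_rank gamma < root_rank delta)%N] = 1%g.
Proof.
have [j ji pairing] := simple_pairing gamma.
apply/trivgP/subsetP=> _ /setIP[/mem_root_group[t ->] Pt].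
suff -> : t = 0 by rewrite root_unit0 group1.
have /subsetP/(_ _ Pt) : pattern root_group [set delta : posroot i | (root_rank gamma < root_rank delta)%N] \subset
    Group (stabilizer_mx_group_set gamma j).
  apply/pattern_subP=> d; rewrite inE => lt_gd; apply/subsetP=> _ /mem_root_group[s ->].
  rewrite inE; apply/asboolP=> a a'; exact: root_mx_above.
rewrite inE => /asboolP stab.
have [a Ea] : exists a : 'I_n.+1, basis_elt a = inr (vec gamma).
  by apply: (basis_eltP hi); rewrite mem_basis_inr vec_rootset.
have [a' Ea'] : exists a' : 'I_n.+1, basis_elt a' = inl j.
  by apply: (basis_eltP hi); rewrite mem_basis_inl.
have : root_mx i (vec gamma) t a a' = 0.
  apply: stab; rewrite ?Ea ?Ea'; first by left.
  by case=> [// | [d [Ed]]]; rewrite (vec_inj Ed) ltnn.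
rewrite root_mx_entry Ea Ea' bracket_inr_inl eqxx andbF.
have -> : (a == a') = false by apply/eqP=> E; rewrite E Ea' in Ea.
rewrite mulr0 addr0 add0r.
move/eqP; rewrite mulf_eq0 => /orP[/eqP // | ].
by move: pairing; rewrite !inE => /orP[] /eqP->; rewrite ?opprK ?rmorphN1 ?oppr_eq0 oner_eq0.
Qed.

Lemma card_root_group gamma : #|root_group gamma| = #|F|.
Proof.
have [j ji pairing] := simple_pairing gamma.
rewrite -[LHS]/(#|root_subgroup F gamma|) root_subgroupE card_imset // => s t E.
have [a Ea] : exists a : 'I_n.+1, basis_elt a = inr (vec gamma).
  by apply: (basis_eltP hi); rewrite mem_basis_inr vec_rootset.
have [a' Ea'] : exists a' : 'I_n.+1, basis_elt a' = inl j.
  by apply: (basis_eltP hi); rewrite mem_basis_inl.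
have := congr1 (fun g : gT => GLval g a a') E.
rewrite !GLval_root_unit !root_mx_entry Ea Ea' bracket_inr_inl eqxx andbF !mulr0 !addr0.
move/addrI; apply: mulIf.
by move: pairing; rewrite !inE => /orP[] /eqP->; rewrite ?opprK ?rmorphN1 ?oppr_eq0 oner_eq0.
Qed.

End RootSubgroups.

(** * The search for a sequence of reductions *)

Definition mask_of (p : pred nat) : seq bool := mkseq p 120.

Definition below (b a : nat) : bool :=
  all (fun j => coord (nth [::] table b) j <= coord (nth [::] table a) j) (nodes 8).

Definition arm_list (a : nat) : seq nat := [seq j.-1 | j <- nth [::] arm_table a].

(** The leg opposite to the arm g; 120 is the number of no root. *)
Definition partner (a g : nat) : nat :=
  head 120%N [seq p.1 | p <- sums_from g & p.2 == a].

Definition split_in (S : seq bool) (c : nat) : bool :=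
  has (fun p => if nth false S p.1 then nth false S p.2 else false) (sums_to c).

Definition sums_into (H K : seq bool) (n : nat) : bool :=
  all (fun p => if nth false H p.1 then nth false K p.2 else true) (sums_from n).

(** The tests of the arm and leg reduction: S without g is still closed, and the
    commutators with the leg of g lie in K or in X_alpha. *)
Definition removable (a : nat) (S K : seq bool) (g : nat) : bool :=
  let d := partner a g in
  if split_in S g then false
  else nth false S d && sums_into S (set_nth false K a true) d.

(** K with all commutators of the roots Z that commute with the remaining arms and
    legs H modulo K. *)
Definition enlarge (a : nat) (S K : seq bool) (todo : seq nat) : seq bool :=
  let H := mask_of (fun n => n \in todo ++ [seq partner a g | g <- todo]) in
  let Z := mask_of (fun n => if nth false S n then sums_into H K n else false) in
  mask_of (fun n => if nth false K n then true
                    else has (fun p => if nth false Z p.1 then nth false S p.2 else false) (sums_to n)).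

Definition ideal_mask (K S : seq bool) : bool :=
  all (fun n => if nth false K n then nth false S n && sums_into S K n else true) (iota 0 120).

(** Removes arms as long as possible, in the order of the table. When no arm can be
    removed, the kernel is enlarged, which is allowed for characters of least
    degree. The result is the kernel on the source once all arms are gone. *)
Fixpoint reduce (a : nat) (b : bool) (fuel : nat) (S K : seq bool) (todo : seq nat) :=
  if todo is [::] then Some K
  else if fuel is fuel'.+1 then
    let k := find (removable a S K) todo in
    if (k < size todo)%N then
      let g := nth 120%N todo k in
      reduce a b fuel' (set_nth false S g false) (set_nth false K (partner a g) true)
             [seq x <- todo | x != g]
    else if b then
      let K' := enlarge a S K todo in
      if ideal_mask K' S && ~~ nth false K' a then reduce a b fuel' S K' todo else None
    else None
  else None.

Lemma reduceS a b fuel S K g0 todo0 (todo := g0 :: todo0) (k := find (removable a S K) todo) :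
  reduce a b fuel.+1 S K todo =
  if (k < size todo)%N then
    reduce a b fuel (set_nth false S (nth 120%N todo k) false)
      (set_nth false K (partner a (nth 120%N todo k)) true)
      [seq x <- todo | x != nth 120%N todo k]
  else if b then
    if ideal_mask (enlarge a S K todo) S && ~~ nth false (enlarge a S K todo) a
    then reduce a b fuel S (enlarge a S K todo) todo else None
  else None.
Proof. by []. Qed.

Definition level_mask (k : nat) : seq bool := nth [::] levels (k - 6).

Definition outside (k a : nat) : seq bool :=
  mask_of (fun n => level k n && ~~ below n a).

Definition arm_ok (k a : nat) : bool :=
  let arms := arm_list a in
  let legs := [seq partner a g | g <- arms] in
  let H := mask_of (fun n => n \in arms ++ legs) in
  let A := set_nth false (mask_of (fun=> false)) a true in
  [&& uniq arms, all (fun g => [&& (g < 120)%N, level k g & g != a]) arms,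
      all (fun g => let d := partner a g in
             [&& (d < 120)%N, level k d, d \notin arms & (g, a) \in sums_from d]) arms
    & all (sums_into H A) (arms ++ legs)].

Definition source_mask (k a : nat) : seq bool :=
  mask_of (fun n => level k n && (n \notin arm_list a)).

Definition path_ok (k a : nat) : bool :=
  let B := mask_of (fun n => level k n && below n a) in
  all (fun n => if (n != a) && nth false B n then
         has (fun p => if nth false B p.2 then level k p.1 else false) (sums_from n)
       else true) (iota 0 120).

(** The search succeeds, with the expected kernel: exactly the legs and the roots
    not below alpha for all characters, and these up to commutators of the source
    for the characters of least degree. There are at most 28 arms, and 60 steps leave
    room for the enlargements. *)
Definition kernel_ok (k a : nat) (b : bool) : bool :=
  let legs := [seq partner a g | g <- arm_list a] in
  let O := outside k a in
  let S := source_mask k a in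
  if reduce a b 60 (level_mask k) O (arm_list a) is Some K then
    all (fun n => level k n ==>
      (nth false O n || (n \in legs) ==> nth false K n) &&
      (nth false K n ==> [|| nth false O n, n \in legs | b && split_in S n])) (iota 0 120)
  else false.

Definition count_ok (k a : nat) : bool :=
  let legs := [seq partner a g | g <- arm_list a] in
  let S := source_mask k a in
  let O := outside k a in
  (size (arm_list a) == (nth (0, 0) cd_table a).2) &&
  (count (fun n => nth false S n &&
      ~~ [|| n == a, nth false O n, n \in legs | split_in S n]) (iota 0 120)
    == (nth (0, 0) cd_table a).1)%N.

Definition root_ok (k a : nat) : bool :=
  [&& arm_ok k a, path_ok k a, ~~ split_in (source_mask k a) a,
      kernel_ok k a true, if a.+1 \in nonnormal_labels then true else kernel_ok k a false
    & count_ok k a].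


Definition level_roots (k : nat) : seq nat := [seq n <- iota 0 120 | level k n].

(** The finite computation behind the theorem. *)
Lemma roots_ok : all (fun k => all (root_ok k) (level_roots k)) [:: 6; 7; 8]%N.
Proof. by vm_cast_no_check (erefl true). Qed.

Lemma arm_table_gt0 : all (all (ltn 0)) arm_table.
Proof. by vm_cast_no_check (erefl true). Qed.

Opaque arm_table cd_table nonnormal_labels.

Lemma nth_mask_of p n : nth false (mask_of p) n = (n < 120)%N && p n.
Proof.
have [lt_n | le_n] := ltnP n 120; first by rewrite nth_mkseq.
by rewrite nth_default ?size_mkseq.
Qed.

Lemma mem_sums_to x y c : (x < 120)%N -> (c < 120)%N ->
  ((x, y) \in sums_to c) = ((y, c) \in sums_from x).
Proof.
move=> lt_x lt_c; rewrite /sums_to splitsE (nth_map 0%N) ?size_iota // nth_iota // add0n.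
apply/flatten_mapP/idP => [[x' _ /mapP[[y' c']]] | s].
  by rewrite mem_filter /= => /andP[/eqP-> s] [-> ->].
exists x; first by rewrite mem_iota.
by apply/mapP; exists (y, c); rewrite // mem_filter /= eqxx.
Qed.

(** * Soundness of the search *)

Section Search.

Variables (i : nat) (F : finFieldType).
Hypothesis hi : i \in [:: 6; 7; 8]%N.
Implicit Types alpha beta gamma delta eta eps : posroot i.

Lemma is_sumC beta gamma delta : is_sum beta gamma delta = is_sum gamma beta delta.
Proof. by rewrite /is_sum vaddC. Qed.

Lemma is_sum_cancel beta gamma gamma' delta :
  is_sum beta gamma delta -> is_sum beta gamma' delta -> gamma = gamma'.
Proof.
move=> /is_sumP E /is_sumP E'; apply: vec_inj; apply: (@vaddI (vec beta)).
- exact: (size_rootset (vec_rootset gamma)).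
- exact: (size_rootset (vec_rootset gamma')).
- exact: etrans (esym E) E'.
Qed.

Lemma card_field_gt1 : (1 < #|F|)%N.
Proof. exact: finNzRing_gt1. Qed.

Lemma level_lt n : level i n -> (n < 120)%N.
Proof.
rewrite /level levelE // ltnNge; apply: contraL => le_n.
by rewrite nth_default // size_map size_table.
Qed.

Definition marked (m : seq bool) : {set posroot i} := [set gamma | nth false m (idx gamma)].

Lemma mem_marked m gamma : (gamma \in marked m) = nth false m (idx gamma).
Proof. by rewrite in_set. Qed.

Lemma mem_marked_mask p gamma : (gamma \in marked (mask_of p)) = p (idx gamma).
Proof. by rewrite mem_marked nth_mask_of idx_lt. Qed.

Lemma marked_remove m gamma : marked (set_nth false m (idx gamma) false) = marked m :\ gamma.
Proof.
apply/setP=> d; rewrite in_setD1 !mem_marked nth_set_nth /= (inj_eq (@idx_inj i)).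
by case: eqP.
Qed.

Lemma marked_add m gamma : marked (set_nth false m (idx gamma) true) = gamma |: marked m.
Proof.
apply/setP=> d; rewrite in_setU1 !mem_marked nth_set_nth /= (inj_eq (@idx_inj i)).
by case: eqP.
Qed.

Lemma split_inPn S beta gamma delta : ~~ split_in S (idx delta) ->
  beta \in marked S -> gamma \in marked S -> ~~ is_sum beta gamma delta.
Proof.
move=> /hasPn no; rewrite !mem_marked => Sb Sc; apply/negP; rewrite is_sumE => s.
have /no /= := etrans (mem_sums_to _ (idx_lt beta) (idx_lt delta)) s.
by rewrite Sb Sc.
Qed.

Lemma sumsP delta x y : (x, y) \in sums_to (idx delta) -> level i x -> level i y ->
  exists beta gamma, [/\ idx beta = x, idx gamma = y & is_sum beta gamma delta].
Proof.
move=> s lx ly; have [b Eb] := idx_of hi (level_lt lx) lx.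
have [c Ec] := idx_of hi (level_lt ly) ly; exists b, c; split=> //.
by rewrite is_sumE Ec Eb -(mem_sums_to _ (level_lt lx) (idx_lt delta)).
Qed.

Lemma split_inP S delta : (forall n, nth false S n -> level i n) -> split_in S (idx delta) ->
  exists beta gamma, [/\ beta \in marked S, gamma \in marked S & is_sum beta gamma delta].
Proof.
move=> lS /hasP[[x y] s /=]; case: ifP => // Sx Sy.
have [b [c [Eb Ec bcd]]] := sumsP s (lS x Sx) (lS y Sy); exists b, c.
by rewrite !mem_marked Eb Ec.
Qed.

Lemma sums_intoP H K beta gamma delta : sums_into H K (idx beta) ->
  gamma \in marked H -> is_sum beta gamma delta -> delta \in marked K.
Proof.
by move=> /allP ok; rewrite !mem_marked is_sumE => Hg /ok /=; rewrite Hg.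
Qed.

Variable alpha : posroot i.
Local Notation a := (idx alpha).

Lemma root_okP : root_ok i a.
Proof.
apply: (allP (allP roots_ok i hi)).
by rewrite mem_filter level_idx // mem_iota idx_lt.
Qed.

Lemma mem_arm gamma : (gamma \in arm alpha) = (idx gamma \in arm_list a).
Proof.
rewrite in_set !labelE /arm_list; have /allP := arm_table_gt0.
have [lt_a | le_a] := ltnP a (size arm_table); last by rewrite nth_default.
move/(_ _ (mem_nth [::] lt_a))/allP=> gt0; apply/idP/mapP => [A | [[|j] Aj ->] //].
  by exists (idx gamma).+1.
by have := gt0 _ Aj.
Qed.

Lemma arm_list_idx g : g \in arm_list a -> exists gamma delta,
  [/\ idx gamma = g, idx delta = partner a g, gamma != alpha, delta \notin arm alpha &
      is_sum delta gamma alpha].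
Proof.
have /and3P[/and4P[_ /allP arms_ok /allP legs_ok _] _ _] := root_okP.
move=> Ag; have /and3P[lt_g lg nga] := arms_ok g Ag.
have /and4P[lt_d ld nAd s] := legs_ok g Ag.
have [c Ec] := idx_of hi lt_g lg; have [d Ed] := idx_of hi lt_d ld; exists c, d.
by split=> //; rewrite -?(inj_eq (@idx_inj i)) ?mem_arm ?is_sumE ?Ed ?Ec.
Qed.

Lemma arm_partner gamma delta : gamma \in arm alpha -> is_sum delta gamma alpha ->
  idx delta = partner a (idx gamma).
Proof.
rewrite mem_arm => /arm_list_idx[c [d [/idx_inj-> <- _ _ dca]]] dga.
by congr idx; apply: (@is_sum_cancel gamma _ _ alpha); rewrite is_sumC.
Qed.

Lemma mem_leg delta : (delta \in leg alpha) =
  (idx delta \in [seq partner a g | g <- arm_list a]).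
Proof.
rewrite in_set; apply/exists_inP/mapP => [[c Ac cda] | [g Ag Ed]].
  exists (idx c); first by rewrite -mem_arm.
  by apply: arm_partner; rewrite // is_sumC.
have [c [d [Ec Ed' _ _ dca]]] := arm_list_idx Ag; exists c; first by rewrite mem_arm Ec.
by rewrite is_sumC (idx_inj (etrans Ed (esym Ed'))).
Qed.

Lemma marked_source : marked (source_mask i a) = source alpha.
Proof. by apply/setP=> c; rewrite mem_marked_mask level_idx // in_setC mem_arm. Qed.

Lemma arm_sub_source : alpha \in source alpha.
Proof.
rewrite in_setC mem_arm; apply/negP=> /arm_list_idx[c [d [/idx_inj-> _]]].
by rewrite eqxx.
Qed.

Lemma arm_heisenberg : heisenberg (@is_sum i) alpha (arm alpha) setT.
Proof.
have /and3P[/and4P[_ _ _ /allP sums] _ _] := root_okP.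
have memH c : c \in (arm alpha :&: setT) :|: leg_in (@is_sum i) alpha (arm alpha) setT ->
    idx c \in arm_list a ++ [seq partner a g | g <- arm_list a].
  move=> hc; rewrite mem_cat; apply/orP; case/setUP: hc => [/setIP[Ac _] | Lc].
    by left; rewrite -mem_arm.
  right; rewrite -mem_leg; move: Lc; rewrite mem_leg_in => /andP[_ /exists_inP[g]].
  move=> /setIP[Ag _] cga; rewrite in_set; apply/exists_inP; exists g; first exact: Ag.
  by rewrite is_sumC.
split=> [g | b c hb hc d bcd].
  rewrite setIT mem_arm => /arm_list_idx[c [d [/idx_inj-> _ _ nAd dca]]].
  by exists d; rewrite // in_setD nAd in_setT.
have c_in : c \in marked (mask_of
    (fun n => n \in arm_list a ++ [seq partner a g | g <- arm_list a])).
  by rewrite mem_marked_mask memH.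
have := sums_intoP (sums _ (memH b hb)) c_in bcd.
rewrite marked_add in_setU1 mem_marked_mask orbF; exact/eqP.
Qed.

Local Notation Red := (reduced (@is_sum i) #|F| (root_group F hi) alpha (arm alpha)).

Lemma removable_step b S K K0 g : g \in arm_list a -> nth false S g -> removable a S K g ->
  Red b (marked S) (marked K) K0 ->
  Red b (marked (set_nth false S g false)) (marked (set_nth false K (partner a g) true)) K0.
Proof.
move=> Ag; have [c [d [Ec Ed _ _ dca]]] := arm_list_idx Ag.
rewrite /removable -Ed -Ec => Sc; case: ifP => // /negbT nsplit /andP[Sd into] red.
have [_ [/idealP[_ cl] _ _ _ _] _] := red.
rewrite marked_remove marked_add.
apply: (reduced_arm is_sumC (@sum_rank i) is_sum_cancel (@root_rank_inj i)
  card_field_gt1 (card_root_group F hi) (abelian_root_group F hi)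
  (@root_group_sum i F hi) (@root_group_pair i F hi) (@root_group_comm i F hi)
  (root_group_free F hi) red).
- apply/setIP; split; first by rewrite mem_arm Ec; exact: Ag.
  by rewrite mem_marked; exact: Sc.
- by rewrite mem_marked; exact: Sd.
- exact: dca.
- apply/idealP; split=> [|x y z /setD1P[_ Sx] /setD1P[_ Sy] xyz]; first exact: subxx.
  apply/setD1P; split; last exact: cl xyz.
  by apply: contraTneq xyz => ->; apply: split_inPn nsplit Sx Sy.
- move=> e z Se dez; have := sums_intoP into Se dez.
  by rewrite marked_add.
Qed.

Lemma enlarge_step S K K0 todo :
    (forall n, nth false S n -> level i n) -> {subset todo <= arm_list a} ->
    (forall gamma, (gamma \in arm alpha :&: marked S) = (idx gamma \in todo)) ->
    ideal_mask (enlarge a S K todo) S -> ~~ nth false (enlarge a S K todo) a ->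
  Red true (marked S) (marked K) K0 -> Red true (marked S) (marked (enlarge a S K todo)) K0.
Proof.
move=> lS sub_todo mem_todo /allP idK' nK'a red.
have K'P c : c \in marked (enlarge a S K todo) ->
    idx c \in iota 0 120 /\ nth false (enlarge a S K todo) (idx c).
  by rewrite mem_marked mem_iota idx_lt.
apply: (reduced_kernel is_sumC (@sum_rank i) is_sum_cancel (@root_rank_inj i)
  card_field_gt1 (card_root_group F hi) (abelian_root_group F hi)
  (@root_group_sum i F hi) (@root_group_pair i F hi) (@root_group_comm i F hi)
  (root_group_free F hi) arm_heisenberg red).
- apply/idealP; split=> [|b c d /K'P[lt_b K'b] Sc bcd].
    apply/subsetP=> b /K'P[lt_b K'b]; have := idK' _ lt_b; rewrite K'b mem_marked.
    by case/andP.
  have := idK' _ lt_b; rewrite K'b => /andP[_ into]; exact: sums_intoP into Sc bcd.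
- by rewrite mem_marked.
- by apply/subsetP=> c; rewrite mem_marked_mask mem_marked => ->.
move=> d /setDP[]; rewrite mem_marked_mask mem_marked => K'd nKd; move: K'd.
rewrite (negPf nKd) => /hasP[[x y] s /=]; case: ifP => // Zx Sy.
move: Zx; rewrite nth_mask_of => /andP[_]; case: ifP => // Sx into.
have [b [c [Eb Ec bcd]]] := sumsP s (lS _ Sx) (lS _ Sy).
exists b, c; split; rewrite ?mem_marked ?Eb ?Ec //.
move=> e he z bez; rewrite -Eb in into; apply: (sums_intoP into _ bez).
rewrite mem_marked_mask mem_cat; case/setUP: he => [ASe | Le].
  by apply/orP; left; rewrite -mem_todo; exact: ASe.
move: Le; rewrite mem_leg_in => /andP[_ /exists_inP[g ASg ega]].
have [Ag _] := setIP ASg.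
apply/orP; right; apply/mapP; exists (idx g); first by rewrite -mem_todo; exact: ASg.
exact: arm_partner Ag ega.
Qed.

Lemma reduceP b fuel S K K0 todo Kf :
    (forall n, nth false S n -> level i n) -> {subset todo <= arm_list a} ->
    (forall gamma, (gamma \in arm alpha :&: marked S) = (idx gamma \in todo)) ->
    Red b (marked S) (marked K) K0 -> reduce a b fuel S K todo = Some Kf ->
  Red b (source alpha) (marked Kf) K0.
Proof.
have done_case S' K' : (forall gamma, (gamma \in arm alpha :&: marked S') = false) ->
    Red b (marked S') (marked K') K0 -> Red b (source alpha) (marked K') K0.
  move=> AS0 red; have [sAS _ _] := red; suff <- : marked S' = source alpha by [].
  apply/eqP; rewrite eqEsubset sAS andbT; apply/subsetP=> c Sc.
  apply/setCP=> Ac; have := AS0 c; rewrite (introT setIP (conj Ac Sc)); discriminate.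
elim: fuel S K todo => [|fuel IHfuel] S K [|g0 todo0] lS sub_todo mem_todo red.
- by case=> <-; apply: done_case mem_todo red.
- by [].
- by case=> <-; apply: done_case mem_todo red.
rewrite reduceS; move: (g0 :: todo0) sub_todo mem_todo => todo sub_todo mem_todo.
rewrite -has_find; case: ifP => [hit | _].
  set g := nth _ _ _; have rg : removable a S K g by apply: nth_find.
  have tg : g \in todo by apply: mem_nth; rewrite -has_find.
  have Ag := sub_todo g tg; have [c [_ [Ec _ _ _ _]]] := arm_list_idx Ag.
  have [_ Sc] : c \in arm alpha /\ c \in marked S by apply/setIP; rewrite mem_todo Ec.
  have Sg : nth false S g by rewrite -Ec -mem_marked.
  apply: IHfuel; last exact: removable_step Ag Sg rg red.
  - by move=> n; rewrite nth_set_nth /=; case: eqP => // _; apply: lS.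
  - by move=> x; rewrite mem_filter => /andP[_]; apply: sub_todo.
  move=> d; rewrite mem_filter -mem_todo -Ec marked_remove (inj_eq (@idx_inj i)).
  by rewrite setIDA in_setD1.
move: red IHfuel {done_case}; case: b => red IHfuel; last discriminate.
case: ifP => [/andP[idK' nK'a] | _]; last discriminate.
apply: (IHfuel _ _ _ lS sub_todo mem_todo); exact: enlarge_step lS sub_todo mem_todo idK' nK'a red.
Qed.

End Search.

(** * The characters over a root *)

Lemma one_to_one_comp (T1 T2 T3 : eqType) (s1 : seq T1) (s2 : seq T2) (s3 : seq T3)
    (f : T1 -> T2) (g : T2 -> T3) :
  one_to_one s1 s2 f -> one_to_one s2 s3 g -> one_to_one s1 s3 (fun x => g (f x)).
Proof.
move=> [imf injf surjf] [img injg surjg]; split=> [x sx | x y sx sy /injg E | z].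
- by rewrite img ?imf.
- by apply: injf => //; apply: E; apply: imf.
by case/surjg=> y /surjf[x sx <-] <-; exists x.
Qed.

Lemma one_to_one_size (T1 T2 : eqType) (s1 : seq T1) (s2 : seq T2) (f : T1 -> T2) :
  uniq s1 -> uniq s2 -> one_to_one s1 s2 f -> size s2 = size s1.
Proof.
move=> U1 U2 [im inj surj]; rewrite -(size_map f s1); apply: perm_size.
apply: uniq_perm => // [|y]; first by rewrite map_inj_in_uniq.
apply/idP/mapP => [/surj[x sx <-] | [x sx ->]]; first by exists x.
exact: im.
Qed.

Section CountLinear.

Variables (gT : finGroupType) (G : {group gT}).

Lemma uniq_irr : uniq (irr G).
Proof. exact/free_uniq/irr_free. Qed.

Lemma size_Irr_lin : size (Irr_lin G) = #|G : G^`(1)|%g.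
Proof.
rewrite -card_lin_irr size_filter -(map_tnth_enum (irr G)) count_map cardE size_filter.
by rewrite enumT.
Qed.

Lemma size_Irr_nontriv : abelian G -> size (Irr_nontriv G) = (#|G| - 1)%N.
Proof.
rewrite card_classes_abelian => /eqP cl; rewrite /Irr_nontriv -(rem_filter 1 uniq_irr) size_rem ?cfun1_irr //.
by rewrite size_tuple NirrE cl subn1.
Qed.

End CountLinear.

Section Main.

Variables (i : nat) (F : finFieldType).
Hypothesis hi : i \in [:: 6; 7; 8]%N.
Variable alpha : posroot i.
Implicit Types (beta gamma delta eta eps : posroot i) (N K T : {set posroot i}).
Local Notation a := (idx alpha).
Local Notation X := (root_group F hi).

Definition below_alpha beta := below (idx beta) a.

Lemma underP beta : reflect (forall j, j \in nodes 8 -> coord (vec beta) j <= coord (vec alpha) j)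
  (below_alpha beta).
Proof. by apply: (iffP allP); rewrite !nth_idx. Qed.

Lemma coord_sum beta gamma delta j : is_sum beta gamma delta -> j \in nodes 8 ->
  coord (vec delta) j = coord (vec beta) j + coord (vec gamma) j.
Proof. by move/is_sumP-> => /coord_addv->. Qed.

Lemma under_step beta : beta != alpha -> below_alpha beta ->
  exists gamma delta, is_sum beta gamma delta /\ below_alpha delta.
Proof.
move=> nba ub; have /and3P[_ /allP/(_ (idx beta)) step _] := root_okP hi alpha.
move: step; rewrite mem_iota idx_lt => /(_ isT).
rewrite (inj_eq (@idx_inj i)) nba nth_mask_of idx_lt (level_idx hi) -/(below_alpha beta) ub /=.
case/hasP=> [[x y] s /=]; rewrite nth_mask_of; case: ifP => // /andP[lt_y /andP[ly uy]] lx.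
have [c Ec] := idx_of hi (level_lt hi lx) lx; have [d Ed] := idx_of hi lt_y ly.
by exists c, d; rewrite is_sumE Ec Ed /below_alpha Ed.
Qed.

(** Each root below alpha, other than alpha, has a sum that is still below alpha, so
    that a chain of sums leads up to alpha. *)
Lemma under_ind (Q : posroot i -> Prop) beta : below_alpha beta -> Q beta ->
  (forall gamma eta delta, Q gamma -> is_sum gamma eta delta -> Q delta) -> Q alpha.
Proof.
move=> ub Qb step; have [n] := ubnP (120 - root_rank beta).
elim: n beta ub Qb => // n IHn beta ub Qb le_n.
have [<- // | nba] := eqVneq beta alpha.
have [gamma [delta [bcd ud]]] := under_step nba ub.
apply: (IHn delta) => //; first exact: step bcd.
have := sum_rank bcd; have := idx_lt delta; rewrite -root_rankE; move: le_n.
move: (root_rank beta) (root_rank delta); clear; lia.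
Qed.

Lemma preceqE beta : preceq beta alpha <-> below_alpha beta.
Proof.
split=> [[s Ea] | ub].
  apply/underP=> j j8; rewrite Ea; elim: s {Ea} => //= c s IHs.
  rewrite coord_addv //; apply: le_trans IHs _; rewrite lerDr.
  exact: coord_ge0 (vec_table c).
pose Q delta := exists s : seq (posroot i),
  vec delta = foldr addv (vec beta) [seq vec gamma | gamma <- s].
apply: (@under_ind Q beta) => [//||c e d [s Ec] /is_sumP Ed]; first by exists [::].
by exists (e :: s); rewrite /= -Ec vaddC.
Qed.

Lemma mem_kset beta : (beta \in kset alpha) = ~~ below_alpha beta.
Proof. by rewrite in_set; congr negb; apply/asboolP/idP => /preceqE. Qed.

Lemma under_refl : below_alpha alpha.
Proof. exact/underP. Qed.

Lemma under_sum beta gamma delta : is_sum beta gamma delta -> below_alpha delta -> below_alpha beta.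
Proof.
move=> bcd /underP ud; apply/underP=> j j8; apply: le_trans (ud j j8).
by rewrite (coord_sum bcd j8) lerDl; exact: coord_ge0 (vec_table gamma).
Qed.

Lemma over_not_under gamma delta : is_sum alpha gamma delta -> ~~ below_alpha delta.
Proof.
move=> acd; apply/underP=> ud.
suff z : vec gamma = zerov by have := vec_rootset gamma; rewrite z (negPf (zerov_Phi hi)).
have sg := size_rootset (vec_rootset gamma).
apply: (@eq_from_nth _ 0); rewrite sg // => j lt_j.
have j8 : j.+1 \in nodes 8 by rewrite mem_iota.
have := ud _ j8; rewrite (coord_sum acd j8) gerDl; have := coord_ge0 j.+1 (vec_table gamma).
have -> : nth 0 zerov j = 0 by rewrite nth_nseq if_same.
rewrite /coord /=; move: (nth 0 (vec gamma) j); clear; lia.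
Qed.

Lemma kset_mod : central_mod (@is_sum i) alpha setT (kset alpha).
Proof.
split.
- by apply/idealP; split=> // b c d; rewrite !in_setT.
- apply/idealP; split=> [|b c d]; first exact: subsetT.
  rewrite !mem_kset => nub _ bcd; apply: contra nub; exact: under_sum bcd.
- exact: in_setT.
- by rewrite mem_kset under_refl.
by move=> e d _; rewrite mem_kset; apply: over_not_under.
Qed.

Local Notation K0 := (kset alpha).
Local Notation S := (source alpha).
Local Notation A := (arm alpha).

Let normP N T : ideal (@is_sum i) N T -> (pattern X N <| pattern X T)%g :=
  pattern_normal (@root_group_sum i F hi) (@root_group_comm i F hi) (N := N) (S := T).

Let commP (T' T K : {set posroot i}) beta : ideal (@is_sum i) K T' -> T \subset T' -> beta \in T' ->
    (forall gamma delta, gamma \in T -> is_sum beta gamma delta -> delta \in K) ->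
  {in X beta & pattern X T, forall b c, [~ b, c]%g \in pattern X K} :=
  pattern_commg (@root_group_sum i F hi) (@root_group_comm i F hi) (S := T') (T := T) (K := K) (beta := beta).

Let kerP T (chi : 'CF(pattern X T)) : ideal (@is_sum i) T T ->
    ideal (@is_sum i) [set gamma in T | X gamma \subset cfker chi] T :=
  kernel_ideal (card_field_gt1 F) (card_root_group F hi) (@root_group_pair i F hi) chi (S := T).

Lemma sub_center T K (chi : 'CF(pattern X T)) beta : chi \in irr (pattern X T) ->
    ideal (@is_sum i) K T -> pattern X K \subset cfker chi -> beta \in T ->
    (forall gamma delta, gamma \in T -> is_sum beta gamma delta -> delta \in K) ->
  X beta \subset 'Z(chi)%CF.
Proof.
move=> irr_chi idK sKK Tb bT; apply/subsetP=> b Xb.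
have Gb := subsetP (root_sub_pattern X Tb) b Xb.
apply/(cfcenterP irr_chi Gb) => c Gc; apply: (subsetP sKK).
exact: (commP idK (subxx T) Tb bT Xb Gc).
Qed.

Lemma center_sum T (chi : 'CF(pattern X T)) beta gamma delta : chi \in irr (pattern X T) ->
    beta \in T -> gamma \in T -> is_sum beta gamma delta ->
  X beta \subset 'Z(chi)%CF -> X delta \subset cfker chi.
Proof.
move=> irr_chi Tb Tc bcd sZ; apply/subsetP=> d Xd.
have [b Xb ntb] := root_neq1 (card_field_gt1 F) (card_root_group F hi) beta.
have [c Xc <-] := root_group_pair bcd Xb Xd ntb.
have Gb := subsetP (root_sub_pattern X Tb) b Xb; have Gc := subsetP (root_sub_pattern X Tc) c Xc.
exact: (elimT (cfcenterP irr_chi Gb) (subsetP sZ b Xb)).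
Qed.

Lemma sum_der1 T beta gamma delta : beta \in T -> gamma \in T -> is_sum beta gamma delta ->
  X delta \subset (pattern X T)^`(1)%g.
Proof.
move=> Tb Tc bcd; have [x Xx ntx] := root_neq1 (card_field_gt1 F) (card_root_group F hi) beta.
apply/subsetP=> z Xz; have [y Xy <-] := root_group_pair bcd Xx Xz ntx; apply: mem_commg.
  exact: subsetP (root_sub_pattern X Tb) x Xx.
exact: subsetP (root_sub_pattern X Tc) y Xy.
Qed.

(** If chi has central root support alpha, a root of largest number outside the
    kernel among those not below alpha would also be in the support. Conversely a
    root of the support other than alpha has a sum that is below alpha and in the
    kernel, and from there a chain of sums leads to alpha. *)
Lemma root_support (chi : 'CF(pattern X setT)) : chi \in irr (pattern X setT) ->
  ([set gamma | (X gamma \subset 'Z(chi)%CF) && ~~ (X gamma \subset cfker chi)] == [set alpha]) =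
  (pattern X K0 \subset cfker chi) && ~~ (X alpha \subset cfker chi).
Proof.
move=> irr_chi; set rs := [set gamma | _].
have mem_rs b : (b \in rs) = (X b \subset 'Z(chi)%CF) && ~~ (X b \subset cfker chi).
  by rewrite in_set.
have [clT idK _ nKa aK] := kset_mod; have [_ nK] := idealP _ _ _ idK.
have [_ kerT] := idealP _ _ _ (kerP chi clT).
have mem_ker b : (b \in [set gamma in setT | X gamma \subset cfker chi]) =
    (X b \subset cfker chi) by rewrite in_set in_setT.
have sum_ker b c d : is_sum b c d -> X b \subset cfker chi ->
    X d \subset cfker chi.
  move=> bcd Kb; have := kerT b c d; rewrite !mem_ker; apply; [exact: Kb | exact: in_setT | exact: bcd].
apply/eqP/andP=> [rsE | [sKK nXK]].
  have : alpha \in rs by rewrite rsE set11.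
  rewrite mem_rs => /andP[_ nXK]; split=> //.
  apply/pattern_subP=> b0 Kb0; apply: contraT => nXb0.
  pose B := [set b in K0 | ~~ (X b \subset cfker chi)].
  have Bb0 : b0 \in B by rewrite in_set Kb0.
  have [b Bb max_b] := max_label (@root_rank i) Bb0.
  move: Bb; rewrite in_set => /andP[Kb nXb].
  suff : b \in rs by rewrite rsE => /set1P Eb; case/negP: nKa; rewrite Eb in Kb.
  rewrite mem_rs nXb andbT.
  apply: (sub_center (K := [set gamma in setT | X gamma \subset cfker chi])) => //.
  - exact: kerP.
  - by apply/pattern_subP=> c; rewrite mem_ker.
  move=> c d _ bcd; rewrite mem_ker; apply: contraT => nXd.
  have := max_b d; rewrite in_set nXd (nK b c) ?in_setT // => /(_ isT).
  by rewrite leqNgt (sum_rank bcd).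
apply/setP=> c; rewrite in_set1 mem_rs; apply/andP/eqP => [[sZc nXc] | ->]; last first.
  by split=> //; apply: (sub_center (K := K0)).
apply/eqP; apply: contraR nXK => nca.
have uc : below_alpha c.
  rewrite -[below_alpha c]negbK -mem_kset; apply: contra nXc => /(root_sub_pattern X) sXP.
  exact: subset_trans sXP sKK.
have [e [d [ced ud]]] := under_step nca uc.
have Kd : X d \subset cfker chi.
  by apply: center_sum ced sZc => //; apply: in_setT.
have step c' e' d' : X c' \subset cfker chi -> is_sum c' e' d' -> X d' \subset cfker chi.
  by move=> Kc' /sum_ker; apply.
exact: (under_ind (Q := fun d => X d \subset cfker chi) ud Kd step).
Qed.

Lemma Irr_atE : Irr_at F alpha = over_root #|F| X alpha A false setT K0.
Proof.
apply: eq_in_filter => chi irr_chi; rewrite andbT; exact: root_support irr_chi.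
Qed.

Local Notation Red b T K := (reduced (@is_sum i) #|F| X alpha A b T K K0).

Lemma kernel_search b : kernel_ok i a b -> exists K : {set posroot i},
  [/\ Red b S K, leg alpha :|: K0 \subset K &
      {in K, forall delta, delta \in leg alpha :|: K0 \/
         b /\ exists beta gamma, [/\ beta \in S, gamma \in S & is_sum beta gamma delta]}].
Proof.
rewrite /kernel_ok; case E: (reduce _ _ _ _ _ _) => [K|]; last discriminate.
move=> /allP ok; exists (marked i K).
have okK d : (nth false (outside i a) (idx d) || (d \in leg alpha) ==> nth false K (idx d)) &&
   (nth false K (idx d) ==> [|| nth false (outside i a) (idx d), d \in leg alpha |
       b && split_in (source_mask i a) (idx d)]).
  by have := ok (idx d); rewrite mem_iota idx_lt (level_idx hi) (mem_leg hi) => /(_ isT).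
have outE d : nth false (outside i a) (idx d) = (d \in K0).
  by rewrite nth_mask_of idx_lt (level_idx hi) mem_kset.
split.
- have levelT : marked i (level_mask i) = setT.
    by apply/setP=> d; rewrite mem_marked in_setT; apply: level_idx.
  apply: reduceP E => // [g | ]; first by rewrite levelT setIT mem_arm.
  rewrite levelT.
  have -> : marked i (outside i a) = K0 by apply/setP=> d; rewrite mem_marked.
  exact/reduced0/kset_mod.
- apply/subsetP=> d; rewrite in_setU mem_marked orbC -outE => Od.
  by have /andP[/implyP/(_ Od)] := okK d.
move=> d; rewrite mem_marked => Kd; have /andP[_ /implyP/(_ Kd)] := okK d.
rewrite outE in_setU orbA [(d \in K0) || _]orbC => /orP[-> | /andP[-> sp]]; [by left | right].
split=> //; rewrite -(marked_source hi); apply: split_inP sp => // n.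
by rewrite nth_mask_of => /and3P[].
Qed.

(** The part of the kernel of T-bar besides alpha is the least ideal of the
    source containing the leg and the roots that are not below alpha. *)
Definition lower : {set posroot i} := 
  if alpha \in Rnormal i then leg alpha :|: K0 else leg_bar alpha :|: K0.

Lemma Tbar_kernelE : Tbar_kernel alpha = alpha |: lower.
Proof. by rewrite /Tbar_kernel /lower; case: ifP. Qed.

Lemma root_ok_kernel : kernel_ok i a true.
Proof. by have /and3P[_ _ /and4P[]] := root_okP hi alpha. Qed.

Lemma root_ok_normal : alpha \in Rnormal i -> kernel_ok i a false.
Proof.
have /and3P[_ _ /and4P[_ _ ok _]] := root_okP hi alpha.
by rewrite in_set labelE; move: ok; case: ifP.
Qed.

Lemma lower_normal : alpha \in Rnormal i -> Red false S lower.
Proof.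
move=> normal; have [K [red sub sup]] := kernel_search (root_ok_normal normal).
rewrite (_ : lower = K) //; rewrite /lower normal; apply/eqP; rewrite eqEsubset sub.
by apply/subsetP=> d /sup[Ld | [E _]]; [exact: Ld | discriminate E].
Qed.

Lemma lowerP : [/\ ideal (@is_sum i) lower S, leg alpha :|: K0 \subset lower, alpha \notin lower &
  forall N, ideal (@is_sum i) N S -> leg alpha :|: K0 \subset N -> lower \subset N].
Proof.
have [normal | nnormal] := boolP (alpha \in Rnormal i).
  have [_ [_ idM _ nMa _] _] := lower_normal normal.
  by move: idM nMa; rewrite /lower normal.
have [K [[_ [_ idK _ nKa _] _] sub _]] := kernel_search root_ok_kernel.
have E : lower = normal_closure (leg alpha :|: K0) S.
  have sKC : K0 \subset normal_closure (leg alpha :|: K0) S.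
    by apply/bigcapsP=> N /andP[_ subN]; apply: subset_trans (subsetUr _ _) subN.
  rewrite /lower (negPf nnormal) /leg_bar; apply/setP=> d; rewrite in_setU in_setD.
  case: (boolP (d \in K0)) => [Kd | _]; first exact/esym/(subsetP sKC).
  by rewrite orbF.
rewrite E; have least N : ideal (@is_sum i) N S -> leg alpha :|: K0 \subset N ->
    normal_closure (leg alpha :|: K0) S \subset N.
  by move=> idN subN; apply: bigcap_inf; apply/andP.
split=> //.
- apply/idealP; split=> [|b c d Cb Sc bcd].
    by have [sKS _] := idealP _ _ _ idK; apply: subset_trans (least K idK sub) sKS.
  apply/bigcapP=> N /andP[idN subN]; have [_ nN] := idealP _ _ _ idN.
  by apply: nN Sc bcd; apply: (bigcapP Cb); apply/andP.
- by apply/bigcapsP=> N /andP[].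
by apply: contra nKa; apply: subsetP (least K idK sub) alpha.
Qed.

Lemma source_closed : ideal (@is_sum i) S S.
Proof. by have [K [[_ [clS _ _ _ _] _] _ _]] := kernel_search root_ok_kernel. Qed.

Lemma source_alpha_closed : ideal (@is_sum i) (S :\ alpha) (S :\ alpha).
Proof.
have [_ cl] := idealP _ _ _ source_closed; have /and3P[_ _ /and4P[]] := root_okP hi alpha.
move=> nsplit _ _ _; apply/idealP; split=> [|b c d /setD1P[_ Sb] /setD1P[_ Sc] bcd].
  exact: subxx.
apply/setD1P; split; last exact: cl bcd.
by apply: contraTneq bcd => ->; apply: split_inPn nsplit _ _; rewrite (marked_source hi).
Qed.

Lemma source_sdprod : (pattern X (S :\ alpha) ><| pattern X [set alpha])%g = pattern X S.
Proof.
exact (pattern_sdprod (@is_sumC i) (@sum_rank i) (@root_rank_inj i) (card_field_gt1 F)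
  (card_root_group F hi) (@root_group_sum i F hi) (@root_group_comm i F hi)
  (root_group_free F hi) source_closed (arm_sub_source hi alpha) source_alpha_closed).
Qed.

Lemma lower_top : ideal (@is_sum i) (alpha |: lower) S.
Proof.
have [idM subM nMa _] := lowerP; have [sMS nM] := idealP _ _ _ idM.
have Sa : alpha \in S := arm_sub_source hi alpha.
apply/idealP; split=> [|b c d]; first by rewrite subUset sub1set Sa sMS.
case/setU1P=> [-> _ acd | Mb Sc bcd]; apply/setU1P; right; last exact: nM bcd.
by apply: (subsetP subM); rewrite in_setU mem_kset (over_not_under acd) orbT.
Qed.

Section Twist.

Variable sd : (pattern X (S :\ alpha) ><| pattern X [set alpha])%g = pattern X S.

Local Notation twist := (@central_twist _ _ _ _ (pattern X (Tbar_kernel alpha)) sd).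

Lemma twist_hyps : [/\ abelian (pattern X [set alpha]), (pattern X (Tbar_kernel alpha) <| pattern X S)%g,
  pattern X lower \subset pattern X (S :\ alpha), pattern X lower \subset pattern X (Tbar_kernel alpha) &
  pattern X [set alpha] \subset pattern X (Tbar_kernel alpha) /\
  (pattern X (Tbar_kernel alpha) \subset pattern X lower <*> pattern X [set alpha])%g /\
  {in pattern X [set alpha] & pattern X S, forall z g, [~ z, g]%g \in pattern X lower}].
Proof.
have [idM subM nMa _] := lowerP; have [sMS nM] := idealP _ _ _ idM.
have Sa : alpha \in S := arm_sub_source hi alpha.
rewrite !Tbar_kernelE; split.
- by rewrite pattern1; apply: abelian_root_group.
- exact/normP/lower_top.
- by apply: pattern_sub; rewrite subsetD1 sMS.
- exact/pattern_sub/subsetUr.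
split; first exact/pattern_sub/subsetUl.
split; first by rewrite pattern_setU1 pattern1 joing_subl joing_subr.
rewrite pattern1; apply: commP idM (subxx S) Sa _ => e d Se aed.
by apply: (subsetP subM); rewrite in_setU mem_kset (over_not_under aed) orbT.
Qed.

Lemma over_root_normal :
  over_root #|F| X alpha A false S lower =i [seq chi : 'CF(pattern X S) <- irr (pattern X S) |
    (pattern X lower \subset cfker chi) && ~~ (pattern X [set alpha] \subset cfker chi)].
Proof. by move=> chi; rewrite mem_over_root andbT mem_filter pattern1 andbC. Qed.

Lemma arm_source0 : A :&: S = set0.
Proof. exact: setICr. Qed.

(** For linear characters it does not matter whether the kernel contains all
    that the reduction puts there: the excess consists of commutators. *)
Lemma over_root_linear K : Red true S K -> leg alpha :|: K0 \subset K ->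
    {in K, forall delta, delta \in leg alpha :|: K0 \/
         exists beta gamma, [/\ beta \in S, gamma \in S & is_sum beta gamma delta]} ->
  over_root #|F| X alpha A true S K =i [seq chi : 'CF(pattern X S) <- irr (pattern X S) |
    [&& pattern X lower \subset cfker chi, ~~ (pattern X [set alpha] \subset cfker chi) & chi 1%g == 1]].
Proof.
move=> red sub sup chi; have [idM subM nMa least] := lowerP; have [_ [clS idK _ _ _] _] := red.
rewrite mem_over_root mem_filter pattern1 arm_source0 cards0 expn0 andbC.
apply: andb_id2r => irr_chi; apply/and3P/and3P => [] [sKK nX one]; split=> //.
  exact: subset_trans (pattern_sub X (least K idK sub)) sKK.
have Lchi : chi \is a linear_char by rewrite qualifE /= irrWchar.
apply/pattern_subP=> d Kd; case: (sup d Kd) => [Ld | [b [c [Sb Sc bcd]]]].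
  exact: subset_trans (root_sub_pattern X (subsetP subM d Ld)) sKK.
exact: subset_trans (sum_der1 Sb Sc bcd) (lin_char_der1 Lchi).
Qed.

Lemma twist_normal : alpha \in Rnormal i ->
  one_to_one [seq (mu, lambda) | mu <- irr (pattern X S / pattern X (Tbar_kernel alpha))%g,
                                 lambda <- Irr_nontriv (pattern X [set alpha])]
    (over_root #|F| X alpha A false setT K0) (fun p => 'Ind[pattern X setT] (twist p)).
Proof.
move=> normal; have [abZ nsN sMC sMN [sZN [sNMZ cZ]]] := twist_hyps.
have [_ _ bij] := lower_normal normal.
apply: one_to_one_comp bij; apply: (eq_mem_one_to_one (fun=> erefl) (fun chi => esym (over_root_normal chi))).
exact: central_twist_one_to_one abZ nsN sMC sMN sZN sNMZ cZ.
Qed.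

Lemma twist_linear :
  one_to_one [seq (mu, lambda) | mu <- Irr_lin (pattern X S / pattern X (Tbar_kernel alpha))%G,
                                 lambda <- Irr_nontriv (pattern X [set alpha])]
    (over_root #|F| X alpha A true setT K0) (fun p => 'Ind[pattern X setT] (twist p)).
Proof.
have [abZ nsN sMC sMN [sZN [sNMZ cZ]]] := twist_hyps.
have [K [red sub sup]] := kernel_search root_ok_kernel; have [_ _ bij] := red.
apply: one_to_one_comp bij.
have sup' : {in K, forall delta, delta \in leg alpha :|: K0 \/
    exists beta gamma, [/\ beta \in S, gamma \in S & is_sum beta gamma delta]}.
  by move=> d /sup[Ld | [_ ex]]; [left | right].
have E := over_root_linear red sub sup'.
apply: (eq_mem_one_to_one (fun=> erefl) (fun chi => esym (E chi))).
exact: central_twist_lin_one_to_one abZ nsN sMC sMN sZN sNMZ cZ.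
Qed.

End Twist.

(** The root subgroups of the source whose images in T-bar are trivial or
    commutators. *)
Definition lower_der : {set posroot i} := [set delta in S |
  [|| delta == alpha, delta \in K0, delta \in leg alpha | split_in (source_mask i a) (idx delta)]].

Lemma card_marked (p : pred nat) :
  #|[set delta : posroot i | p (idx delta)]| = count (fun n => level i n && p n) (iota 0 120).
Proof.
rewrite cardE -(size_map (@idx i)) -size_filter; apply: perm_size.
apply: uniq_perm => [||n].
- by rewrite map_inj_uniq ?enum_uniq //; apply: idx_inj.
- by rewrite filter_uniq // iota_uniq.
rewrite mem_filter mem_iota; apply/mapP/idP => [[d pd ->] | /andP[/andP[ln pn] lt_n]].
  by move: pd; rewrite mem_enum in_set => ->; rewrite level_idx // idx_lt.
by have [d Ed] := idx_of hi lt_n ln; exists d; rewrite // mem_enum in_set Ed.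
Qed.

Lemma root_ok_count : count_ok i a.
Proof. by have /and3P[_ _ /and4P[_ _ _]] := root_okP hi alpha. Qed.

Lemma card_arm : #|A| = (mida_exp alpha).2.
Proof.
have /andP[/eqP E _] := root_ok_count; rewrite /mida_exp labelE -[_.+1.-1]/a -E.
have /and3P[/and4P[U arms_ok _ _] _ _] := root_okP hi alpha.
rewrite cardE -(size_map (@idx i)); apply: perm_size; apply: uniq_perm => [||n].
- by rewrite map_inj_uniq ?enum_uniq //; apply: idx_inj.
- exact: U.
apply/mapP/idP => [[d Ad ->] | An]; first by rewrite -mem_arm -mem_enum.
have /and3P[lt_n ln _] := allP arms_ok n An.
by have [d Ed] := idx_of hi lt_n ln; exists d; rewrite // mem_enum mem_arm Ed.
Qed.

Lemma card_lower_der : (#|S| - #|lower_der|)%N = (mida_exp alpha).1.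
Proof.
have /andP[_ /eqP E] := root_ok_count; rewrite /mida_exp labelE -[_.+1.-1]/a -E.
rewrite -cardsDS; last by apply/subsetP=> d; rewrite in_set => /andP[].
pose p n := (n \notin arm_list a) &&
   ~~ [|| n == a, nth false (outside i a) n, n \in [seq partner a g | g <- arm_list a] |
       split_in (source_mask i a) n].
have -> : S :\: lower_der = [set delta | p (idx delta)].
  apply/setP=> d; rewrite in_setD [d \in lower_der]in_set [RHS]in_set /p -mem_arm -(mem_leg hi).
  rewrite (_ : nth false (outside i a) (idx d) = (d \in K0)); last first.
    by rewrite nth_mask_of idx_lt (level_idx hi) mem_kset.
  apply: etrans (congr1 (fun b => ~~ (b && [|| d == alpha, d \in K0, d \in leg alpha |
    split_in (source_mask i a) (idx d)]) && b) (in_setC d A)) _.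
  rewrite (inj_eq (@idx_inj i)) negb_and andb_orl andNb andbC; exact: erefl.
rewrite card_marked; apply: eq_in_count => n; rewrite mem_iota /= add0n => lt_n.
by rewrite /p [nth false (source_mask i a) n]nth_mask_of lt_n /= andbA.
Qed.

Lemma sum_lower_der beta gamma delta : beta \in S -> gamma \in S -> is_sum beta gamma delta ->
  delta \in lower_der.
Proof.
have [_ cl] := idealP _ _ _ source_closed; move=> Sb Sc bcd; rewrite in_set (cl beta gamma delta) // andTb.
have [sp | nsplit] := boolP (split_in (source_mask i a) (idx delta)); first exact/or4P/Or44.
by have := split_inPn nsplit; rewrite (marked_source hi) => /(_ _ _ Sb Sc); rewrite bcd.
Qed.

Lemma lower_der_ideal : ideal (@is_sum i) lower_der S.
Proof.
apply/idealP; split=> [|b c d]; first by apply/subsetP=> d; rewrite in_set => /andP[].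
by rewrite in_set => /andP[Sb _] Sc bcd; apply: sum_lower_der bcd.
Qed.

Lemma Tbar_kernel_der : Tbar_kernel alpha \subset lower_der.
Proof.
have [K [[_ [_ idK _ _ _] _] sub sup]] := kernel_search root_ok_kernel.
have [_ _ _ /(_ K idK sub) sMK] := lowerP; have [sKS _] := idealP _ _ _ idK.
rewrite Tbar_kernelE; apply/subsetP=> d /setU1P[-> | /(subsetP sMK) Kd].
  by rewrite in_set eqxx (arm_sub_source hi).
case: (sup d Kd) => [Ld | [_ [b [c [Sb Sc bcd]]]]]; last exact: sum_lower_der Sb Sc bcd.
rewrite in_set (subsetP sKS d Kd) /=; case/setUP: Ld => ->; by rewrite !orbT.
Qed.

(** The derived subgroup of T-bar is a pattern subgroup again, which counts the
    linear characters. *)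
Lemma index_der1_Tbar (N := pattern X (Tbar_kernel alpha)) :
  #|(pattern X S / N)%G : (pattern X S / N)^`(1)|%g = (#|F| ^ (mida_exp alpha).1)%N.
Proof.
have idD := lower_der_ideal; have /andP[sDS nDS] := normP idD.
have [idM subM _ _] := lowerP; have [sMS _] := idealP _ _ _ idM.
have sND : N \subset pattern X lower_der by apply/pattern_sub/Tbar_kernel_der.
have nNS : pattern X S \subset 'N(N)%g.
  by rewrite /N Tbar_kernelE; have /andP[] := normP lower_top.
have sGD : ((pattern X S)^`(1) \subset pattern X lower_der)%g.
  apply: der1_min => //; rewrite /abelian sub_quotient_pre //.
  apply/pattern_subP=> b Sb; apply/subsetP=> x Xx; have Gx := subsetP (root_sub_pattern X Sb) x Xx.
  apply/morphpreP; split; first exact: subsetP nDS x Gx.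
  apply/centP=> _ /morphimP[y ny Gy ->]; apply/commgP; rewrite -morphR ?(subsetP nDS x Gx) //.
  apply/eqP/coset_id; apply: (commP idD (subxx S) Sb _ Xx Gy) => c d Sc bcd.
  exact: sum_lower_der Sb Sc bcd.
have -> : ((pattern X S / N)^`(1) = pattern X lower_der / N)%g.
  rewrite -quotient_der //; apply/eqP; rewrite eqEsubset (quotientS _ sGD) andTb.
  rewrite sub_quotient_pre; last exact: subset_trans sDS nNS.
  apply/pattern_subP=> d Dd; apply/subsetP=> x Xx.
  have nNx : x \in 'N(N)%g.
    by apply: (subsetP nNS); apply: (subsetP sDS); apply: (subsetP (root_sub_pattern X Dd)).
  apply/morphpreP; split=> //; move: Dd; rewrite in_set => /andP[_].
  have inN : d \in Tbar_kernel alpha -> coset N x \in ((pattern X S)^`(1) / N)%g.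
    by move=> Nd; rewrite coset_id ?group1 //; apply: (subsetP (root_sub_pattern X Nd)).
  rewrite Tbar_kernelE in inN; case/or4P=> [/eqP Ed | Kd | Ld | sp].
  - by apply: inN; rewrite Ed setU11.
  - by apply/inN/setU1P; right; apply: (subsetP subM); rewrite in_setU Kd orbT.
  - by apply/inN/setU1P; right; apply: (subsetP subM); rewrite in_setU Ld.
  have [|b [c []]] := split_inP hi _ sp; first by move=> n; rewrite nth_mask_of => /and3P[].
  rewrite (marked_source hi) => Sb Sc bcd; apply: mem_quotient.
  exact: subsetP (sum_der1 Sb Sc bcd) x Xx.
rewrite (index_quotient_eq (subset_trans (subsetIr _ _) sND) sDS nNS).
rewrite (indexg_pattern (@is_sumC i) (@sum_rank i) (@root_rank_inj i) (card_field_gt1 F)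
  (card_root_group F hi) (@root_group_sum i F hi) (@root_group_comm i F hi)
  (root_group_free F hi) source_closed idD).
exact (congr1 (expn #|F|) card_lower_der).
Qed.

Lemma size_over_root_linear : size (over_root #|F| X alpha A true setT K0) =
  (#|F| ^ (mida_exp alpha).1 * (#|F| - 1))%N.
Proof.
have := one_to_one_size _ _ (twist_linear source_sdprod) => ->.
- rewrite size_allpairs size_Irr_lin index_der1_Tbar size_Irr_nontriv.
    rewrite pattern1 card_root_group; exact: erefl.
  by rewrite pattern1; apply: abelian_root_group.
- by apply: allpairs_uniq => [||[? ?] [? ?] _ _ //]; apply/filter_uniq/uniq_irr.
- exact/filter_uniq/uniq_irr.
Qed.

Lemma over_root_degree :
  {in over_root #|F| X alpha A true setT K0, forall chi : 'CF(pattern X setT),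
     chi 1%g = (#|F| ^ (mida_exp alpha).2)%:R}.
Proof.
by move=> chi; rewrite mem_over_root setIT card_arm => /and4P[_ _ _ /eqP].
Qed.

(** The bound q^n for the degrees over alpha, with n arms, is attained because the
    characters of this degree have been counted. *)
Lemma Irr_midaE : Irr_mida F alpha =i over_root #|F| X alpha A true setT K0.
Proof.
have degree_ge (chi : 'CF(pattern X setT)) : chi \in over_root #|F| X alpha A false setT K0 ->
    (#|F| ^ #|A :&: setT|)%:R <= chi 1%g.
  move=> Fchi; have := over_root_degree_ge (@is_sumC i) (@sum_rank i) (@is_sum_cancel i)
    (@root_rank_inj i) (card_field_gt1 F) (card_root_group F hi) (abelian_root_group F hi)
    (@root_group_sum i F hi) (@root_group_pair i F hi) (@root_group_comm i F hi)
    (root_group_free F hi) kset_mod (arm_heisenberg hi alpha) Fchi.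
  by case.
have mem_true (chi : 'CF(pattern X setT)) : (chi \in over_root #|F| X alpha A true setT K0) =
    (chi \in over_root #|F| X alpha A false setT K0) && (chi 1%g == (#|F| ^ #|A :&: setT|)%:R).
  by rewrite !mem_over_root andbT -!andbA.
have [chi0 F0] : exists chi0, chi0 \in over_root #|F| X alpha A true setT K0.
  have : (0 < size (over_root #|F| X alpha A true setT K0))%N.
    have pos e : (0 < #|F| ^ e * (#|F| - 1))%N.
      by rewrite muln_gt0 expn_gt0 subn_gt0 (card_field_gt1 F) (ltnW (card_field_gt1 F)).
    rewrite size_over_root_linear; exact: pos.
  by case: (over_root _ _ _ _ _ _ _) => // chi0 s _; exists chi0; rewrite mem_head.
move: F0; rewrite mem_true => /andP[F0 /eqP deg0] chi.
rewrite mem_filter Irr_atE mem_true andbC; apply: andb_id2l => Fchi.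
apply/allP/eqP => [le_chi | -> psi Fpsi]; last exact: degree_ge.
apply/eqP; rewrite eq_le degree_ge // andbT -deg0; exact: le_chi.
Qed.

End Main.

Theorem proposition8p1 (i : nat) (hi : i \in [:: 6; 7; 8]%N)
    (F : finFieldType) (q : nat) (hq : #|F| = q) (alpha : posroot i) :
  exists sdX : (Xcompl F alpha ><| Xgroup F alpha)%g = Sgroup F alpha,
    [/\ alpha \notin Rnormal i ->
          one_to_one
            [seq (mu, lambda) | mu <- Irr_lin (Tbar F alpha),
                                lambda <- Irr_nontriv (Xgroup F alpha)]
            (Irr_mida F alpha) (Psi sdX),
        alpha \in Rnormal i ->
          one_to_one
            [seq (mu, lambda) | mu <- irr (Tbar F alpha),
                                lambda <- Irr_nontriv (Xgroup F alpha)]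
            (Irr_at F alpha) (Psi sdX) &
        size (Irr_mida F alpha) = (q ^ (mida_exp alpha).1 * (q - 1))%N /\
        {in Irr_mida F alpha, forall chi : 'CF(U i F),
           chi 1%g = (q ^ (mida_exp alpha).2)%:R}].
Proof.
exists (source_sdprod F hi alpha); split=> [_ | normal |].
- refine (eq_mem_one_to_one (fun _ => erefl) _ (twist_linear (source_sdprod F hi alpha))).
  by move=> chi; rewrite (Irr_midaE hi alpha).
- rewrite (Irr_atE F hi alpha); exact: (twist_normal (source_sdprod F hi alpha) normal).
rewrite -hq; split.
  rewrite -(size_over_root_linear F hi alpha); apply: perm_size; apply: uniq_perm.
  - by do 2!apply: filter_uniq; apply: uniq_irr.
  - by apply: filter_uniq; apply: uniq_irr.
  exact: Irr_midaE.
move=> chi; rewrite (Irr_midaE hi alpha); exact: over_root_degree.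
Qed.
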